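(* There exists an absolute constant $c>0$ such that the following holds for every $n\ge 1$. Let $\Omega,\Omega'$ be two bounded convex domains in $\mathbb{R}^n$ having piecewise smooth boundaries, with $\Omega\subseteq\Omega'$, and set $v:=\operatorname{vol}\Omega/\operatorname{vol}\Omega'\in[0,1]$. Let $k\geq 3$ be a natural number. (1) If $\Omega$ is symmetric with respect to the origin (i.e. $\Omega=-\Omega$), then $$\lambda^N_{k-2}(\Omega')\geq c\,\min\Big\{\frac{(\log(1-v))^2}{n^8(\log k)^6},\ \frac{1}{n^6(\log k)^4}\Big\}\,\lambda^N_k(\Omega).$$ (2) For general (not necessarily symmetric) $\Omega$, $$\lambda^N_{k-2}(\Omega')\geq c\,\min\Big\{\frac{(\log(1-2^{-n}v))^2}{n^8(\log k)^6},\ \frac{1}{n^6(\log k)^4}\Big\}\,\lambda^N_k(\Omega).$$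
   Context: For a bounded domain $\Omega\subset\mathbb{R}^n$ with piecewise smooth boundary, $0=\lambda_0^N(\Omega)<\lambda_1^N(\Omega)\leq\lambda_2^N(\Omega)\leq\cdots\leq\lambda_k^N(\Omega)\leq\cdots$ denote the Neumann eigenvalues of the (positive) Laplacian on $\Omega$, listed in increasing order, counted with multiplicity, and indexed from $0$. $\operatorname{vol}$ is Lebesgue measure on $\mathbb{R}^n$ and $\log$ is the natural logarithm; when $v=1$, $(\log(1-v))^2$ is read as $+\infty$, so that the minimum in (1) is its second entry. ''Absolute constant'' means a constant independent of everything (of $n$, $k$, $\Omega$, $\Omega'$). *)

(* Defs.v *)
From HB Require Import structures.
From mathcomp Require Import all_boot all_order all_algebra.
From mathcomp Require Import all_classical all_reals all_analysis.

Set Implicit Arguments.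
Unset Strict Implicit.
Unset Printing Implicit Defensive.

Import Order.TTheory GRing.Theory Num.Theory.
Import numFieldNormedType.Exports.

Local Open Scope classical_set_scope.
Local Open Scope ring_scope.

(* The Borel sigma-algebra of R^n, generated by the coordinate maps, as the
   library does for tuples. *)
Section row_measurable.
Context (R : realType) (n : nat).

Let coord (i : 'I_n) (x : 'rV[R]_n) : measurableTypeR R := x 0 i.

Let row_set0 : g_sigma_preimage coord set0.
Proof. exact: sigma_algebra0. Qed.

Let row_setC A : g_sigma_preimage coord A -> g_sigma_preimage coord (~` A).
Proof. exact: sigma_algebraC. Qed.

Let row_bigcup (F : _^nat) : (forall i, g_sigma_preimage coord (F i)) ->
  g_sigma_preimage coord (\bigcup_i F i).
Proof. exact: sigma_algebra_bigcup. Qed.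

HB.instance Definition _ :=
  @isMeasurable.Build (measure_tuple_display R.-ocitv.-measurable.-sigma)
    'rV[R]_n (g_sigma_preimage coord) row_set0 row_setC row_bigcup.

End row_measurable.

Section row_lebesgue_step.
Local Open Scope ereal_scope.
Context (R : realType) (n : nat).
Variable mu : {sigma_finite_measure set 'rV[R]_n -> \bar R}.

Definition row_cons (p : measurableTypeR R * 'rV[R]_n) : 'rV[R]_n.+1 :=
  row_mx (p.1)%:M p.2 : 'rV[R]_(1 + n).

Lemma measurable_coord m (i : 'I_m) :
  measurable_fun setT (fun x : 'rV[R]_m => x ord0 i : measurableTypeR R).
Proof.
move=> _ Y mY; rewrite setTI; apply: sub_sigma_algebra => /=.
rewrite -bigcup_seq/=; exists i => /=; first by rewrite mem_index_enum.
by exists Y => //; rewrite setTI.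
Qed.

Lemma measurable_row_cons : measurable_fun setT row_cons.
Proof.
have gen : g_sigma_preimage (fun i x => row_cons x ord0 i : measurableTypeR R)
    `<=` measurable.
  apply: smallest_sub; first exact: sigma_algebra_measurable.
  rewrite -bigcup_seq => B [i _ [A mA <-]]; rewrite setTI.
  have mi : measurable_fun setT
      (fun p : measurableTypeR R * 'rV[R]_n => row_cons p ord0 i
        : measurableTypeR R).
    have [->|[j ->]] : i = lshift n (ord0 : 'I_1) \/
        exists j : 'I_n, i = rshift 1 j.
      by case: (split_ordP (i : 'I_(1 + n))) => j ->;
        [left; rewrite (ord1 j)|right; exists j].
    - rewrite [X in measurable_fun _ X](_ : _ = fst); first exact: measurable_fst.
      apply/funext => p; apply: etrans (row_mxEl _ _ _ _) _.
      by rewrite mxE eqxx mulr1n.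
    - rewrite [X in measurable_fun _ X](_ : _ =
        (fun x : 'rV[R]_n => x ord0 j : measurableTypeR R) \o snd).
        exact: (measurableT_comp (measurable_coord j) measurable_snd).
      by apply/funext => p; apply: etrans (row_mxEr _ _ _ _) _.
  by have := mi measurableT A mA; rewrite setTI.
move=> _ B mB; rewrite setTI; apply: gen.
rewrite (g_sigma_preimage_comp
  (fun i (x : 'rV[R]_n.+1) => x ord0 i : measurableTypeR R)).
exists B => //.
by rewrite setTI.
Qed.

Definition row_lebesgue_step : set 'rV[R]_n.+1 -> \bar R :=
  pushforward (lebesgue_measure \x mu) row_cons.

Let step0 : row_lebesgue_step set0 = 0.
Proof. by rewrite /row_lebesgue_step /pushforward preimage_set0 measure0. Qed.

Let step_ge0 A : 0 <= row_lebesgue_step A.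
Proof. exact: (measure_ge0 (lebesgue_measure \x mu) (row_cons @^-1` A)). Qed.

Let step_sigma_additive : semi_sigma_additive row_lebesgue_step.
Proof.
move=> F mF tF mUF; rewrite /row_lebesgue_step /pushforward preimage_bigcup.
apply: measure_semi_sigma_additive.
- by move=> k; rewrite -[X in measurable X]setTI; exact: measurable_row_cons.
- apply/trivIsetP => /= i j _ _ ij; rewrite -preimage_setI.
  by move/trivIsetP : tF => /(_ _ _ _ _ ij) ->//; rewrite preimage_set0.
- rewrite -preimage_bigcup -[X in measurable X]setTI.
  exact: measurable_row_cons.
Qed.

HB.instance Definition _ := isMeasure.Build _ _ _
  row_lebesgue_step step0 step_ge0 step_sigma_additive.

Let measurable_row_behead :
  measurable_fun setT (fun x : 'rV[R]_n.+1 => rsubmx (x : 'rV[R]_(1 + n))).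
Proof.
have gen : g_sigma_preimage (fun j (x : 'rV[R]_n.+1) =>
    rsubmx (x : 'rV[R]_(1 + n)) ord0 j : measurableTypeR R) `<=` measurable.
  apply: smallest_sub; first exact: sigma_algebra_measurable.
  rewrite -bigcup_seq => B [i _ [A mA <-]].
  rewrite (_ : (fun x : 'rV[R]_n.+1 => _) =
    (fun x : 'rV[R]_n.+1 => x ord0 (rshift 1 i) : measurableTypeR R)).
    exact: (measurable_coord (rshift 1 i : 'I_n.+1)).
  by apply/funext => x; rewrite mxE.
move=> _ B mB; rewrite setTI; apply: gen.
rewrite (g_sigma_preimage_comp
  (fun j (y : 'rV[R]_n) => y ord0 j : measurableTypeR R)).
by exists B => //; rewrite setTI.
Qed.

Let step_sigma_finite : sigma_finite setT row_lebesgue_step.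
Proof.
have /sigma_finiteP[F [TF ndF Foo]] := sigma_finiteT (@lebesgue_measure R).
have /sigma_finiteP[G [TG ndG Goo]] := sigma_finiteT mu.
exists (fun k => [set x : 'rV[R]_n.+1 |
    F k (x ord0 ord0) /\ G k (rsubmx (x : 'rV[R]_(1 + n)))]).
  rewrite predeqE => x; split => // _.
  have [i _ Fi] : (\bigcup_k F k) (x ord0 ord0) by rewrite -TF.
  have [j _ Gj] : (\bigcup_k G k) (rsubmx (x : 'rV[R]_(1 + n))) by rewrite -TG.
  exists (maxn i j) => //; split.
  - by move: Fi; exact/subsetPset/ndF/leq_maxl.
  - by move: Gj; exact/subsetPset/ndG/leq_maxr.
move=> k; have [mF Fk] := Foo k; have [mG Gk] := Goo k; split.
  apply: measurableI.
    have := measurable_coord (@ord0 n) measurableT mF.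
    by rewrite setTI.
  have := measurable_row_behead measurableT mG.
  by rewrite setTI.
rewrite /row_lebesgue_step /pushforward.
rewrite (_ : _ @^-1` _ = F k `*` G k).
  by rewrite product_measure1E// lte_mul_pinfty// ge0_fin_numE.
rewrite predeqE => -[a y] /=.
have -> : row_cons (a, y) ord0 (ord0 : 'I_n.+1) = a.
  rewrite (_ : (ord0 : 'I_n.+1) = lshift n (ord0 : 'I_1)) ; last exact: val_inj.
  apply: etrans (row_mxEl (a%:M : 'rV[R]_1) y _ _) _.
  by rewrite mxE eqxx mulr1n.
have -> : rsubmx (row_cons (a, y) : 'rV[R]_(1 + n)) = y by exact: row_mxKr.
by [].
Qed.

HB.instance Definition _ := Measure_isSigmaFinite.Build _ _ _
  row_lebesgue_step step_sigma_finite.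

End row_lebesgue_step.

(* Lebesgue measure on R^n: the n-fold product of the one-dimensional one. *)
Fixpoint lebesgue_row (R : realType) (n : nat) :
    {sigma_finite_measure set 'rV[R]_n -> \bar R} :=
  if n is m.+1 then row_lebesgue_step (lebesgue_row R m) else \d_(0 : 'rV[R]_0).

Section smooth.
Context (R : realType).

Definition partial n (i : 'I_n) (f : 'rV[R]_n -> R) : 'rV[R]_n -> R :=
  fun x => 'D_(delta_mx ord0 i) f x.

Definition partials n (s : seq 'I_n) (f : 'rV[R]_n -> R) : 'rV[R]_n -> R :=
  foldr (@partial n) f s.

(* C^infinity on the whole of R^n: all iterated partial derivatives, of every
   order, exist and are continuous. *)
Definition smooth n (f : 'rV[R]_n -> R) : Prop :=
  forall s : seq 'I_n, continuous (partials s f) /\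
    forall (i : 'I_n) x, derivable (partials s f) x (delta_mx ord0 i).

Definition smooth_map m n (f : 'rV[R]_m -> 'rV[R]_n) : Prop :=
  forall j : 'I_n, smooth (fun x => f x ord0 j).

Definition closed_cube m : set 'rV[R]_m :=
  [set x | forall i, 0 <= x ord0 i <= 1].

Definition open_cube m : set 'rV[R]_m :=
  [set x | forall i, 0 < x ord0 i < 1].

(* The boundary of Omega is a finite union of smooth patches, each parametrized
   by the closed unit cube of R^(n-1), regular and one-to-one on the open cube,
   the images of the open cubes being pairwise disjoint.  Up to the boundary of
   the cube only smoothness is required, so that cones are covered as well as
   polytopes and domains with smooth boundary. *)
Definition piecewise_smooth_boundary n (Omega : set 'rV[R]_n) : Prop :=
  exists (N : nat) (phi : 'I_N -> 'rV[R]_n.-1 -> 'rV[R]_n),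
    [/\ forall a, smooth_map (phi a),
        forall a x, open_cube x -> row_free (jacobian (phi a) x),
        forall a b x y, open_cube x -> open_cube y -> phi a x = phi b y ->
          a = b /\ x = y &
        closure Omega `\` Omega = \bigcup_(a in setT) (phi a @` @closed_cube _)].

(* [closure Omega `\` Omega] above is the topological boundary as Omega is open;
   connectedness of a domain follows from convexity. *)
Definition bounded_convex_domain n (Omega : set 'rV[R]_n) : Prop :=
  [/\ Omega !=set0, open Omega, bounded_set Omega, convex_set Omega &
      piecewise_smooth_boundary Omega].

End smooth.

Section neumann.
Context (R : realType) (n : nat).
Implicit Types (Omega : set 'rV[R]_n) (u v : 'rV[R]_n -> R)
  (g h : 'I_n -> 'rV[R]_n -> R).

Local Notation vol := (lebesgue_row R n).

Definition square_integrable Omega u : Prop :=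
  measurable_fun Omega (u : 'rV[R]_n -> measurableTypeR R) /\
  (\int[vol]_(x in Omega) ((u x) ^+ 2)%:E < +oo)%E.

Definition test_function Omega u : Prop :=
  smooth u /\
  exists K : set 'rV[R]_n, [/\ compact K, K `<=` Omega &
    forall x, ~ K x -> u x = 0].

Definition weak_gradient Omega u g : Prop :=
  forall (phi : 'rV[R]_n -> R), test_function Omega phi -> forall i,
    \int[vol]_(x in Omega) (u x * partial i phi x) =
    - \int[vol]_(x in Omega) (g i x * phi x).

(* u lies in the Sobolev space H^1(Omega), with weak gradient g. *)
Definition sobolev1 Omega u g : Prop :=
  [/\ square_integrable Omega u, forall i, square_integrable Omega (g i) &
      weak_gradient Omega u g].

(* Weak formulation of  - Delta u = lambda u  in Omega with vanishing normal
   derivative on the boundary. *)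
Definition neumann_eigenfunction Omega (lambda : R) u : Prop :=
  ~ {ae vol, forall x, Omega x -> u x = 0} /\
  exists g, sobolev1 Omega u g /\
    forall v h, sobolev1 Omega v h ->
      \int[vol]_(x in Omega) (\sum_i g i x * h i x) =
      lambda * \int[vol]_(x in Omega) (u x * v x).

Definition independent_on Omega m (u : 'I_m -> 'rV[R]_n -> R) : Prop :=
  forall a : 'I_m -> R,
    {ae vol, forall x, Omega x -> \sum_i a i * u i x = 0} ->
    forall i, a i = 0.

(* The entry of index k, counting from 0, in the increasing list of the Neumann
   eigenvalues repeated according to multiplicity: the least t for which the
   eigenspaces of the eigenvalues at most t have total dimension at least k+1
   (+oo if there were no such t). *)
Definition neumann_eigenvalue Omega (k : nat) : \bar R :=
  ereal_inf [set t%:E | t in [set t : R |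
    exists (lambda : 'I_k.+1 -> R) (u : 'I_k.+1 -> 'rV[R]_n -> R),
      (forall i, neumann_eigenfunction Omega (lambda i) (u i) /\
                 lambda i <= t) /\
      independent_on Omega u]].

Definition volume_ratio Omega Omega' : R :=
  fine (vol Omega) / fine (vol Omega').

(* With w = 1 the first entry is +oo, because lne 0 = -oo. *)
Definition neumann_factor (k : nat) (w : R) : \bar R :=
  Order.min
    ((lne (1 - w)%:E) ^+ 2 * ((n%:R ^+ 8 * ln k%:R ^+ 6)^-1)%:E)%E
    ((n%:R ^+ 6 * ln k%:R ^+ 4)^-1)%:E.

End neumann.

(* Main.v *)
Require Import Defs.
From mathcomp Require Import all_boot all_order all_algebra.
From mathcomp Require Import all_classical all_reals all_analysis.
From mathcomp Require Import measurable_realfun ring lra.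

(* The factors [n^8 (log k)^6] and [n^6 (log k)^4] absorb all logarithms, so that
   it suffices to show [lambda_{k-2}(Omega') >= c w^2 / n^4 lambda_k(Omega)],
   where [w] is the proportion of the volume of [Omega'] occupied by a convex
   [S] inside [Omega] with a centre of symmetry: [S = Omega] in (1), and in (2)
   [S] is the intersection of [Omega] with a reflected copy [x - Omega], for [x]
   such that it has at least half the average volume.

   Choose [r] such that [Omega] contains [k+1] points at mutual distances at
   least [r] but not [k+1] points at mutual distances at least [2r].  Tents on
   disjoint balls of radius [r/2] around the former have Rayleigh quotient
   [O(n^2 / r^2)], by comparison with the homothety of ratio [1 - 1/(2n)], whence
   [lambda_k(Omega) = O(n^2 / r^2)].  Also [Omega] does not contain [k-1] points
   at mutual distances at least [8r] (two more could be inserted on a segment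
   between two of these), so [k-2] balls of radius [8r] cover it, in particular
   [S].  Disjoint homothetic copies of [S] along a segment show that [Omega'] is
   contained in the homothetic image of [S] of ratio [T = O(n / w)], hence [k-2]
   balls of radius [8rT] cover [Omega'].  Splitting [Omega'] into convex cells of
   radius [8rT] and applying on each cell the Poincare inequality, derived from
   Prekopa-Leindler, gives [lambda_{k-2}(Omega') >= c / (rT)^2]. *)

Set Implicit Arguments.
Unset Strict Implicit.
Unset Printing Implicit Defensive.

Import Order.TTheory GRing.Theory Num.Theory.
Import numFieldNormedType.Exports.

Local Open Scope classical_set_scope.
Local Open Scope ring_scope.

(** * Lebesgue measure on row vectors *)

(** The Neumann eigenvalues are defined through eigenfunctions and not by a min-max formula, and
    this asymmetry shapes the proof. The lower bound takes eigenfunctions as given: among k - 1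
    independent ones, some combination has zero mean on each of k - 2 cells. The upper bound must
    manufacture eigenfunctions out of the tents, which requires a spectral theorem, hence the
    completeness of H^1 and a compactness property of its embedding into L^2. Compactness is again
    the Poincare inequality on cells, now for a fine net: up to finitely many cell means, the L^2
    norm is controlled by a small multiple of the energy. Prekopa-Leindler thus serves both bounds.
    The obstacle in the Poincare inequality is regularity: Prekopa-Leindler asks for a pointwise
    first-order inequality with quadratic error. A Sobolev function satisfies it only after
    mollification, and only at a distance from the boundary. Convex cells are therefore exhausted by
    convex subsets that stay away from the boundary. *)

Lemma measurable_row (R : realType) d (T : measurableType d) n
    (f : T -> 'rV[R]_n) :
  (forall i, measurable_fun setT (fun x => f x ord0 i)) ->
  measurable_fun setT f.
Proof.
move=> mf.
have gen : g_sigma_preimage (fun i x => f x ord0 i : measurableTypeR R)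
    `<=` measurable.
  apply: smallest_sub; first exact: sigma_algebra_measurable.
  rewrite -bigcup_seq => B [i _ [A mA <-]]; rewrite setTI.
  by have := mf i measurableT A mA; rewrite setTI.
move=> _ B mB; rewrite setTI; apply: gen.
rewrite (g_sigma_preimage_comp
  (fun i (x : 'rV[R]_n) => x ord0 i : measurableTypeR R)).
by exists B => //; rewrite setTI.
Qed.

Lemma measurable_row_coord (R : realType) n (i : 'I_n) :
  measurable_fun setT (fun x : 'rV[R]_n => x ord0 i).
Proof. exact: measurable_coord. Qed.

Lemma measurable_row_affine (R : realType) n (a : R) (b : 'rV[R]_n) :
  measurable_fun setT (fun x : 'rV[R]_n => a *: x + b).
Proof.
apply: measurable_row => i.
rewrite (_ : (fun x => _) = (fun x : 'rV[R]_n => a * x ord0 i + b ord0 i)); last first.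
  by apply/funext => x; rewrite !mxE.
apply: measurable_funD => //; apply: measurable_funM => //.
exact: measurable_row_coord.
Qed.

Lemma integral_row_step (R : realType) n (f : 'rV[R]_n.+1 -> \bar R) :
  measurable_fun setT f -> (forall x, 0 <= f x)%E ->
  (\int[lebesgue_row R n.+1]_x f x =
  \int[lebesgue_measure]_a \int[lebesgue_row R n]_y f (row_cons (a, y)))%E.
Proof.
move=> mf f0.
rewrite [LHS](@ge0_integral_pushforward _ _ _ _ R _ (@measurable_row_cons R n)
  (lebesgue_measure \x lebesgue_row R n)%E) //.
rewrite preimage_setT fubini_tonelli1 //=.
- exact: (measurableT_comp mf (@measurable_row_cons R n)).
Qed.

(** By uniqueness of Lebesgue measure it suffices to compare it with the pushforward, rescaled by
    [|a|], on half-open intervals. The sign of [a] decides which end of the preimage is closed. *)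
Lemma ge0_integral_affine1 (R : realType) (a b : R) (f : R -> \bar R) :
  a != 0 -> measurable_fun setT f -> (forall x, 0 <= f x)%E ->
  (\int[lebesgue_measure]_x f (a * x + b)%R =
   `|a|^-1%:E * \int[lebesgue_measure]_x f x)%E.
Proof.
move=> a0 mf f0.
pose phi : measurableTypeR R -> measurableTypeR R := fun x => a * x + b.
have mphi : @measurable_fun _ _ (measurableTypeR R) (measurableTypeR R) setT phi.
  exact: measurable_funD.
pose pm := measure_function_pushforward__canonical__measure_function_Measure lebesgue_measure mphi.
have na : 0 <= `|a| by [].
have key A : measurable A -> lebesgue_measure A =
    mscale (NngNum na) pm A.
  apply: lebesgue_measure_unique => _ [[u v] /= _ <-].
  rewrite /mscale/= /pushforward /=.
  have [an|ap|a00] := ltgtP a 0; last by rewrite a00 eqxx in a0.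
    rewrite (_ : phi @^-1` _ = `[(v - b) / a, (u - b) / a[%classic); last first.
      apply/seteqP; split => x /=; rewrite !in_itv/= /phi ler_ndivrMr// ltr_ndivlMr// lerBrDr ltrBlDr;
      by rewrite [x * a]mulrC andbC.
    rewrite !lebesgue_measure_itv/= !lte_fin ltr_nM2r ?invr_lt0//.
    rewrite ltrD2r; case: ifPn => // _; last by rewrite mule0.
    by rewrite -!EFinB -EFinM ltr0_norm//; congr EFin; field.
  rewrite (_ : phi @^-1` _ = `](u - b) / a, (v - b) / a]%classic); last first.
    apply/seteqP; split => x /=; rewrite !in_itv/= /phi ler_pdivlMr// ltr_pdivrMr// lerBrDr ltrBlDr;
      by rewrite [x * a]mulrC.
  rewrite !lebesgue_measure_itv/= !lte_fin ltr_pM2r ?invr_gt0//.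
  rewrite ltrD2r; case: ifPn => // _; last by rewrite mule0.
  by rewrite -!EFinB -EFinM gtr0_norm//; congr EFin; field.
rewrite [in RHS](eq_measure_integral (mscale (NngNum na) pm)); last first.
  by move=> A mA _; exact: key.
rewrite ge0_integral_mscale//= muleA -EFinM mulVf ?normr_eq0// mul1e.
apply/esym.
exact: (@ge0_integral_pushforward _ _ (measurableTypeR R) (measurableTypeR R) R
  phi mphi lebesgue_measure setT f measurableT mf (fun x _ => f0 x)).
Qed.

Definition row_behead (R : realType) n (x : 'rV[R]_n.+1) : 'rV[R]_n :=
  \row_j x ord0 (lift ord0 j).

Lemma row_cons0 (R : realType) n (p : R * 'rV[R]_n) :
  row_cons p ord0 ord0 = p.1.
Proof.
rewrite /row_cons (_ : (ord0 : 'I_n.+1) = lshift n (ord0 : 'I_1)); last exact: val_inj.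
by apply: etrans (row_mxEl _ _ _ _) _; rewrite mxE eqxx mulr1n.
Qed.

Lemma row_consS (R : realType) n (p : R * 'rV[R]_n) j :
  row_cons p ord0 (lift ord0 j) = p.2 ord0 j.
Proof.
rewrite /row_cons (_ : lift ord0 j = rshift 1 j); last exact: val_inj.
exact: row_mxEr.
Qed.

Lemma row_consP (R : realType) n (x y : 'rV[R]_n.+1) :
  x ord0 ord0 = y ord0 ord0 ->
  (forall j, x ord0 (lift ord0 j) = y ord0 (lift ord0 j)) -> x = y.
Proof.
move=> x0 xS; apply/rowP => i.
by case: (unliftP ord0 i) => [j|] ->.
Qed.

Lemma row_cons_affine (R : realType) n (a : R) (b : 'rV[R]_n.+1) (p : R * 'rV[R]_n) :
  a *: row_cons p + b = row_cons (a * p.1 + b ord0 ord0,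
    a *: p.2 + row_behead b).
Proof.
apply: row_consP => [|j].
  by rewrite row_cons0 mxE [X in X + _]mxE row_cons0.
by rewrite row_consS mxE [X in X + _]mxE row_consS !mxE.
Qed.

Lemma measurable_fun_row_step (R : realType) n (f : 'rV[R]_n.+1 -> \bar R) :
  measurable_fun setT f -> (forall x, 0 <= f x)%E ->
  measurable_fun setT (fun a : R => \int[lebesgue_row R n]_y f (row_cons (a, y)))%E.
Proof.
move=> mf f0.
exact: (@measurable_fun_fubini_tonelli_F _ _ _ _ R (lebesgue_row R n) _
  (measurableT_comp mf (@measurable_row_cons R n)) (fun x => f0 _)).
Qed.

Lemma measurable_fun_row_cons (R : realType) d (T : measurableType d) n
    (f : 'rV[R]_n.+1 -> T) (a : R) :
  measurable_fun setT f ->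
  measurable_fun setT (fun y : 'rV[R]_n => f (row_cons (a, y))).
Proof.
move=> mf.
have mf2 : measurable_fun setT (fun p : R * 'rV[R]_n => f (row_cons p)).
  exact: (measurableT_comp mf (@measurable_row_cons R n)).
exact: (measurableT_comp mf2 (measurable_pair1 _)).
Qed.

(** Induction on the dimension, each coordinate contributing one factor [|a|^-1] through Tonelli. *)
Lemma ge0_integral_affine (R : realType) n (a : R) (b : 'rV[R]_n)
    (f : 'rV[R]_n -> \bar R) :
  a != 0 -> measurable_fun setT f -> (forall x, 0 <= f x)%E ->
  (\int[lebesgue_row R n]_x f (a *: x + b)%R =
   (`|a| ^- n)%:E * \int[lebesgue_row R n]_x f x)%E.
Proof.
move=> a0; elim: n b f => [|n IH] b f mf f0.
  rewrite expr0 invr1 mul1e; apply: eq_integral => x _; congr f.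
  by apply/rowP; case.
have mF := measurable_fun_row_step mf f0.
rewrite !integral_row_step//; last first.
  exact: (measurableT_comp mf (measurable_row_affine a b)).
under eq_integral => x _ do under eq_integral => y _ do rewrite row_cons_affine /=.
under eq_integral => x _.
  rewrite (IH _ (fun y => f (row_cons ((a * x + b ord0 ord0)%R, y))))//; last first.
    exact: measurable_fun_row_cons.
  over.
rewrite /=.
transitivity ((`|a| ^- n)%:E * \int[lebesgue_measure]_x
   \int[lebesgue_row R n]_y f (row_cons ((a * x + b ord0 ord0)%R, y)))%E.
  apply: (@ge0_integralZl _ _ R (@lebesgue_measure R) setT measurableT
    (fun x => \int[lebesgue_row R n]_y f (row_cons ((a * x + b ord0 ord0)%R, y)))%E).
  - have maff : measurable_fun setT (fun x : R => a * x + b ord0 ord0).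
      exact: measurable_funD.
    exact: (measurableT_comp mF maff).
  - by move=> x _; exact: integral_ge0.
  - by rewrite lee_fin invr_ge0 exprn_ge0.
rewrite (@ge0_integral_affine1 R a (b ord0 ord0) (fun x => \int[lebesgue_row R n]_y f (row_cons (x, y)))%E a0 mF).
  by rewrite muleA -EFinM -invfM -exprSr.
by move=> x; exact: integral_ge0.
Qed.

Lemma lebesgue_row_affine (R : realType) n (a : R) (b : 'rV[R]_n) (A : set 'rV[R]_n) :
  a != 0 -> measurable A ->
  (lebesgue_row R n [set x | A (a *: x + b)%R] =
   (`|a| ^- n)%:E * lebesgue_row R n A)%E.
Proof.
move=> a0 mA.
have mB : measurable [set x | A (a *: x + b)].
  by have := measurable_row_affine a b measurableT mA; rewrite setTI.
rewrite -[X in lebesgue_row R n X]setIT -integral_indic//.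
rewrite -[X in (_ * lebesgue_row R n X)%E]setIT -integral_indic//.
apply: (@ge0_integral_affine R n a b (fun x => (\1_A x)%:E)) => //.
by apply/measurable_EFinP; exact: measurable_indic.
Qed.

Lemma ball_row (R : realType) n (x y : 'rV[R]_n) (e : R) :
  0 < e -> (forall i, `|x ord0 i - y ord0 i| < e) -> ball x e y.
Proof. by move=> e0 H; split => // i j; rewrite ord1; exact: H. Qed.

Lemma measurable_forall_ord n d (T : measurableType d)
    (P : 'I_n -> set T) :
  (forall i, measurable (P i)) -> measurable [set x | forall i, P i x].
Proof.
move=> mP; rewrite (_ : [set x | _] = \bigcap_(i in [set: 'I_n]) P i).
  exact: fin_bigcap_measurable.
by apply/seteqP; split => x /= H i; [move=> _; exact: H|exact: H].
Qed.

Lemma measurable_lt_cst (R : realType) d (T : measurableType d) (f : T -> R) (a : R) :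
  measurable_fun setT f -> measurable [set x | f x < a].
Proof.
move=> mf; have := mf measurableT `]-oo, a[%classic (measurable_itv _).
by rewrite setTI; congr measurable; apply/seteqP; split => x /=; rewrite in_itv.
Qed.

Lemma measurable_le_cst (R : realType) d (T : measurableType d) (f : T -> R) (a : R) :
  measurable_fun setT f -> measurable [set x | f x <= a].
Proof.
move=> mf; have := mf measurableT `]-oo, a]%classic (measurable_itv _).
by rewrite setTI; congr measurable; apply/seteqP; split => x /=; rewrite in_itv.
Qed.

(** The sigma-algebra is generated by the coordinates and not by the topology. An open set is the
    countable union of the boxes with rational centre and half-side 1/(k+1) that it contains. *)
Lemma open_measurable_row (R : realType) n (U : set 'rV[R]_n) :
  open U -> measurable U.
Proof.
move=> oU.
pose box (p : 'rV[rat]_n * nat) : set 'rV[R]_n :=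
  [set x | forall i, `|x ord0 i - ratr (p.1 ord0 i)| < p.2.+1%:R^-1].
pose F p := if `[< box p `<=` U >] then box p else set0.
have mbox p : measurable (box p).
  apply: measurable_forall_ord => i; apply: measurable_lt_cst.
  apply: measurableT_comp => //; apply: measurable_funB => //.
  exact: measurable_row_coord.
rewrite (_ : U = \bigcup_p F p); last first.
  apply/seteqP; split => [x Ux|x [p _]]; rewrite /F; last by case: asboolP => // H /H.
  have /nbhs_ballP[e /= e0 He] := oU _ Ux.
  have [k _ /(_ k (leqnn _)) kP] : \forall k \near \oo, k.+1%:R^-1 < e / 2.
    by apply: near_infty_natSinv_lt (PosNum _); rewrite divr_gt0.
  have /choice[q qP] : forall i, exists q : rat, ratr q \in `]x ord0 i, x ord0 i + k.+1%:R^-1[.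
    by move=> i; apply: rat_in_itvoo; rewrite ltrDl invr_gt0.
  exists (\row_i q i, k) => //.
  have bx : box (\row_i q i, k) x.
    move=> i /=; rewrite mxE; have := qP i; rewrite in_itv/= => /andP[h1 h2].
    by rewrite distrC ger0_norm ?subr_ge0 ?ltW// ltrBlDl.
  case: asboolP => // -[] y yb; apply: He; apply: ball_row => // i.
  rewrite (le_lt_trans (ler_distD (ratr ((\row_i q i) ord0 i)) _ _))//.
  rewrite (splitr e) ltrD ?(lt_trans _ kP) ?(bx i)//.
  by rewrite distrC; exact: yb.
apply: countable_bigcupT_measurable => [|p]; first exact: countableP.
by rewrite /F; case: asboolP.
Qed.

Lemma continuous_measurable_row (R : realType) n (f : 'rV[R]_n -> R) :
  continuous f -> measurable_fun setT f.
Proof.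
move=> /continuousP cf; apply: (measurability _ (RGenOpens.measurableE R)).
move=> _ [_ [a [b ->] <-]]; rewrite setTI; apply: open_measurable_row.
by apply: cf; exact: interval_open.
Qed.

Definition cube (R : realType) n (L : R) : set 'rV[R]_n :=
  [set x | forall i, `|x ord0 i| <= L].

Lemma measurable_cube (R : realType) n (L : R) : measurable (@cube R n L).
Proof.
apply: measurable_forall_ord => i; apply: measurable_le_cst.
by apply: measurableT_comp => //; exact: measurable_row_coord.
Qed.

Lemma lebesgue_row_cube (R : realType) n (L : R) : 0 <= L ->
  lebesgue_row R n (cube L) = ((L *+ 2) ^+ n)%:E.
Proof.
move=> L0; elim: n => [|n IH].
  rewrite /= expr0 diracE mem_set//; by case.
rewrite -[X in lebesgue_row _ _ X]setIT -integral_indic//; last exact: measurable_cube.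
rewrite integral_row_step//; last first.
  by apply/measurable_EFinP; apply: measurable_indic; exact: measurable_cube.
under eq_integral => a _.
  under eq_integral => y _.
    rewrite (_ : \1_(cube L) (row_cons (a, y)) = \1_(`[-L, L]%classic) a * \1_(cube L) y); last first.
      rewrite !indicE -natrM mulnb; congr (_%:R); congr nat_of_bool.
      apply/idP/andP; rewrite !inE /= in_itv/= -ler_norml.
        move=> H; split; first by have := H ord0; rewrite row_cons0.
        by move=> i; have := H (lift ord0 i); rewrite row_consS.
      move=> [aL yL] i; case: (unliftP ord0 i) => [j|] ->.
        by rewrite row_consS; exact: yL.
      by rewrite row_cons0.
    rewrite EFinM; over.
  rewrite ge0_integralZl//; last first.
    by apply/measurable_EFinP; apply: measurable_indic; exact: measurable_cube.
  rewrite integral_indic// ?setIT; last exact: measurable_cube.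
  over.
rewrite /= ge0_integralZr//; last first.
  by apply/measurable_EFinP; apply: measurable_indic.
have -> : (\int[@lebesgue_measure R]_x (\1_`[- L, L] x)%:E = (L *+ 2)%:E)%E.
  rewrite integral_indic// setIT.
  apply: etrans (lebesgue_measure_itv `[- L, L]) _; rewrite /= lte_fin.
  have [LL|LL] := ltP (- L) L; first by rewrite -EFinB mulr2n opprK.
  by have -> : L = 0 by [lra]; rewrite mul0rn.
by rewrite [X in (_ * X)%E]IH -EFinM exprS.
Qed.

Lemma open_lebesgue_row_gt0 (R : realType) n (U : set 'rV[R]_n) :
  open U -> U !=set0 -> (0 < lebesgue_row R n U)%E.
Proof.
move=> oU [x Ux].
have /nbhs_ballP[e /= e0 He] := oU _ Ux.
have sub : [set y | cube (e / 2) (1 *: y + - x)] `<=` U.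
  move=> y /= yc; apply: He; apply: ball_row => // i.
  have := yc i; rewrite !mxE mul1r distrC => /le_lt_trans; apply.
  by rewrite ltr_pdivrMr// ltr_pMr// ltr1n.
apply: (@lt_le_trans _ _ (lebesgue_row R n [set y | cube (e / 2) (1 *: y + - x)])).
  rewrite lebesgue_row_affine ?oner_neq0//; last exact: measurable_cube.
  rewrite normr1 expr1n invr1 mul1e lebesgue_row_cube ?divr_ge0 ?ltW//.
  by rewrite lte_fin exprn_gt0// pmulrn_rgt0// divr_gt0.
apply: le_measure => //; rewrite inE; last exact: open_measurable_row.
have := measurable_row_affine 1 (- x) measurableT (@measurable_cube R n (e / 2)).
by rewrite setTI.
Qed.

Lemma bounded_set_cube (R : realType) n (A : set 'rV[R]_n) :
  bounded_set A -> exists2 L : R, 0 < L & A `<=` cube L.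
Proof.
move=> [M [Mr MA]]; exists (`|M| + 1); first by rewrite ltr_wpDl.
move=> x Ax i; have := MA (`|M| + 1).
rewrite (le_lt_trans (ler_norm M)) ?ltrDl// => /(_ isT x Ax); apply: le_trans.
rewrite [leRHS]/Num.Def.normr/= mx_normrE.
by apply: (le_bigmax _ (fun i : 'I_1 * 'I_n => `|x i.1 i.2|) (ord0, i)).
Qed.

Lemma bounded_lebesgue_row_lty (R : realType) n (A : set 'rV[R]_n) :
  measurable A -> bounded_set A -> (lebesgue_row R n A < +oo)%E.
Proof.
move=> mA /bounded_set_cube[L L0 AL].
apply: (@le_lt_trans _ _ (lebesgue_row R n (cube L))).
  by apply: le_measure => //; rewrite inE//; exact: measurable_cube.
by rewrite lebesgue_row_cube ?ltry// ltW.
Qed.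

(** * The Prekopa-Leindler inequality *)

Lemma lebesgue_affine1 (R : realType) (a b : R) (A : set R) :
  a != 0 -> measurable A ->
  (lebesgue_measure [set x : R | A (a * x + b)%R] =
   `|a|^-1%:E * lebesgue_measure A)%E.
Proof.
move=> a0 mA.
have maff : measurable_fun setT (fun x : R => a * x + b).
  exact: measurable_funD.
have mB : measurable [set x | A (a * x + b)].
  by have := maff measurableT _ mA; rewrite setTI.
rewrite -[X in lebesgue_measure X]setIT -integral_indic//.
rewrite -[X in (_ * lebesgue_measure X)%E]setIT -integral_indic//.
apply: (@ge0_integral_affine1 R a b (fun x => (\1_A x)%:E)) => //.
by apply/measurable_EFinP; exact: measurable_indic.
Qed.

(** Take [a] in [A] near its supremum and [b] in [B] near its infimum. The midpoints of [b] with the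
    part of [A] below [a], and of [a] with the part of [B] above [b], lie in [C] on opposite sides
    of (a + b)/2, so their measures add up. Since the supremum and the infimum need not be attained,
    each truncation loses at most e/2. *)
Lemma brunn_minkowski1 (R : realType) (A B C : set R) (L : R) :
  measurable A -> measurable B -> measurable C ->
  A !=set0 -> B !=set0 ->
  (forall x, A x -> `|x| <= L) -> (forall x, B x -> `|x| <= L) ->
  (forall x y, A x -> B y -> C ((x + y) / 2)) ->
  (lebesgue_measure A + lebesgue_measure B <= 2%:E * lebesgue_measure C)%E.
Proof.
move=> mA mB mC A0 B0 AL BL ABC.
apply/lee_addgt0Pr => e e0.
have supA : has_sup A.
  by split => //; exists L => x /AL; rewrite ler_norml => /andP[].
have infB : has_inf B.
  by split => //; exists (- L) => x /BL; rewrite ler_norml => /andP[].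
have [a Aa ale] := sup_adherent (divr_gt0 e0 (ltr0Sn _ 1)) supA.
have [b Bb ble] := inf_adherent (divr_gt0 e0 (ltr0Sn _ 1)) infB.
pose A1 := A `&` `]-oo, a[%classic.
pose B1 := B `&` `]b, +oo[%classic.
have mA1 : measurable A1 by exact: measurableI.
have mB1 : measurable B1 by exact: measurableI.
have mI (c : R) : (lebesgue_measure (`[c, (c + e / 2)%R]%classic : set R) <= (e / 2)%:E)%E.
  by rewrite lebesgue_measure_itv/= lte_fin ltrDl divr_gt0// -EFinB addrAC subrr add0r.
have hA : (lebesgue_measure A <= lebesgue_measure A1 + (e / 2)%:E)%E.
  apply: (@le_trans _ _ (lebesgue_measure (A1 `|` `[a, a + e / 2]%classic))).
    apply: le_measure; rewrite ?inE//; first exact: measurableU.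
    move=> x Ax; have [xa|ax] := ltP x a; first by left; split => //=; rewrite in_itv.
    right; rewrite /= in_itv/= ax/= (le_trans (ub_le_sup supA.2 Ax))//.
    by rewrite -lerBlDr ltW.
  apply: (le_trans (measureU2 _ _ _)) => //.
  by apply: leeD2l; exact: mI.
have hB : (lebesgue_measure B <= lebesgue_measure B1 + (e / 2)%:E)%E.
  apply: (@le_trans _ _ (lebesgue_measure (B1 `|` `[b - e / 2, b]%classic))).
    apply: le_measure; rewrite ?inE//; first exact: measurableU.
    move=> x Bx; have [xb|bx] := ltP b x; first by left; split => //=; rewrite in_itv/= xb.
    right; rewrite /= in_itv/= bx andbT (le_trans _ (ge_inf infB.2 Bx))//.
    by rewrite lerBlDr ltW.
  apply: (le_trans (measureU2 _ _ _)) => //.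
  apply: leeD2l; have := mI (b - e / 2); rewrite subrK; exact.
pose C1 := [set x : R | A1 (2 * x + - b)].
pose C2 := [set x : R | B1 (2 * x + - a)].
have maff (c : R) : measurable_fun setT (fun x : R => 2 * x + c).
  exact: measurable_funD.
have mC1 : measurable C1 by have := maff (- b) measurableT _ mA1; rewrite setTI.
have mC2 : measurable C2 by have := maff (- a) measurableT _ mB1; rewrite setTI.
have C12 : C1 `&` C2 = set0.
  apply/seteqP; split => // x [[_ /=]]; rewrite in_itv/= => h1 [_ /=].
  by rewrite in_itv/= andbT => h2; lra.
have sub : C1 `|` C2 `<=` C.
  move=> x [[Ax _]|[Bx _]].
    by have := ABC _ _ Ax Bb; congr C; field.
  by have := ABC _ _ Aa Bx; congr C; field.
have : (lebesgue_measure C1 + lebesgue_measure C2 <= lebesgue_measure C)%E.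
  rewrite -measureU//; apply: le_measure; rewrite ?inE//.
  exact: measurableU.
have two0 : (2 : R) != 0 by rewrite pnatr_eq0.
rewrite !lebesgue_affine1// -ge0_muleDr// ger0_norm// => H.
apply: (@le_trans _ _ (lebesgue_measure A1 + (e/2)%:E + (lebesgue_measure B1 + (e/2)%:E))%E).
  exact: leeD.
rewrite addeACA -EFinD -splitr leeD2r//.
have /(lee_wpmul2l (_ : (0 <= 2%:E :> \bar R)%E)) := H.
rewrite muleA -EFinM divff// mul1e; apply.
by rewrite lee_fin.
Qed.

Section layer_cake.
Context (R : realType) (f : R -> R).
Hypotheses (mf : measurable_fun setT f) (f0 : forall x, 0 <= f x).
Local Open Scope ereal_scope.

Let S := [set p : R * R | 0 <= p.2 < f p.1]%R.

Let mS : measurable S.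
Proof.
have -> : S = [set p : R * R | - p.2 <= 0]%R `&` [set p | p.2 - f p.1 < 0]%R.
  apply/seteqP; split => p /=; rewrite /S/= oppr_le0 subr_lt0; first by move=> /andP.
  by move=> [-> ->].
apply: measurableI.
  apply: (@measurable_le_cst R _ (R * R)%type (fun p => - p.2)%R).
  exact: measurableT_comp.
apply: (@measurable_lt_cst R _ (R * R)%type (fun p => p.2 - f p.1)%R).
apply: measurable_funB => //.
exact: (measurableT_comp mf).
Qed.

Let K (p : R * R) : \bar R := (\1_S p)%:E.

Let mK : measurable_fun setT K.
Proof. by apply/measurable_EFinP; exact: measurable_indic. Qed.

Let K0 p : 0 <= K p. Proof. by rewrite lee_fin. Qed.

Let slice t : \int[lebesgue_measure]_x K (x, t) =
  lebesgue_measure [set x | 0 <= t < f x]%R.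
Proof.
rewrite -[X in lebesgue_measure X]setIT -integral_indic//.
have [t0|t0] := leP 0%R t; last by rewrite (_ : [set _ | _] = set0)// -subset0.
have -> : [set x | true && (t < f x)]%R = [set x | - f x < - t]%R.
  by apply/seteqP; split => x /=; rewrite ltrN2.
by apply: measurable_lt_cst; exact: measurableT_comp.
Qed.

Lemma measurable_fun_superlevel :
  measurable_fun setT (fun t : R => lebesgue_measure [set x | 0 <= t < f x]%R).
Proof.
have := @measurable_fun_fubini_tonelli_G _ _ _ _ R lebesgue_measure _ mK K0.
by congr measurable_fun; apply/funext => t; rewrite -slice.
Qed.

(** Tonelli for the indicator of the subgraph of [f]. The condition [0 <= t] sits inside the level
    set, so that [t] can range over the whole line. *)
Lemma layer_cake :
  \int[lebesgue_measure]_x (f x)%:E =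
  \int[lebesgue_measure]_t lebesgue_measure [set x | 0 <= t < f x]%R.
Proof.
under [RHS]eq_integral do rewrite -slice.
rewrite -(@fubini_tonelli _ _ _ _ R lebesgue_measure lebesgue_measure _ mK K0).
apply: eq_integral => x _.
rewrite (_ : (fun y => _) = (fun y => (\1_(`[0, f x[%classic) y)%:E)); last first.
  apply/funext => y; rewrite /K !indicE; congr (_%:R%:E).
rewrite integral_indic// setIT; apply/esym.
apply: etrans (lebesgue_measure_itv `[0%R, f x[) _ => /=.
by rewrite lte_fin; case: ltgtP (f0 x) => // [_|<-] _; rewrite ?oppr0 ?adde0.
Qed.

End layer_cake.

Definition bdd_supp1 (R : realType) (M L : R) (f : R -> R) :=
  [/\ measurable_fun setT f, forall x, 0 <= f x <= M &
      forall x, L < `|x| -> f x = 0].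

Lemma bdd_supp1_integral (R : realType) (M L : R) (f : R -> R) :
  0 <= L -> bdd_supp1 M L f ->
  (\int[lebesgue_measure]_x (f x)%:E <= (M * (L *+ 2))%:E)%E.
Proof.
have mI : 0 <= L -> (lebesgue_measure (`[(- L)%R, L]%classic : set R) <= (L *+ 2)%:E)%E.
  move=> L0; rewrite lebesgue_measure_itv/= lte_fin; case: ifPn => _.
    by rewrite -EFinB mulr2n opprK.
  by rewrite lee_fin mulrn_wge0.
move=> L0 [mf fM fL].
have M0 : 0 <= M by have /andP[/le_trans h /h] := fM 0.
apply: (@le_trans _ _ (\int[lebesgue_measure]_x (M%:E * (\1_(`[- L, L]) x)%:E))%E).
  apply: ge0_le_integral => //.
  - by move=> x _; rewrite lee_fin; have /andP[] := fM x.
  - exact/measurable_EFinP.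
  - by apply/measurable_EFinP; apply: measurable_funM => //; exact: measurable_indic.
  - move=> x _; rewrite -EFinM lee_fin indicE.
    have [xL|Lx] := leP `|x| L; last by rewrite (fL x Lx) mulr_ge0.
    rewrite mem_set ?mulr1; first by have /andP[] := fM x.
    by rewrite /= in_itv/= -ler_norml.
rewrite ge0_integralZl//; last by apply/measurable_EFinP; exact: measurable_indic.
rewrite integral_indic// setIT EFinM; apply: lee_wpmul2l; first by rewrite lee_fin.
exact: mI.
Qed.

(** Dividing [f] and [g] by their suprema [F], [G], and [h] by sqrt(F G), makes the superlevel sets
    of the first two nonempty for exactly the same levels t < 1, as Brunn-Minkowski demands.
    Integrating over the levels gives an additive inequality, and the arithmetic-geometric mean
    inequality turns it into the multiplicative one. If [F] or [G] is 0, the left-hand side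
    vanishes. *)
Lemma prekopa_leindler1 (R : realType) (M L : R) (f g h : R -> R) : 0 <= L ->
  bdd_supp1 M L f -> bdd_supp1 M L g -> bdd_supp1 M L h ->
  (forall x y, f x * g y <= h ((x + y) / 2) ^+ 2) ->
  (\int[lebesgue_measure]_x f x) * (\int[lebesgue_measure]_x g x) <=
  (\int[lebesgue_measure]_x h x) ^+ 2.
Proof.
move=> L0 bf bg bh fgh.
have [mf fM fL] := bf; have [mg gM gL] := bg; have [mh hM hL] := bh.
have f0 x : 0 <= f x by have /andP[] := fM x.
have g0 x : 0 <= g x by have /andP[] := gM x.
have h0 x : 0 <= h x by have /andP[] := hM x.
have fin (k : R -> R) : bdd_supp1 M L k ->
    (\int[lebesgue_measure]_x (k x)%:E \is a fin_num)%E.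
  move=> bk; rewrite ge0_fin_numE; last first.
    by apply: integral_ge0 => x _; rewrite lee_fin; case: bk => _ /(_ x)/andP[].
  exact: (le_lt_trans (bdd_supp1_integral L0 bk) (ltry _)).
have supf : has_sup (range f).
  by split; [exists (f 0), 0|exists M => _ [x _ <-]; case/andP: (fM x)].
have supg : has_sup (range g).
  by split; [exists (g 0), 0|exists M => _ [x _ <-]; case/andP: (gM x)].
pose F := sup (range f); pose G := sup (range g).
have fF x : f x <= F by apply: ub_le_sup => //; case: supf.
have gG x : g x <= G by apply: ub_le_sup => //; case: supg.
have F0 : 0 <= F by rewrite (le_trans _ (fF 0)).
have G0 : 0 <= G by rewrite (le_trans _ (gG 0)).
move: F0; rewrite le_eqVlt => /predU1P[F0|F0].
  rewrite [X in X * _](_ : _ = 0) ?mul0r ?sqr_ge0//.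
  rewrite /Rintegral integral0_eq// => x _; congr EFin.
  by apply/eqP; rewrite eq_le f0 andbT F0.
move: G0; rewrite le_eqVlt => /predU1P[G0|G0].
  rewrite [X in _ * X](_ : _ = 0) ?mulr0 ?sqr_ge0//.
  rewrite /Rintegral integral0_eq// => x _; congr EFin.
  by apply/eqP; rewrite eq_le g0 andbT G0.
pose H := Num.sqrt (F * G).
have H0 : 0 < H by rewrite sqrtr_gt0 mulr_gt0.
have HE : H ^+ 2 = F * G by rewrite sqr_sqrtr// ltW// mulr_gt0.
pose lc (k : R -> R) (t : R) := lebesgue_measure [set x | 0 <= t < k x].
have mset (k : R -> R) (t : R) : measurable_fun setT k -> measurable [set x | 0 <= t < k x].
  move=> mk; have [t0|t0] := leP 0 t; last by rewrite (_ : [set _ | _] = set0)// -subset0.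
  have -> : [set x | true && (t < k x)] = [set x | - k x < - t].
    by apply/seteqP; split => x /=; rewrite ltrN2.
  by apply: measurable_lt_cst; exact: measurableT_comp.
pose phi x := F^-1 * f x; pose gam x := G^-1 * g x; pose eta x := H^-1 * h x.
have mphi : measurable_fun setT phi by exact: measurable_funM.
have mgam : measurable_fun setT gam by exact: measurable_funM.
have meta : measurable_fun setT eta by exact: measurable_funM.
have phi0 x : 0 <= phi x by rewrite mulr_ge0// invr_ge0 ltW.
have gam0 x : 0 <= gam x by rewrite mulr_ge0// invr_ge0 ltW.
have eta0 x : 0 <= eta x by rewrite mulr_ge0// invr_ge0 ltW.
have phi1 x : phi x <= 1 by rewrite /phi ler_pdivrMl// mulr1.
have gam1 x : gam x <= 1 by rewrite /gam ler_pdivrMl// mulr1.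
have key t : (lc phi t + lc gam t <= 2%:E * lc eta t)%E.
  have [t0|t0] := ltP t 0.
    rewrite /lc (_ : [set _ | _] = set0); last by rewrite -subset0 => x /=; rewrite leNgt t0.
    rewrite (_ : [set x | _ <= _ < gam x] = set0); last by rewrite -subset0 => x /=; rewrite leNgt t0.
    by rewrite measure0 add0e mule_ge0// lee_fin.
  have [t1|t1] := leP 1 t.
    rewrite /lc (_ : [set _ | _] = set0); last first.
      by rewrite -subset0 => x /= /andP[_]; rewrite ltNge (le_trans _ t1).
    rewrite (_ : [set x | _ <= _ < gam x] = set0); last first.
      by rewrite -subset0 => x /= /andP[_]; rewrite ltNge (le_trans _ t1).
    by rewrite measure0 add0e mule_ge0// lee_fin.
  apply: (@brunn_minkowski1 R _ _ _ L); [exact: mset|exact: mset|exact: mset|..].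
  - have /sup_adherent/(_ supf)[_ [x _ <-]] : 0 < (1 - t) * F by rewrite mulr_gt0// subr_gt0.
    rewrite -/F mulrBl mul1r opprB addrCA subrr addr0 => tF.
    by exists x; rewrite /= t0/= /phi ltr_pdivlMl// mulrC.
  - have /sup_adherent/(_ supg)[_ [x _ <-]] : 0 < (1 - t) * G by rewrite mulr_gt0// subr_gt0.
    rewrite -/G mulrBl mul1r opprB addrCA subrr addr0 => tF.
    by exists x; rewrite /= t0/= /gam ltr_pdivlMl// mulrC.
  - move=> x /= /andP[_ tx]; rewrite leNgt; apply/negP => /fL fx.
    by move: tx; rewrite /phi fx mulr0 ltNge t0.
  - move=> x /= /andP[_ tx]; rewrite leNgt; apply/negP => /gL gx.
    by move: tx; rewrite /gam gx mulr0 ltNge t0.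
  - move=> x y /= /andP[_ tx] /andP[_ ty]; rewrite t0/=.
    rewrite -(ltr_pXn2r (n:=2)) ?nnegrE//.
    apply: (@lt_le_trans _ _ (phi x * gam y)).
      by rewrite expr2 ltr_pM.
    rewrite /phi /gam /eta exprMn exprVn HE mulrACA -invfM.
    by rewrite ler_wpM2l// invr_ge0 ltW// mulr_gt0.
have lcm (k : R -> R) : measurable_fun setT k -> (forall x, 0 <= k x) ->
    measurable_fun setT (lc k).
  by move=> mk k0; exact: measurable_fun_superlevel.
have ineq : (\int[lebesgue_measure]_x (phi x)%:E + \int[lebesgue_measure]_x (gam x)%:E <=
    2%:E * \int[lebesgue_measure]_x (eta x)%:E)%E.
  rewrite !layer_cake//.
  rewrite -ge0_integralD//; [|exact: lcm|exact: lcm].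
  rewrite -ge0_integralZl//; last exact: lcm.
  apply: ge0_le_integral => //.
  - by move=> t _; exact: adde_ge0.
  - by apply: emeasurable_funD; exact: lcm.
  - by apply: emeasurable_funM => //; exact: lcm.
  - by move=> t _; exact: key.
have sc (c : R) (k : R -> R) : 0 < c -> measurable_fun setT k -> (forall x, 0 <= k x) ->
   (\int[lebesgue_measure]_x (c^-1 * k x)%:E = (c^-1)%:E * \int[lebesgue_measure]_x (k x)%:E)%E.
  move=> c0 mk k0; under eq_integral do rewrite EFinM.
  rewrite ge0_integralZl//; first exact/measurable_EFinP.
    by move=> x _; rewrite lee_fin.
  by rewrite lee_fin invr_ge0 ltW.
move: ineq; rewrite !sc//.
rewrite -[X in ((F^-1)%:E * X)%E]fineK ?fin// -[X in ((G^-1)%:E * X)%E]fineK ?fin//.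
rewrite -[X in ((H^-1)%:E * X)%E]fineK ?fin//.
rewrite -!EFinM -EFinD lee_fin.
pose a := \int[lebesgue_measure]_x f x; pose b := \int[lebesgue_measure]_x g x.
pose c := \int[lebesgue_measure]_x h x.
move=> ineq0; have {ineq0} ineq : F^-1 * a + G^-1 * b <= 2 * (H^-1 * c) := ineq0.
suff : a * b <= c ^+ 2 by [].
have a0 : 0 <= F^-1 * a.
  by apply: mulr_ge0; [rewrite invr_ge0 ltW|rewrite /a; exact: Rintegral_ge0].
have b0 : 0 <= G^-1 * b.
  by apply: mulr_ge0; [rewrite invr_ge0 ltW|rewrite /b; exact: Rintegral_ge0].
have : (F^-1 * a) * (G^-1 * b) <= (H^-1 * c) ^+ 2.
  have : 0 <= (F^-1 * a - G^-1 * b) ^+ 2 by exact: sqr_ge0.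
  move: ineq a0 b0; set u := F^-1 * a; set v := G^-1 * b; set w := H^-1 * c.
  by move=> *; nra.
rewrite exprMn exprVn HE mulrACA -invfM ler_pM2l//.
by rewrite invr_gt0 mulr_gt0.
Qed.

(** A class that keeps every integral finite, so that real-valued integrals can be used. It is
    stable under fixing the first coordinate, and integrating out the other ones lands in
    [bdd_supp1] with a larger bound, as the induction on the dimension requires. *)
Definition bdd_supp (R : realType) n (M L : R) (f : 'rV[R]_n -> R) :=
  [/\ measurable_fun setT f, forall x, 0 <= f x <= M &
      forall x, ~ cube L x -> f x = 0].

Lemma bdd_supp_integral (R : realType) n (M L : R) (f : 'rV[R]_n -> R) :
  0 <= L -> bdd_supp M L f ->
  (\int[lebesgue_row R n]_x (f x)%:E <= (M * (L *+ 2) ^+ n)%:E)%E.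
Proof.
move=> L0 [mf fM fL].
have M0 : 0 <= M by have /andP[/le_trans h /h] := fM 0.
apply: (@le_trans _ _ (\int[lebesgue_row R n]_x (M%:E * (\1_(cube L) x)%:E))%E).
  apply: ge0_le_integral => //.
  - by move=> x _; rewrite lee_fin; have /andP[] := fM x.
  - exact/measurable_EFinP.
  - apply/measurable_EFinP; apply: measurable_funM => //.
    by apply: measurable_indic; exact: measurable_cube.
  - move=> x _; rewrite -EFinM lee_fin indicE.
    have [xL|Lx] := pselect (cube L x); last by rewrite (fL x Lx) mulr_ge0.
    by rewrite mem_set ?mulr1//; have /andP[] := fM x.
rewrite ge0_integralZl//; last first.
  by apply/measurable_EFinP; apply: measurable_indic; exact: measurable_cube.
rewrite integral_indic// ?setIT; last exact: measurable_cube.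
by rewrite [X in (_ * X)%E](lebesgue_row_cube n L0) -EFinM.
Qed.

Lemma bdd_supp_fin_num (R : realType) n (M L : R) (f : 'rV[R]_n -> R) :
  0 <= L -> bdd_supp M L f ->
  (\int[lebesgue_row R n]_x (f x)%:E)%E \is a fin_num.
Proof.
move=> L0 bf; rewrite ge0_fin_numE; last first.
  by apply: integral_ge0 => x _; rewrite lee_fin; case: bf => _ /(_ x)/andP[].
exact: (le_lt_trans (bdd_supp_integral L0 bf) (ltry _)).
Qed.

Lemma bdd_supp_row_cons (R : realType) n (M L a : R) (f : 'rV[R]_n.+1 -> R) :
  bdd_supp M L f -> bdd_supp M L (fun y => f (row_cons (a, y))).
Proof.
move=> [mf fM fL]; split.
- exact: measurable_fun_row_cons.
- by move=> y; exact: fM.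
- move=> y yL; apply: fL => H; apply: yL => i.
  by have := H (lift ord0 i); rewrite row_consS.
Qed.

Lemma Rintegral_row_step (R : realType) n (M L : R) (f : 'rV[R]_n.+1 -> R) :
  0 <= L -> bdd_supp M L f ->
  \int[lebesgue_row R n.+1]_x f x =
  \int[lebesgue_measure]_a \int[lebesgue_row R n]_y f (row_cons (a, y)).
Proof.
move=> L0 bf; have [mf fM fL] := bf.
rewrite {1}/Rintegral integral_row_step//; first last.
- by move=> x; rewrite lee_fin; have /andP[] := fM x.
- exact/measurable_EFinP.
congr fine; apply: eq_integral => a _; rewrite fineK//.
exact: (bdd_supp_fin_num L0 (bdd_supp_row_cons a bf)).
Qed.

Lemma bdd_supp1_row_step (R : realType) n (M L : R) (f : 'rV[R]_n.+1 -> R) :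
  0 <= L -> bdd_supp M L f ->
  bdd_supp1 (M * (L *+ 2) ^+ n) L
    (fun a => \int[lebesgue_row R n]_y f (row_cons (a, y))).
Proof.
move=> L0 bf; have [mf fM fL] := bf; split.
- apply: (@measurableT_comp _ _ _ _ _ _ (@fine R)) => //.
  apply: (@measurable_fun_row_step R n (EFin \o f)); first exact/measurable_EFinP.
  by move=> x; rewrite lee_fin; have /andP[] := fM x.
- move=> a; rewrite Rintegral_ge0; last by move=> y _; have /andP[] := fM (row_cons (a, y)).
  have ba := bdd_supp_row_cons a bf.
  by rewrite -lee_fin fineK ?(bdd_supp_fin_num L0 ba)// (bdd_supp_integral L0 ba).
- move=> a La; rewrite /Rintegral integral0_eq// => y _; congr EFin; apply: fL.
  by move=> /(_ ord0); rewrite row_cons0 leNgt La.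
Qed.

Lemma row_cons_mid (R : realType) n (a b : R) (x y : 'rV[R]_n) :
  2^-1 *: (row_cons (a, x) + row_cons (b, y)) =
  row_cons ((a + b) / 2, 2^-1 *: (x + y)).
Proof.
apply: row_consP => [|j]; rewrite ?row_consS ?row_cons0 mxE [X in _ * X]mxE.
  by rewrite !row_cons0 mulrC.
by rewrite !row_consS !mxE.
Qed.

(** Induction on the dimension: for fixed first coordinates [a] and [b], the inductive inequality
    between the slices is precisely the hypothesis of the one-dimensional case for the marginals. *)
Lemma prekopa_leindler (R : realType) n (M L : R) (f g h : 'rV[R]_n -> R) :
  0 <= L -> bdd_supp M L f -> bdd_supp M L g -> bdd_supp M L h ->
  (forall x y, f x * g y <= h (2^-1 *: (x + y)) ^+ 2) ->
  (\int[lebesgue_row R n]_x f x) * (\int[lebesgue_row R n]_x g x) <=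
  (\int[lebesgue_row R n]_x h x) ^+ 2.
Proof.
move=> L0; elim: n M f g h => [|n IH] M f g h bf bg bh fgh.
  have E (k : 'rV[R]_0 -> R) : bdd_supp M L k -> \int[lebesgue_row R 0]_x k x = k 0.
    move=> [mk _ _]; rewrite /Rintegral /= integral_dirac//.
      by rewrite diracE mem_set// mul1e.
    exact/measurable_EFinP.
  rewrite !E//; have := fgh 0 0; congr (_ <= h _ ^+ 2).
  by apply/rowP; case.
rewrite !(@Rintegral_row_step R n M L)//.
apply: (@prekopa_leindler1 R _ L _ _ _ L0 (bdd_supp1_row_step L0 bf)
  (bdd_supp1_row_step L0 bg) (bdd_supp1_row_step L0 bh)) => a b.
apply: (IH M); try exact: bdd_supp_row_cons.
by move=> x y; rewrite -row_cons_mid; exact: fgh.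
Qed.

(** * Poincare inequality on convex sets *)

(** The norm of row vectors is the sup norm, so Euclidean geometry is expressed through [dot], and
    distances appear squared. *)
Definition dot (R : realType) n (x y : 'rV[R]_n) : R := \sum_i x ord0 i * y ord0 i.

Definition convex (R : realType) n (A : set 'rV[R]_n) :=
  forall x y (t : R), 0 <= t <= 1 -> A x -> A y -> A (t *: x + (1 - t) *: y).

Lemma convex_setE (R : realType) n (A : set 'rV[R]_n) : convex_set A -> convex A.
Proof.
move=> cA x y t /andP[t0 t1] /mem_set Ax /mem_set Ay.
have := cA x y (Itv01 t0 t1) Ax Ay; rewrite inE.
by congr A.
Qed.

Section dot.
Context (R : realType) (n : nat).
Implicit Types x y z : 'rV[R]_n.

Lemma dotC x y : dot x y = dot y x.
Proof. by apply: eq_bigr => i _; rewrite mulrC. Qed.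

Lemma dotDl x y z : dot (x + y) z = dot x z + dot y z.
Proof. by rewrite -big_split/=; apply: eq_bigr => i _; rewrite mxE mulrDl. Qed.

Lemma dotZl a x y : dot (a *: x) y = a * dot x y.
Proof. by rewrite /dot mulr_sumr; apply: eq_bigr => i _; rewrite mxE mulrA. Qed.

Lemma dotDr x y z : dot z (x + y) = dot z x + dot z y.
Proof. by rewrite dotC dotDl !(dotC z). Qed.

Lemma dotZr a x y : dot x (a *: y) = a * dot x y.
Proof. by rewrite dotC dotZl dotC. Qed.

Lemma dotNl x y : dot (- x) y = - dot x y.
Proof. by rewrite -scaleN1r dotZl mulN1r. Qed.

Lemma dotNr x y : dot x (- y) = - dot x y.
Proof. by rewrite dotC dotNl dotC. Qed.

Lemma dot_ge0 x : 0 <= dot x x.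
Proof. by apply: sumr_ge0 => i _; rewrite -expr2 sqr_ge0. Qed.

Definition dotE := (dotDl, dotDr, dotZl, dotZr, dotNl, dotNr).

Lemma dot_young (c : R) x y : 0 < c -> dot x y <= c * dot x x + dot y y / (4 * c).
Proof.
move=> c0; have := dot_ge0 (2 * c *: x - y); rewrite !dotE (dotC y x).
set a := dot x x; set b := dot x y; set d := dot y y => H.
rewrite -(ler_pM2l (_ : 0 < 4 * c)) ?mulr_gt0//.
have -> : 4 * c * (c * a + d / (4 * c)) = 4 * c ^+ 2 * a + d.
  by field; rewrite gt_eqF.
by nra.
Qed.

Lemma dot_eq0 x : dot x x = 0 -> x = 0.
Proof.
move=> /eqP; rewrite psumr_eq0 => [/allP H|i _]; last by rewrite -expr2 sqr_ge0.
apply/rowP => i; rewrite mxE; apply/eqP.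
have := H i; rewrite mem_index_enum => /(_ isT).
by rewrite -expr2 sqrf_eq0.
Qed.

Lemma cauchy_schwarz x y : dot x y ^+ 2 <= dot x x * dot y y.
Proof.
have [y0|y0] := eqVneq (dot y y) 0.
  by rewrite y0 (dot_eq0 y0) -(scale0r 0) dotZr mul0r expr0n mulr0.
have yp : 0 < dot y y by rewrite lt_neqAle eq_sym y0 dot_ge0.
have := dot_ge0 (dot y y *: x - dot x y *: y); rewrite !dotE (dotC y x).
set a := dot x x; set b := dot x y; set d := dot y y => H.
rewrite -subr_ge0 -(pmulr_rge0 _ yp) -/d.
by move: H; congr (_ <= _); ring.
Qed.

Lemma coord_le_dot x i : x ord0 i ^+ 2 <= dot x x.
Proof.
rewrite /dot (bigD1 i)//= expr2 lerDl; apply: sumr_ge0 => j _.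
by rewrite -expr2 sqr_ge0.
Qed.

Lemma measurable_dot d (T : measurableType d) (f g : T -> 'rV[R]_n) :
  measurable_fun setT f -> measurable_fun setT g ->
  measurable_fun setT (fun t => dot (f t) (g t)).
Proof.
move=> mf mg; rewrite /dot.
apply: (@measurable_sum _ _ _ _ _ _ (fun i t => f t ord0 i * g t ord0 i)) => i.
apply: measurable_funM.
  exact: (measurableT_comp (@measurable_row_coord R n i) mf).
exact: (measurableT_comp (@measurable_row_coord R n i) mg).
Qed.

End dot.

(** * Real-valued integrals and square-integrable functions *)

Section Rintegrable.
Context d (T : measurableType d) (R : realType).
Variables (mu : {measure set T -> \bar R}) (D : set T).
Hypothesis mD : measurable D.

Lemma RintegrableZl (k : R) (f : T -> R) : mu.-integrable D (EFin \o f) ->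
  mu.-integrable D (EFin \o (fun x => k * f x)).
Proof. by move=> fi; have := integrableZl mD k fi. Qed.

Lemma RintegrableD (f g : T -> R) : mu.-integrable D (EFin \o f) ->
  mu.-integrable D (EFin \o g) -> mu.-integrable D (EFin \o (fun x => f x + g x)).
Proof. by move=> fi gi; have := integrableD mD fi gi. Qed.

Lemma RintegrableB (f g : T -> R) : mu.-integrable D (EFin \o f) ->
  mu.-integrable D (EFin \o g) -> mu.-integrable D (EFin \o (fun x => f x - g x)).
Proof. by move=> fi gi; have := integrableB mD fi gi. Qed.

End Rintegrable.

Section square_integrable.
Context (R : realType) (n : nat) (D : set 'rV[R]_n) (mD : measurable D).
Local Notation mu := (lebesgue_row R n).
Implicit Types u v : 'rV[R]_n -> R.

Lemma sqi_integrable u : square_integrable D u ->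
  mu.-integrable D (EFin \o (fun x => u x ^+ 2)).
Proof.
move=> [mu_ iu]; apply/integrableP; split.
  by apply/measurable_EFinP; exact: measurable_funX.
by under eq_integral do rewrite /= ger0_norm ?sqr_ge0//.
Qed.

Lemma sqiM u v : square_integrable D u -> square_integrable D v ->
  mu.-integrable D (EFin \o (fun x => u x * v x)).
Proof.
move=> su sv.
have /(integrableD mD (sqi_integrable su)) i2 := sqi_integrable sv.
apply: le_integrable i2 => //.
  apply/measurable_EFinP; apply: measurable_funM; [exact: su.1|exact: sv.1].
move=> x _ /=; rewrite lee_fin [leRHS]ger0_norm ?addr_ge0 ?sqr_ge0// ler_norml.
by have := sqr_ge0 (u x + v x); have := sqr_ge0 (u x - v x); nra.
Qed.

Lemma sqiD u v : square_integrable D u -> square_integrable D v ->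
  square_integrable D (fun x => u x + v x).
Proof.
move=> su sv; split; first by apply: measurable_funD; [exact: su.1|exact: sv.1].
have := integrableD mD (integrableZl mD 2 (sqi_integrable su))
  (integrableZl mD 2 (sqi_integrable sv)).
move=> /integrableP[m2]; apply: le_lt_trans; apply: ge0_le_integral => //.
- by move=> x _; rewrite lee_fin sqr_ge0.
- apply/measurable_EFinP/measurable_funX.
  by apply: measurable_funD; [exact: su.1|exact: sv.1].
- exact: measurableT_comp.
- move=> x _ /=; rewrite lee_fin ger0_norm.
    by have := sqr_ge0 (u x - v x); nra.
  by rewrite addr_ge0// mulr_ge0// sqr_ge0.
Qed.

Lemma sqiZ (a : R) u : square_integrable D u ->
  square_integrable D (fun x => a * u x).
Proof.
move=> su; split; first by apply: measurable_funM => //; exact: su.1.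
under eq_integral do rewrite exprMn EFinM.
rewrite ge0_integralZl//.
- by rewrite lte_mul_pinfty ?lee_fin ?sqr_ge0//; exact: su.2.
- by apply/measurable_EFinP/measurable_funX; exact: su.1.
- by move=> x _; rewrite lee_fin sqr_ge0.
- by rewrite lee_fin sqr_ge0.
Qed.

Lemma sqiB u v : square_integrable D u -> square_integrable D v ->
  square_integrable D (fun x => u x - v x).
Proof.
move=> su sv; have := sqiD su (sqiZ (-1) sv).
by congr square_integrable; apply/funext => x; rewrite mulN1r.
Qed.

Lemma sqi0 : square_integrable D (fun=> 0).
Proof.
split; first exact: measurable_cst.
by under eq_integral do rewrite expr0n; rewrite integral0.
Qed.

Lemma sqi_sum I (s : seq I) (f : I -> 'rV[R]_n -> R) :
  (forall i, square_integrable D (f i)) ->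
  square_integrable D (fun x => \sum_(i <- s) f i x).
Proof.
move=> sf; elim: s => [|i s IH].
  by have := sqi0; congr square_integrable; apply/funext => x; rewrite big_nil.
have := sqiD (sf i) IH; congr square_integrable.
by apply/funext => x; rewrite big_cons.
Qed.

Lemma integrable_bounded u (B : R) : (mu D < +oo)%E -> measurable_fun D u ->
  (forall x, D x -> `|u x| <= B) -> mu.-integrable D (EFin \o u).
Proof.
move=> Doo mu_ uB; apply: measurable_bounded_integrable => //.
exists B; split; first exact: num_real.
by move=> M BM x Dx /=; rewrite (le_trans (uB x Dx))// ltW.
Qed.

Lemma sqi_bounded u (B : R) : (mu D < +oo)%E -> measurable_fun D u ->
  (forall x, D x -> `|u x| <= B) -> square_integrable D u.
Proof.
move=> Doo mu_ uB; split => //.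
have /integrableP[_] : mu.-integrable D (EFin \o (fun x => u x ^+ 2)).
  apply: (@integrable_bounded _ (B ^+ 2)) => //; first exact: measurable_funX.
  move=> x Dx; rewrite normrX; apply: lerXn2r; rewrite ?nnegrE//.
    by rewrite (le_trans _ (uB x Dx)).
  exact: uB.
by under eq_integral do rewrite /= ger0_norm ?sqr_ge0//.
Qed.

Definition ip u v := \int[mu]_(x in D) (u x * v x).

Lemma ipC u v : ip u v = ip v u.
Proof. by apply: eq_Rintegral => x _; rewrite mulrC. Qed.

Lemma ipDl u v w : square_integrable D u -> square_integrable D v ->
  square_integrable D w -> ip (fun x => u x + v x) w = ip u w + ip v w.
Proof.
move=> su sv sw; rewrite /ip -RintegralD//; [|exact: sqiM|exact: sqiM].
by apply: eq_Rintegral => x _; rewrite mulrDl.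
Qed.

Lemma ipZl a u w : square_integrable D u -> square_integrable D w ->
  ip (fun x => a * u x) w = a * ip u w.
Proof.
move=> su sw; rewrite /ip -RintegralZl//; last exact: sqiM.
by apply: eq_Rintegral => x _; rewrite mulrA.
Qed.

Lemma ip_ge0 u : 0 <= ip u u.
Proof. by apply: Rintegral_ge0 => x _; rewrite -expr2 sqr_ge0. Qed.

End square_integrable.

Lemma sqiS (R : realType) n (E D : set 'rV[R]_n) u : measurable E -> measurable D ->
  E `<=` D -> square_integrable D u -> square_integrable E u.
Proof.
move=> mE mD ED [mu_ iu]; split; first exact: measurable_funS mu_.
apply: le_lt_trans iu; apply: ge0_subset_integral => //.
  by apply/measurable_EFinP/measurable_funX.
by move=> x _; rewrite lee_fin sqr_ge0.
Qed.

(** The square of the inequality 1 + s/2 <= exp(s/2). Its quadratic term is what produces the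
    variance in the second-order expansion of Prekopa-Leindler. *)
Lemma expR_ge_quadratic (R : realType) (s : R) : `|s| <= 1 ->
  1 + s + s ^+ 2 / 4 <= expR s.
Proof.
move=> s1; have -> : expR s = expR (s / 2) ^+ 2 by rewrite expr2 -expRD -splitr.
have -> : 1 + s + s ^+ 2 / 4 = (1 + s / 2) ^+ 2 by field.
apply: lerXn2r; rewrite ?nnegrE ?expR_ge0//; last exact: expR_ge1Dx.
by move: s1; rewrite ler_norml => /andP[]; lra.
Qed.

Lemma bdd_supp_patch (R : realType) n (C : set 'rV[R]_n) (M L : R)
    (f : 'rV[R]_n -> R) :
  measurable C -> C `<=` cube L -> measurable_fun C f ->
  0 <= M -> (forall x, C x -> 0 <= f x <= M) -> bdd_supp M L (f \_ C).
Proof.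
move=> mC CL mf M0 fM; split.
- by apply/(measurable_restrictT _ mC).
- by move=> x; rewrite patchE; case: ifPn => [/set_mem/fM//|_]; rewrite lexx M0.
- by move=> x xL; rewrite patchE memNset// => /CL.
Qed.

Section poincare.
Context (R : realType) (n : nat) (C : set 'rV[R]_n) (p : 'rV[R]_n) (rho : R).
Hypotheses (mC : measurable C) (cC : convex C) (rho0 : 0 < rho).
Hypothesis Cp : forall x, C x -> dot (x - p) (x - p) <= rho ^+ 2.
Local Notation mu := (lebesgue_row R n).

(** A Gaussian weight at the scale of the cell. Its strong log-concavity yields, at midpoints, a
    gain of order [|x - y|^2 / rho^2] in the exponent, while on [C] it stays between exp(-1/2) and 1
    and can be removed at the end. *)
Let phi (x : 'rV[R]_n) := expR (- (dot (x - p) (x - p) / (2 * rho ^+ 2))).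

Let phi_ge0 x : 0 <= phi x. Proof. exact: expR_ge0. Qed.

Let phi_le1 x : phi x <= 1.
Proof.
by rewrite expR_le1 oppr_le0 divr_ge0 ?dot_ge0// mulr_ge0// sqr_ge0.
Qed.

Let phi_ge x : C x -> expR (- 2^-1) <= phi x.
Proof.
move=> /Cp xp; rewrite ler_expR lerN2 ler_pdivrMr ?mulr_gt0 ?exprn_gt0//.
by rewrite mulrA mulVf ?mul1r.
Qed.

Let mphi : measurable_fun C phi.
Proof.
apply: measurable_funTS; apply: measurableT_comp => //.
apply: measurableT_comp => //; apply: measurable_funM => //.
have m1 : measurable_fun setT (fun x : 'rV[R]_n => x - p).
  have := measurable_row_affine 1 (- p).
  by congr measurable_fun; apply/funext => x; rewrite scale1r.
exact: measurable_dot.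
Qed.

Let C_cube : exists2 L : R, 0 <= L & C `<=` cube L.
Proof.
exists (\sum_i `|p ord0 i| + rho).
  by rewrite addr_ge0 ?(ltW rho0)// sumr_ge0.
move=> x /Cp xp i.
have -> : x ord0 i = (x - p) ord0 i + p ord0 i by rewrite !mxE subrK.
rewrite (le_trans (ler_normD _ _))// addrC lerD//.
  by rewrite (bigD1 i)//= lerDl sumr_ge0.
rewrite -(@ler_pXn2r _ 2) ?nnegrE ?(ltW rho0)// real_normK ?num_real//.
exact: le_trans (coord_le_dot _ _) xp.
Qed.

Let Coo : (mu C < +oo)%E.
Proof.
have [L L0 CL] := C_cube.
apply: (@le_lt_trans _ _ (mu (cube L))).
  by apply: le_measure => //; rewrite inE//; exact: measurable_cube.
by rewrite lebesgue_row_cube// ltry.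
Qed.

(* Prekopa-Leindler for [exp (e F - 2 e^2 rho^2 |G|^2) phi], [exp (- e F) phi] and
   [phi]; the second-order terms in [e -> 0] give the inequality. *)
Lemma weighted_poincare (F : 'rV[R]_n -> R) (G : 'rV[R]_n -> 'rV[R]_n) (B M : R) :
  measurable_fun C F -> measurable_fun C (fun x => dot (G x) (G x)) ->
  (forall x, C x -> `|F x| <= B) -> (forall x, C x -> dot (G x) (G x) <= B) ->
  0 <= M ->
  (forall x y, C x -> C y ->
     F x - F y <= dot (G x) (x - y) + M * dot (x - y) (x - y)) ->
  \int[mu]_(x in C) (F x * phi x) = 0 ->
  \int[mu]_(x in C) (F x ^+ 2 * phi x) <=
  8 * rho ^+ 2 * \int[mu]_(x in C) (dot (G x) (G x) * phi x).
Proof.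
move=> mF mG FB GB M0 FG F0.
have [L L0 CL] := C_cube.
have B0 : forall x, C x -> 0 <= B by move=> x /FB; apply: le_trans.
pose A := \int[mu]_(x in C) phi x.
set V := \int[mu]_(x in C) _; set W := \int[mu]_(x in C) _.
have iphi : mu.-integrable C (EFin \o phi).
  by apply: (integrable_bounded mC (B := 1)) => // x _; rewrite ger0_norm.
have iF : mu.-integrable C (EFin \o (fun x => F x * phi x)).
  apply: (integrable_bounded mC (B := B)) => //; first exact: measurable_funM.
  move=> x Cx; rewrite normrM -[B]mulr1 ler_pM ?FB// ger0_norm//.
have iF2 : mu.-integrable C (EFin \o (fun x => F x ^+ 2 * phi x)).
  apply: (integrable_bounded mC (B := B ^+ 2)) => //.
    by apply: measurable_funM => //; exact: measurable_funX.
  move=> x Cx; rewrite normrM -[B ^+ 2]mulr1 ler_pM//; last by rewrite ger0_norm.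
  by rewrite normrX lerXn2r ?nnegrE ?(B0 x)// FB.
have iG : mu.-integrable C (EFin \o (fun x => dot (G x) (G x) * phi x)).
  apply: (integrable_bounded mC (B := B)) => //; first exact: measurable_funM.
  move=> x Cx; rewrite normrM -[B]mulr1 ler_pM//; last by rewrite ger0_norm.
  by rewrite ger0_norm ?dot_ge0// GB.
have V0 : 0 <= V by apply: Rintegral_ge0 => x _; rewrite mulr_ge0// sqr_ge0.
have W0 : 0 <= W by apply: Rintegral_ge0 => x _; rewrite mulr_ge0// dot_ge0.
have A0 : 0 <= A by exact: Rintegral_ge0.
(* [e] small enough for the quadratic error terms to be absorbed. *)
have key : forall e : R, 0 < e -> e * B <= 2^-1 -> 2 * e ^+ 2 * rho ^+ 2 * B <= 2^-1 ->
    8 * e * M * rho ^+ 2 <= 1 ->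
    (A - 2 * e ^+ 2 * rho ^+ 2 * W) * (A + e ^+ 2 / 4 * V) <= A ^+ 2.
  move=> e e0 eB1 eB2 eM.
  pose s1 x := e * F x - 2 * e ^+ 2 * rho ^+ 2 * dot (G x) (G x).
  pose s2 x := - (e * F x).
  have eF x : C x -> `|e * F x| <= 2^-1.
    move=> Cx; rewrite normrM (gtr0_norm e0) (le_trans _ eB1)//.
    by rewrite ler_pM2l// FB.
  have c2 : 0 <= 2 * e ^+ 2 * rho ^+ 2.
    by apply: mulr_ge0; [apply: mulr_ge0 => //|]; exact: sqr_ge0.
  have eG x : C x -> `|2 * e ^+ 2 * rho ^+ 2 * dot (G x) (G x)| <= 2^-1.
    move=> Cx; rewrite ger0_norm; last by rewrite mulr_ge0// dot_ge0.
    by rewrite (le_trans _ eB2)// ler_wpM2l// GB.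
  have s11 x : C x -> `|s1 x| <= 1.
    move=> Cx; rewrite (le_trans (ler_normB _ _))//.
    by have := eF x Cx; have := eG x Cx; lra.
  have s21 x : C x -> `|s2 x| <= 1.
    by move=> Cx; rewrite normrN; have := eF x Cx; lra.
  have ms1 : measurable_fun C s1.
    by apply: measurable_funB; apply: measurable_funM.
  have ms2 : measurable_fun C s2.
    by apply: measurable_funN; apply: measurable_funM.
  have E1 : 1 <= expR 1 :> R by rewrite -[leLHS]expR0 ler_expR.
  have bu (s : 'rV[R]_n -> R) : measurable_fun C s -> (forall x, C x -> `|s x| <= 1) ->
      bdd_supp (expR 1) L ((fun x => expR (s x) * phi x) \_ C).
    move=> ms s1'; apply: bdd_supp_patch => //; last first.
      move=> x Cx; rewrite mulr_ge0 ?expR_ge0//= -[leRHS]mulr1 ler_pM ?expR_ge0//.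
      by rewrite ler_expR (le_trans (ler_norm _))// s1'.
    by apply: measurable_funM => //; exact: measurableT_comp.
  have bh : bdd_supp (expR 1) L (phi \_ C).
    apply: bdd_supp_patch => //.
    by move=> x Cx; rewrite phi_ge0/= (le_trans (phi_le1 x)).
  have := prekopa_leindler L0 (bu _ ms1 s11) (bu _ ms2 s21) bh.
  rewrite -!Rintegral_mkcond => /(_ _)/wrap[].
    move=> x y; rewrite !patchE.
    case: ifPn => [/set_mem Cx|_]; last by rewrite mul0r sqr_ge0.
    case: ifPn => [/set_mem Cy|_]; last by rewrite mulr0 sqr_ge0.
    have Cxy : C (2^-1 *: (x + y)).
      have := cC (t := 2^-1) _ Cx Cy; rewrite scalerDr.
      have -> : 1 - 2^-1 = 2^-1 :> R by field.
      by apply; apply/andP; split; [rewrite invr_ge0|rewrite invf_le1 ?ler1n].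
    rewrite (mem_set Cxy).
    have -> : expR (s1 x) * phi x * (expR (s2 y) * phi y) = expR (s1 x + s2 y +
        (- (dot (x - p) (x - p) / (2 * rho ^+ 2)) - dot (y - p) (y - p) / (2 * rho ^+ 2))).
      by rewrite mulrACA /phi -!expRD.
    rewrite [X in _ <= X]expr2 /phi -expRD ler_expR.
    rewrite /s1 /s2.
    have := FG x y Cx Cy.
    set d := dot (x - y) (x - y); set g := dot (G x) (G x) => FGxy.
    (* By the parallelogram identity the midpoint gains d / (4 rho^2) in the exponent. Half of it
       pays for Young's inequality applied to the gradient term, the other half for the error
       [M * d], thanks to the bound on [e * M]. *)
    have par : dot (x - p) (x - p) + dot (y - p) (y - p) =
       2 * dot (2^-1 *: (x + y) - p) (2^-1 *: (x + y) - p) + d / 2.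
      by rewrite /d !dotE (dotC p x) (dotC p y) (dotC y x); field.
    have yng : e * dot (G x) (x - y) <= 2 * e ^+ 2 * rho ^+ 2 * g + d / (8 * rho ^+ 2).
      have c0 : 0 < 2 * e * rho ^+ 2 by rewrite !mulr_gt0 ?exprn_gt0.
      have := ler_wpM2l (ltW e0) (dot_young (G x) (x - y) c0); rewrite -/d -/g.
      congr (_ <= _); field.
      by rewrite !gt_eqF.
    have d0 : 0 <= d by exact: dot_ge0.
    have md : e * M * d <= d / (8 * rho ^+ 2).
      rewrite ler_pdivlMr ?mulr_gt0 ?exprn_gt0//.
      have := ler_wpM2r d0 eM; rewrite mul1r.
      by congr (_ <= _); ring.
    have eFF : e * (F x - F y) <= 2 * e ^+ 2 * rho ^+ 2 * g + d / (4 * rho ^+ 2).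
      have := ler_wpM2l (ltW e0) FGxy; rewrite [leRHS]mulrDr [e * (M * d)]mulrA.
      have -> : d / (4 * rho ^+ 2) = d / (8 * rho ^+ 2) + d / (8 * rho ^+ 2).
        by field; rewrite gt_eqF.
      by move: yng md; lra.
    have E : (dot (x - p) (x - p) / (2 * rho ^+ 2) + dot (y - p) (y - p) / (2 * rho ^+ 2)) =
      (dot (2^-1 *: (x + y) - p) (2^-1 *: (x + y) - p) / (2 * rho ^+ 2)) *+ 2 + d / (4 * rho ^+ 2).
      by rewrite -mulrDl par; field; rewrite gt_eqF.
    move: eFF E; rewrite mulr2n mulrBr.
    set a1 := dot (x - p) _ / _; set a2 := dot (y - p) _ / _; set a3 := dot (_ - p) _ / _.
    by set a4 := d / _; lra.
  move=> PL.
  have iu (s : 'rV[R]_n -> R) : measurable_fun C s -> (forall x, C x -> `|s x| <= 1) ->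
      mu.-integrable C (EFin \o (fun x => expR (s x) * phi x)).
    move=> ms s1'; apply: (integrable_bounded mC (B := expR 1)) => //.
      by apply: measurable_funM => //; exact: measurableT_comp.
    move=> x Cx; rewrite ger0_norm ?mulr_ge0 ?expR_ge0// -[leRHS]mulr1.
    by rewrite ler_pM ?expR_ge0// ler_expR (le_trans (ler_norm _))// s1'.
  (* For [s1] the bound exp(s) >= 1 + s suffices: the term in [F] integrates to zero and the
     gradient term remains. For [s2] the quadratic bound is used, and the variance [V] comes from
     there. *)
  have lu : A - 2 * e ^+ 2 * rho ^+ 2 * W <= \int[mu]_(x in C) (expR (s1 x) * phi x).
    have -> : A - 2 * e ^+ 2 * rho ^+ 2 * W =
      \int[mu]_(x in C) (phi x + (e * (F x * phi x) - 2 * e ^+ 2 * rho ^+ 2 * (dot (G x) (G x) * phi x))).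
      rewrite RintegralD//; last first.
        by apply: RintegrableB => //; exact: RintegrableZl.
      rewrite RintegralB//; try exact: RintegrableZl.
      by rewrite !RintegralZl// F0 mulr0 sub0r.
    apply: le_Rintegral => //.
    - by apply: RintegrableD => //; apply: RintegrableB => //; exact: RintegrableZl.
    - exact: iu.
    - move=> x Cx; have := expR_ge1Dx (s1 x); rewrite /s1.
      by move=> /(ler_wpM2r (phi_ge0 x)); apply: le_trans; rewrite le_eqVlt; apply/orP; left; apply/eqP; ring.
  have lw : A + e ^+ 2 / 4 * V <= \int[mu]_(x in C) (expR (s2 x) * phi x).
    have -> : A + e ^+ 2 / 4 * V =
      \int[mu]_(x in C) (phi x + (e ^+ 2 / 4 * (F x ^+ 2 * phi x) - e * (F x * phi x))).
      rewrite RintegralD//; last first.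
        by apply: RintegrableB => //; exact: RintegrableZl.
      rewrite RintegralB//; try exact: RintegrableZl.
      by rewrite !RintegralZl// F0 mulr0 subr0.
    apply: le_Rintegral => //.
    - by apply: RintegrableD => //; apply: RintegrableB => //; exact: RintegrableZl.
    - exact: iu.
    - move=> x Cx; have := expR_ge_quadratic (s21 x Cx); rewrite /s2.
      move=> /(ler_wpM2r (phi_ge0 x)); apply: le_trans; rewrite le_eqVlt; apply/orP; left; apply/eqP.
      by field.
  have I0 : 0 <= \int[mu]_(x in C) (expR (s1 x) * phi x).
    by apply: Rintegral_ge0 => x _; exact: mulr_ge0 (expR_ge0 _) (phi_ge0 x).
  have AV0 : 0 <= A + e ^+ 2 / 4 * V.
    by apply: addr_ge0 => //; apply: mulr_ge0 => //; apply: divr_ge0 => //; exact: sqr_ge0.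
  exact: (le_trans (ler_wpM2r AV0 lu) (le_trans (ler_wpM2l I0 lw) PL)).
have [A00|Ane] := eqVneq A 0.
  apply: (@le_trans _ _ (B ^+ 2 * A)); last first.
    by rewrite A00 mulr0 mulr_ge0// mulr_ge0// sqr_ge0.
  rewrite -RintegralZl//; apply: le_Rintegral => //.
    exact: RintegrableZl.
  move=> x Cx; rewrite ler_wpM2r// -[F x ^+ 2]real_normK ?num_real//.
  by rewrite lerXn2r ?nnegrE ?FB// (B0 x).
  rewrite leNgt; apply/negP => VW.
  (* If the inequality failed, [X] would be positive. The left-hand side of [key] is A^2 + e^2 (X -
     e^2 Y), which exceeds A^2 once e^2 Y < X. [N] adds up all the lower bounds imposed on 1/e. *)
  pose X := A * (V / 4 - 2 * rho ^+ 2 * W).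
  have X0 : 0 < X by rewrite mulr_gt0// ?lt_neqAle ?A0 1?eq_sym ?Ane//; move: VW; lra.
  pose Y := rho ^+ 2 * W * V / 2.
  have Y0 : 0 <= Y by rewrite divr_ge0 ?mulr_ge0 ?(ltW rho0).
  pose N := 2 + 2 * `|B| + 4 * rho ^+ 2 * `|B| + 8 * M * rho ^+ 2 + 2 * Y / X.
  have r2 : 0 < rho ^+ 2 by rewrite exprn_gt0.
  have q0 : 0 <= 2 * Y / X by rewrite divr_ge0 ?(ltW X0)// mulr_ge0.
  have q1 : 0 <= 4 * rho ^+ 2 * `|B| by rewrite !mulr_ge0 ?(ltW rho0).
  have q2 : 0 <= 8 * M * rho ^+ 2 by rewrite !mulr_ge0 ?(ltW rho0).
  have nB : 0 <= `|B| by [].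
  have N1 : 1 <= N by rewrite /N; lra.
  have N0 : 0 < N by lra.
  pose e := N^-1.
  have e0 : 0 < e by rewrite invr_gt0.
  have eN : e * N = 1 by rewrite mulVf// gt_eqF.
  have e1 : e <= 1 by rewrite invf_le1.
  have bnd (t : R) : 0 <= t -> t <= N -> e * t <= 1.
    by move=> t0 tN; rewrite -eN ler_wpM2l// ltW.
  have := key e e0.
  have h1 : e * (2 * `|B|) <= 1 by apply: bnd; rewrite ?mulr_ge0// /N; lra.
  have h2 : e * (4 * rho ^+ 2 * `|B|) <= 1 by apply: bnd => //; rewrite /N; lra.
  have h3 : e * (8 * M * rho ^+ 2) <= 1 by apply: bnd => //; rewrite /N; lra.
  have h4 : e * (2 * Y / X) <= 1 by apply: bnd => //; rewrite /N; lra.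
  have BB : B <= `|B| by exact: ler_norm.
  have h1' : e * B <= 2^-1.
    have := ler_wpM2l (ltW e0) BB; move: h1; rewrite mulrCA; lra.
  have h2' : 2 * e ^+ 2 * rho ^+ 2 * B <= 2^-1.
    apply: (@le_trans _ _ (e * (e * (4 * rho ^+ 2 * `|B|)) / 2)).
      have -> : e * (e * (4 * rho ^+ 2 * `|B|)) / 2 = 2 * e ^+ 2 * rho ^+ 2 * `|B| by field.
      by rewrite ler_wpM2l// !mulr_ge0 ?(ltW rho0) ?(ltW e0).
    rewrite ler_pdivrMr// mulVf//.
    by rewrite -[leRHS]mulr1 ler_pM ?(ltW e0)// mulr_ge0 ?(ltW e0).
  have h3' : 8 * e * M * rho ^+ 2 <= 1 by move: h3; congr (_ <= _); ring.
  move=> /(_ h1' h2' h3'); rewrite leNgt => /negP; apply.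
  have -> : (A - 2 * e ^+ 2 * rho ^+ 2 * W) * (A + e ^+ 2 / 4 * V) = A ^+ 2 + e ^+ 2 * (X - e ^+ 2 * Y).
    by rewrite /X /Y; field.
  rewrite ltrDl mulr_gt0 ?exprn_gt0// subr_gt0.
  apply: (@le_lt_trans _ _ (e * Y)).
    by rewrite ler_wpM2r// expr2 ler_piMr// ltW.
  by move: h4; rewrite mulrA ler_pdivrMr// mul1r mulrCA; lra.
Qed.

(** The weighted inequality is applied to [F - c], with [c] the weighted mean, and the weight is
    removed by exp(-1/2) <= [phi] <= 1, whence the factor exp(1/2). The plain mean does at least as
    well as [c], since (f - c a)^2 >= 0. Multiplying by the volume avoids a division on null
    cells. *)
Lemma poincare_C11 (F : 'rV[R]_n -> R) (G : 'rV[R]_n -> 'rV[R]_n) (B M : R) :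
  measurable_fun C F -> measurable_fun C (fun x => dot (G x) (G x)) ->
  (forall x, C x -> `|F x| <= B) -> (forall x, C x -> dot (G x) (G x) <= B) ->
  0 <= M ->
  (forall x y, C x -> C y ->
     F x - F y <= dot (G x) (x - y) + M * dot (x - y) (x - y)) ->
  fine (mu C) * \int[mu]_(x in C) (F x ^+ 2) <=
  (\int[mu]_(x in C) F x) ^+ 2 +
  8 * expR 2^-1 * rho ^+ 2 * fine (mu C) * \int[mu]_(x in C) dot (G x) (G x).
Proof.
move=> mF mG FB GB M0 FG.
pose E := expR (- 2^-1 : R); have E0 : 0 < E by exact: expR_gt0.
have EV : expR 2^-1 = E^-1 by rewrite /E -expRN opprK.
set a := fine (mu C); set S := \int[mu]_(x in C) _; set f := \int[mu]_(x in C) _.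
set D := \int[mu]_(x in C) _.
have a0 : 0 <= a by exact: fine_ge0.
have D0 : 0 <= D by apply: Rintegral_ge0 => x _; exact: dot_ge0.
have K0 : 0 <= 8 * expR 2^-1 * rho ^+ 2 by rewrite !mulr_ge0 ?expR_ge0 ?(ltW rho0).
have iphi : mu.-integrable C (EFin \o phi).
  by apply: (integrable_bounded mC (B := 1)) => // x _; rewrite ger0_norm.
have iF : mu.-integrable C (EFin \o F) by exact: (integrable_bounded mC (B := B)).
have iFphi : mu.-integrable C (EFin \o (fun x => F x * phi x)).
  apply: (integrable_bounded mC (B := B)) => //; first exact: measurable_funM.
  by move=> x Cx; rewrite normrM -[B]mulr1 ler_pM ?FB// ger0_norm.
have iG : mu.-integrable C (EFin \o (fun x => dot (G x) (G x))).
  apply: (integrable_bounded mC (B := B)) => // x Cx.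
  by rewrite ger0_norm ?dot_ge0// GB.
have icst (c : R) : mu.-integrable C (EFin \o (fun=> c)).
  exact: (integrable_bounded mC (B := `|c|)).
pose A := \int[mu]_(x in C) phi x.
have EA : E * a <= A.
  by rewrite -Rintegral_cst//; exact: le_Rintegral.
have [a00|an0] := eqVneq a 0.
  by rewrite a00 mul0r mulr0 mul0r addr0 sqr_ge0.
have ap : 0 < a by rewrite lt_neqAle eq_sym an0.
have A0 : 0 < A by rewrite (lt_le_trans _ EA)// mulr_gt0.
pose c := (\int[mu]_(x in C) (F x * phi x)) / A.
have mF1 : measurable_fun C (fun x => F x - c) by exact: measurable_funB.
have F1B x : C x -> `|F x - c| <= B + `|c|.
  by move=> Cx; rewrite (le_trans (ler_normB _ _))// lerD2r FB.
have sF1 : square_integrable C (fun x => F x - c).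
  exact: (sqi_bounded mC Coo mF1 F1B).
have sF : square_integrable C F by exact: (sqi_bounded mC Coo mF FB).
have := @weighted_poincare (fun x => F x - c) G (B + `|c|) M mF1 mG F1B.
move=> /(_ _ M0)/wrap[].
  by move=> x Cx; rewrite (le_trans (GB x Cx))// lerDl.
move=> /(_ _ _)/wrap[].
  by move=> x y Cx Cy; rewrite opprB addrA subrK FG.
  under eq_Rintegral do rewrite mulrBl.
  rewrite RintegralB//; last exact: RintegrableZl.
  by rewrite RintegralZl// /c -mulrA mulVf ?mulr1 ?subrr// gt_eqF.
set V := \int[mu]_(x in C) _; set W := \int[mu]_(x in C) _ => VW.
have WD : W <= D.
  apply: le_Rintegral => //.
    apply: (integrable_bounded mC (B := B)) => //; first exact: measurable_funM.
    move=> x Cx; rewrite ger0_norm ?mulr_ge0 ?dot_ge0// -[leRHS]mulr1.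
    by rewrite ler_pM ?dot_ge0// GB.
  by move=> x Cx; rewrite ler_piMr ?dot_ge0.
have SV : E * \int[mu]_(x in C) ((F x - c) ^+ 2) <= V.
  rewrite -RintegralZl//; last exact: sqi_integrable.
  apply: le_Rintegral => //.
  - by apply: RintegrableZl => //; exact: sqi_integrable.
  - apply: (integrable_bounded mC (B := (B + `|c|) ^+ 2)) => //.
      by apply: measurable_funM => //; exact: measurable_funX.
    move=> x Cx; rewrite normrM -[leRHS]mulr1 ler_pM//; last by rewrite ger0_norm.
    rewrite normrX lerXn2r ?nnegrE ?F1B//.
    by rewrite (le_trans _ (F1B x Cx)).
  - by move=> x Cx; rewrite mulrC ler_wpM2l ?sqr_ge0// phi_ge.
have expand : \int[mu]_(x in C) ((F x - c) ^+ 2) = S - 2 * c * f + c ^+ 2 * a.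
  rewrite -Rintegral_cst// -RintegralZl//.
  rewrite -RintegralB//; [|exact: sqi_integrable|exact: RintegrableZl].
  rewrite -RintegralD//.
    by apply: eq_Rintegral => x _; ring.
  apply: RintegrableB => //; first exact: sqi_integrable.
  exact: RintegrableZl.
rewrite EV; have H : S - 2 * c * f + c ^+ 2 * a <= 8 * E^-1 * rho ^+ 2 * D.
  rewrite -expand -(ler_pM2l E0) (le_trans SV)// (le_trans VW)//.
  rewrite (le_trans (ler_wpM2l _ WD))// ?mulr_ge0 ?(ltW rho0)//.
  rewrite le_eqVlt; apply/orP; left; apply/eqP; field.
  by rewrite gt_eqF.
have := ler_wpM2l a0 H; have := sqr_ge0 (f - c * a).
set Q := 8 * E^-1 * rho ^+ 2.
have -> : a * (Q * D) = Q * a * D by ring.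
by nra.
Qed.

End poincare.

(** * Continuity of translations in L^2 *)

(** Continuity of translations in L^2, tested on cubes so as to admit functions that are only
    locally square integrable, such as constants and indicators of half-spaces. *)
Definition tcont (R : realType) n (f : 'rV[R]_n -> R) :=
  [/\ measurable_fun setT f,
      forall L, square_integrable (cube L) f &
      forall L e, 0 < e -> exists2 d, 0 < d & forall z, cube d z ->
        (\int[lebesgue_row R n]_(x in cube L) ((f (x - z) - f x) ^+ 2)%:E <= e%:E)%E].

Section tcont.
Context (R : realType) (n : nat).
Local Notation mu := (lebesgue_row R n).
Implicit Types (f g h : 'rV[R]_n -> R).

Lemma measurable_shift (z : 'rV[R]_n) : measurable_fun setT (fun x : 'rV[R]_n => x - z).
Proof.
have := measurable_row_affine 1 (- z).
by congr measurable_fun; apply/funext => x; rewrite scale1r.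
Qed.

Lemma measurable_comp_shift d (T : measurableType d) (f : 'rV[R]_n -> T) (z : 'rV[R]_n) :
  measurable_fun setT f -> measurable_fun setT (fun x : 'rV[R]_n => f (x - z)).
Proof. by move=> mf; exact: (measurableT_comp mf (measurable_shift z)). Qed.

Lemma cube_lty (L : R) : (mu (cube L) < +oo)%E.
Proof.
have [L0|L0] := leP 0 L; first by rewrite lebesgue_row_cube// ltry.
apply: (@le_lt_trans _ _ (mu (cube 0))); last by rewrite lebesgue_row_cube// ltry.
apply: le_measure; rewrite ?inE; [exact: measurable_cube|exact: measurable_cube|].
by move=> x xL i; rewrite (le_trans (xL i))// ltW.
Qed.

Lemma ge0_integral_shift (f : 'rV[R]_n -> \bar R) (z : 'rV[R]_n) :
  measurable_fun setT f -> (forall x, 0 <= f x)%E ->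
  (\int[mu]_x f (x - z)%R = \int[mu]_x f x)%E.
Proof.
move=> mf f0; have := @ge0_integral_affine R n 1 (- z) f (oner_neq0 _) mf f0.
rewrite normr1 expr1n invr1 mul1e => <-.
by apply: eq_integral => x _; rewrite scale1r.
Qed.

Lemma integral_cube_shift (f : 'rV[R]_n -> R) (z : 'rV[R]_n) L :
  measurable_fun setT f -> (forall x, 0 <= f x) -> cube 1 z ->
  (\int[mu]_(x in cube L) (f (x - z))%:E <= \int[mu]_(x in cube (L + 1)) (f x)%:E)%E.
Proof.
move=> mf f0 z1.
have mL := @measurable_cube R n L.
have mL1 := @measurable_cube R n (L + 1).
rewrite [leRHS]integral_mkcond.
pose k := (EFin \o f) \_ (cube (L + 1)).
have k0 x : (0 <= k x)%E by apply: erestrict_ge0 => y _; rewrite lee_fin.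
have mk : measurable_fun setT k.
  by apply/(measurable_restrictT _ mL1)/measurable_funTS/measurable_EFinP.
rewrite -/k -(ge0_integral_shift z mk k0) integral_mkcond.
have mfz := measurable_comp_shift z mf.
apply: ge0_le_integral => //.
- by move=> x _; apply: erestrict_ge0 => y _; rewrite lee_fin.
- by apply/(measurable_restrictT _ mL)/measurable_funTS/measurable_EFinP.
- exact: (measurableT_comp mk (measurable_shift z)).
- move=> x _; rewrite /k !patchE; case: ifPn => [/set_mem xL|_].
    rewrite mem_set// => i; rewrite !mxE (le_trans (ler_normB _ _))//.
    by rewrite lerD ?xL ?z1.
  by case: ifPn => _; rewrite ?lee_fin.
Qed.

(** Three-term comparison through [g]. The approximation is taken on [cube (L + 1)], which leaves
    room for translating; 1/9 is 1/3 for each of three terms, divided by the 3 of (a + b + c)^2 <= 3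
    (a^2 + b^2 + c^2). *)
Lemma tcont_lim f : measurable_fun setT f ->
  (forall L, square_integrable (cube L) f) ->
  (forall L e, 0 < e -> exists2 g, tcont g &
     (\int[mu]_(x in cube L) ((f x - g x) ^+ 2)%:E <= e%:E)%E) ->
  tcont f.
Proof.
move=> mf sf H; split => // L e e0.
have e9 : 0 < e / 9 by rewrite divr_gt0.
have [g tg fg] := H (L + 1) _ e9.
have [mg sg tg2] := tg; have [d d0 gd] := tg2 L _ e9.
exists (Num.min 1 d); first by rewrite lt_min ltr01.
move=> z zd.
have z1 : cube 1 z by move=> i; rewrite (le_trans (zd i))// ge_min lexx.
have zd' : cube d z by move=> i; rewrite (le_trans (zd i))// ge_min lexx orbT.
have mL := @measurable_cube R n L.
have mfg : measurable_fun setT (fun x => f x - g x) by exact: measurable_funB.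
have mfgz := measurable_comp_shift z mfg.
have mgz : measurable_fun setT (fun x : 'rV[R]_n => g (x - z) - g x).
  by apply: measurable_funB => //; exact: measurable_comp_shift.
have m1 : measurable_fun (cube L) (fun x => ((f (x - z) - g (x - z)) ^+ 2)%:E).
  exact/measurable_funTS/measurable_EFinP/measurable_funX.
have m2 : measurable_fun (cube L) (fun x => ((g (x - z) - g x) ^+ 2)%:E).
  exact/measurable_funTS/measurable_EFinP/measurable_funX.
have m3 : measurable_fun (cube L) (fun x => ((f x - g x) ^+ 2)%:E).
  exact/measurable_funTS/measurable_EFinP/measurable_funX.
apply: (@le_trans _ _ (\int[mu]_(x in cube L) (3%:E *
   (((f (x - z) - g (x - z)) ^+ 2)%:E + ((g (x - z) - g x) ^+ 2)%:E + ((f x - g x) ^+ 2)%:E)))%E).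
  apply: ge0_le_integral => //.
  - by move=> x _; rewrite lee_fin sqr_ge0.
  - apply/measurable_funTS/measurable_EFinP/measurable_funX.
    by apply: measurable_funB => //; exact: measurable_comp_shift.
  - by apply: emeasurable_funM => //; apply: emeasurable_funD => //; exact: emeasurable_funD.
  - move=> x _; rewrite -!EFinD -EFinM lee_fin.
    set a := f _; set b := g (x - z); set c := g x; set q := f x.
    have := sqr_ge0 ((a - b) - (b - c)); have := sqr_ge0 ((a - b) + (q - c)).
    have := sqr_ge0 ((b - c) + (q - c)); nra.
rewrite ge0_integralZl//; first last.
- by move=> x _; rewrite -!EFinD lee_fin !addr_ge0// sqr_ge0.
- by apply: emeasurable_funD => //; exact: emeasurable_funD.
rewrite ge0_integralD//; first last.
- by move=> x _; rewrite lee_fin sqr_ge0.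
- exact: emeasurable_funD.
- by move=> x _; rewrite -EFinD lee_fin !addr_ge0// sqr_ge0.
rewrite ge0_integralD//; first last.
- by move=> x _; rewrite lee_fin sqr_ge0.
- by move=> x _; rewrite lee_fin sqr_ge0.
have -> : e = 3 * (e / 9 + e / 9 + e / 9) by field.
rewrite EFinM; apply: lee_wpmul2l; first by rewrite lee_fin.
rewrite EFinD; apply: leeD; last first.
  apply: le_trans fg; apply: ge0_subset_integral => //.
  - exact: measurable_cube.
  - exact/measurable_funTS/measurable_EFinP/measurable_funX.
  - by move=> x _; rewrite lee_fin sqr_ge0.
  - by move=> x xL i; rewrite (le_trans (xL i))// lerDl.
rewrite EFinD; apply: leeD; last exact: gd.
apply: le_trans fg.
apply: (@integral_cube_shift (fun x => (f x - g x) ^+ 2)) => //.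
  exact: measurable_funX.
by move=> x; exact: sqr_ge0.
Qed.

Lemma tcont_dominated (f_ : nat -> 'rV[R]_n -> R) f h :
  (forall k, tcont (f_ k)) -> (forall x, f_ k x @[k --> \oo] --> f x) ->
  (forall k x, `|f_ k x| <= h x) ->
  (forall L, square_integrable (cube L) h) -> tcont f.
Proof.
move=> tf ff fh sh.
have mf : measurable_fun setT f.
  apply: (@measurable_fun_cvg _ _ _ setT f_) => //.
  by move=> k; case: (tf k).
have fh' x : `|f x| <= h x.
  apply: (ler_cvg_to (cvg_norm (ff x)) (cvg_cst (h x))).
  exact: nearW.
have h0 x : 0 <= h x by exact: le_trans (fh' x).
have sf L : square_integrable (cube L) f.
  split; first exact: measurable_funTS.
  apply: le_lt_trans (sh L).2; apply: ge0_le_integral => //.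
  - exact: measurable_cube.
  - by move=> x _; rewrite lee_fin sqr_ge0.
  - exact/measurable_EFinP/measurable_funX/measurable_funTS.
  - by apply/measurable_EFinP/measurable_funX; case: (sh L).
  - move=> x _; rewrite lee_fin -[f x ^+ 2]real_normK ?num_real//.
    by rewrite lerXn2r ?nnegrE.
apply: tcont_lim => // L e e0.
have mL := @measurable_cube R n L.
have mfk k : measurable_fun setT (f_ k) by case: (tf k).
have := @dominated_convergence _ _ R mu (cube L) mL
  (fun k x => ((f x - f_ k x) ^+ 2)%:E) (fun=> 0%E) (fun x => (4 * h x ^+ 2)%:E).
case.
- move=> k; apply/measurable_funTS/measurable_EFinP/measurable_funX.
  exact: measurable_funB.
- exact: measurable_cst.
- apply: aeW => x _ /=; apply/cvg_EFin; first exact: nearW.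
  have -> : 0 = (f x - f x) ^+ 2 :> R by rewrite subrr expr0n.
  apply: (@cvgM _ _ _ _ (fun k => f x - f_ k x) (fun k => f x - f_ k x)).
    by apply: cvgB => //; exact: cvg_cst.
  by apply: cvgB => //; exact: cvg_cst.
- by apply: RintegrableZl => //; exact: sqi_integrable.
- apply: aeW => x k _ /=; rewrite lee_fin ger0_norm ?sqr_ge0//.
  have := fh k x; have := fh' x; rewrite !ler_norml => /andP[a1 a2] /andP[a3 a4].
  by nra.
move=> _ _; rewrite integral0 => /fine_cvgP[_] /cvgrPdist_le /(_ e e0)[N _ /(_ N (leqnn _))].
rewrite sub0r normrN => H; exists (f_ N) => //.
have iN : (\int[mu]_(x in cube L) ((f x - f_ N x) ^+ 2)%:E < +oo)%E.
  by case: (sqiB mL (sf L) (let: And3 _ sk _ := tf N in sk L)).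
rewrite -(@fineK _ (\int[mu]_(x in cube L) _)%E); last first.
  by rewrite ge0_fin_numE//; apply: integral_ge0 => x _; rewrite lee_fin sqr_ge0.
by rewrite lee_fin (le_trans (ler_norm _)).
Qed.

Lemma tcontD f g : tcont f -> tcont g -> tcont (fun x => f x + g x).
Proof.
move=> [mf sf tf] [mg sg tg]; split; first exact: measurable_funD.
  by move=> L; apply: sqiD => //; exact: measurable_cube.
move=> L e e0; have e4 : 0 < e / 4 by rewrite divr_gt0.
have [d1 d10 H1] := tf L _ e4; have [d2 d20 H2] := tg L _ e4.
exists (Num.min d1 d2); first by rewrite lt_min d10.
move=> z zd.
have z1 : cube d1 z by move=> i; rewrite (le_trans (zd i))// ge_min lexx.
have z2 : cube d2 z by move=> i; rewrite (le_trans (zd i))// ge_min lexx orbT.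
have {}H1 := H1 z z1; have {}H2 := H2 z z2.
have mL := @measurable_cube R n L.
have m1 : measurable_fun (cube L) (fun x : 'rV[R]_n => ((f (x - z) - f x) ^+ 2)%:E).
  apply/measurable_funTS/measurable_EFinP/measurable_funX.
  by apply: measurable_funB => //; exact: measurable_comp_shift.
have m2 : measurable_fun (cube L) (fun x : 'rV[R]_n => ((g (x - z) - g x) ^+ 2)%:E).
  apply/measurable_funTS/measurable_EFinP/measurable_funX.
  by apply: measurable_funB => //; exact: measurable_comp_shift.
apply: (@le_trans _ _ (\int[mu]_(x in cube L) (2%:E *
   (((f (x - z) - f x) ^+ 2)%:E + ((g (x - z) - g x) ^+ 2)%:E)))%E).
  apply: ge0_le_integral => //.
  - by move=> x _; rewrite lee_fin sqr_ge0.
  - apply/measurable_funTS/measurable_EFinP/measurable_funX.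
    apply: measurable_funB; last exact: measurable_funD.
    by apply: measurable_funD; exact: measurable_comp_shift.
  - by apply: emeasurable_funM => //; exact: emeasurable_funD.
  - move=> x _; rewrite -!EFinD -EFinM lee_fin.
    by have := sqr_ge0 ((f (x - z) - f x) - (g (x - z) - g x)); nra.
rewrite ge0_integralZl//; first last.
- by move=> x _; rewrite -!EFinD lee_fin !addr_ge0// sqr_ge0.
- exact: emeasurable_funD.
rewrite ge0_integralD//; first last.
- by move=> x _; rewrite lee_fin sqr_ge0.
- by move=> x _; rewrite lee_fin sqr_ge0.
have -> : e = 2 * (e / 4 + e / 4) by field.
by rewrite EFinM; apply: lee_wpmul2l; rewrite ?lee_fin// EFinD; exact: leeD.
Qed.

Lemma tcontZ (a : R) f : tcont f -> tcont (fun x => a * f x).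
Proof.
move=> [mf sf tf]; split; first exact: measurable_funM.
  by move=> L; apply: sqiZ => //; exact: measurable_cube.
move=> L e e0; have a1 : 0 < a ^+ 2 + 1 by rewrite ltr_wpDl// sqr_ge0.
have ea : 0 < e / (a ^+ 2 + 1) by rewrite divr_gt0.
have [d d0 H] := tf L _ ea; exists d => // z /H {}H.
have mL := @measurable_cube R n L.
under eq_integral do rewrite -mulrBr exprMn EFinM.
rewrite ge0_integralZl//; first last.
- by rewrite lee_fin sqr_ge0.
- by move=> x _; rewrite lee_fin sqr_ge0.
- apply/measurable_funTS/measurable_EFinP/measurable_funX.
  by apply: measurable_funB => //; exact: measurable_comp_shift.
apply: (@le_trans _ _ ((a ^+ 2)%:E * (e / (a ^+ 2 + 1))%:E)%E).
  by apply: lee_wpmul2l => //; rewrite lee_fin sqr_ge0.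
rewrite -EFinM lee_fin mulrCA ler_piMr ?(ltW e0)//.
by rewrite ler_pdivrMr// mul1r lerDl.
Qed.

Lemma tcont_bounded_sets f : measurable_fun setT f -> (forall x, `|f x| <= 1) ->
  forall L, square_integrable (cube L) f.
Proof.
move=> mf f1 L; apply: (sqi_bounded (measurable_cube L) (cube_lty L)) => //.
exact: measurable_funTS.
Qed.

Lemma tcont_lipschitz f (K : R) : measurable_fun setT f -> 0 <= K ->
  (forall x, `|f x| <= 1) ->
  (forall x z d, cube d z -> `|f (x - z) - f x| <= K * d) -> tcont f.
Proof.
move=> mf K0 f1 fK; split => //; first exact: tcont_bounded_sets.
move=> L e e0; pose V := fine (mu (cube L)).
have V0 : 0 <= V by exact: fine_ge0.
pose d := Num.min 1 (e / (K ^+ 2 * V + 1)).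
have KV : 0 < K ^+ 2 * V + 1 by rewrite ltr_wpDl// mulr_ge0// sqr_ge0.
have d0 : 0 < d by rewrite lt_min ltr01 divr_gt0.
have d1 : d <= 1 by rewrite ge_min lexx.
have de : d <= e / (K ^+ 2 * V + 1) by rewrite ge_min lexx orbT.
exists d => // z zd; have mL := @measurable_cube R n L.
apply: (@le_trans _ _ (\int[mu]_(x in cube L) ((K * d) ^+ 2)%:E)%E).
  apply: ge0_le_integral => //.
  - by move=> x _; rewrite lee_fin sqr_ge0.
  - apply/measurable_funTS/measurable_EFinP/measurable_funX.
    by apply: measurable_funB => //; exact: measurable_comp_shift.
  - move=> x _; rewrite lee_fin -[leLHS]real_normK ?num_real//.
    by rewrite lerXn2r ?nnegrE ?mulr_ge0 ?(ltW d0)// fK.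
have -> : (\int[mu]_(x in cube L) ((K * d) ^+ 2)%:E = ((K * d) ^+ 2 * V)%:E)%E.
  by rewrite integral_cst// /V [RHS]EFinM fineK// ge0_fin_numE// cube_lty.
rewrite lee_fin exprMn.
apply: (@le_trans _ _ ((K ^+ 2 * V + 1) * d)).
  rewrite mulrAC mulrC expr2 -mulrA mulrC -mulrA.
  apply: (@le_trans _ _ (d * (K ^+ 2 * V))); last first.
    by rewrite mulrC ler_wpM2r ?(ltW d0)// lerDl.
  by rewrite ler_wpM2l ?(ltW d0)// ler_piMr// mulr_ge0// sqr_ge0.
by rewrite mulrC -ler_pdivlMr.
Qed.

Definition clamp (t : R) : R := Num.min 1 (Num.max 0 t).

Lemma clamp_lipschitz (s t : R) : `|clamp s - clamp t| <= `|s - t|.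
Proof.
rewrite /clamp; case: (leP 0 s) => hs; case: (leP 0 t) => ht;
  rewrite ?(max_idPr hs) ?(max_idPr ht) ?(max_idPl (ltW hs)) ?(max_idPl (ltW ht)) ?(min_idPr ler01) ?subrr//=.
- case: (leP 1 s) => h1; case: (leP 1 t) => h2; rewrite ?subrr ?normr0//.
  + by rewrite ger0_norm ?subr_ge0 ?(ltW h2)// ger0_norm; lra.
  + by rewrite ler0_norm ?subr_le0 ?(ltW h1)// ler0_norm; lra.
- case: (leP 1 s) => h1; rewrite !ger0_norm; lra.
- case: (leP 1 t) => h1; rewrite !ler0_norm; lra.
- by rewrite normr0.
Qed.

Lemma clamp_ge0 t : 0 <= clamp t.
Proof. by rewrite /clamp le_min ler01 le_max lexx. Qed.

Lemma clamp_le1 t : clamp t <= 1.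
Proof. by rewrite /clamp ge_min lexx. Qed.

Lemma clamp_norm t : `|clamp t| <= 1.
Proof. by rewrite ger0_norm ?clamp_ge0// clamp_le1. Qed.

Lemma measurable_clamp d (T : measurableType d) (f : T -> R) :
  measurable_fun setT f -> measurable_fun setT (fun x => clamp (f x)).
Proof. by move=> mf; apply: measurable_minr => //; exact: measurable_maxr. Qed.

Lemma tcont_clamp f : tcont f -> tcont (fun x => clamp (f x)).
Proof.
move=> [mf sf tf]; have mc := measurable_clamp mf; split => //.
  by apply: tcont_bounded_sets => // x; exact: clamp_norm.
move=> L e e0; have [d d0 H] := tf L e e0; exists d => // z /H; apply: le_trans.
apply: ge0_le_integral => //; first exact: measurable_cube.
- by move=> x _; rewrite lee_fin sqr_ge0.
- apply/measurable_funTS/measurable_EFinP/measurable_funX.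
  by apply: measurable_funB => //; exact: (measurable_comp_shift z mc).
- apply/measurable_funTS/measurable_EFinP/measurable_funX.
  by apply: measurable_funB => //; exact: measurable_comp_shift.
- move=> x _; rewrite lee_fin -[leLHS]real_normK ?num_real// -[leRHS]real_normK ?num_real//.
  by rewrite lerXn2r ?nnegrE// clamp_lipschitz.
Qed.

Lemma tcont_cst (a : R) : `|a| <= 1 -> tcont (fun _ : 'rV[R]_n => a).
Proof.
move=> a1; apply: (@tcont_lipschitz _ 0) => // x z d _.
by rewrite subrr normr0 mul0r.
Qed.

(** The indicator of a half-space is the pointwise limit of clamped affine functions of slope k + 1,
    which are Lipschitz. *)
Lemma tcont_ray (i : 'I_n) (a : R) : tcont (\1_[set x : 'rV[R]_n | a < x ord0 i] : 'rV[R]_n -> R).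
Proof.
pose u (k : nat) (x : 'rV[R]_n) := clamp (k.+1%:R * (x ord0 i - a)).
have mx : measurable_fun setT (fun x : 'rV[R]_n => x ord0 i - a).
  by apply: measurable_funB => //; exact: measurable_row_coord.
have mu_ k : measurable_fun setT (u k).
  by apply: measurable_clamp; exact: measurable_funM.
apply: (@tcont_dominated u _ (fun=> 1)).
- move=> k; apply: (@tcont_lipschitz _ k.+1%:R) => //.
    by move=> x; exact: clamp_norm.
  move=> x z d zd; rewrite (le_trans (clamp_lipschitz _ _))//.
  rewrite -mulrBr normrM ger0_norm// ler_wpM2l// !mxE.
  by rewrite (_ : _ - _ - _ - _ = - z ord0 i) ?normrN ?zd//; ring.
- move=> x; apply: cvg_near_cst; rewrite indicE.
  have [xa|ax] := leP (x ord0 i) a.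
    rewrite memNset/=; last by apply/negP; rewrite -leNgt.
    apply: nearW => k; rewrite /u /clamp (max_idPl _) ?(min_idPr ler01)//.
    by rewrite pmulr_rle0// subr_le0.
  rewrite mem_set//; have xa : 0 < x ord0 i - a by rewrite subr_gt0.
  near=> k; rewrite /u /clamp; apply/min_idPl; rewrite le_max; apply/orP; right.
  rewrite -ler_pdivrMl// mulr1; apply/ltW; near: k.
  exact: (near_infty_natSinv_lt (PosNum xa)).
- by move=> k x; exact: clamp_norm.
- by apply: tcont_bounded_sets => // x; rewrite normr1.
Unshelve. all: by end_near. Qed.
(** Good sets: they form a sigma-algebra containing the half-spaces. Finite unions are obtained by
    clamping a sum of indicators at 1, countable ones by dominated convergence. *)
Let D := [set A : set 'rV[R]_n | tcont (\1_A : 'rV[R]_n -> R)].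
Let D_sigma : sigma_algebra setT D.
Proof.
split => /=.
- by rewrite /D/= indic0; apply: tcont_cst; rewrite normr0.
- move=> A DA; rewrite /D/= setTD indicC.
  have := tcontD (tcont_cst (_ : `|1| <= 1)) (tcontZ (-1) DA).
  rewrite normr1 => /(_ (lexx _)); congr tcont; apply/funext => x.
  by rewrite !indicE; case: (x \in A); rewrite /= ?mulr1 ?mulr0; ring.
- move=> A DA.
  pose U (k : nat) := \bigcup_(j in [set j | (j < k)%N]) A j.
  apply: (@tcont_dominated (fun k => \1_(U k) : 'rV[R]_n -> R) _ (fun=> 1)).
  + elim=> [|k IH].
      rewrite (_ : U 0 = set0); first by rewrite indic0; apply: tcont_cst; rewrite normr0.
      by rewrite -subset0 => x [].
    have := tcont_clamp (tcontD IH (DA k)); congr tcont; apply/funext => x.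
    have -> : U k.+1 = U k `|` A k.
      apply/seteqP; split => y.
        move=> [j /=]; rewrite ltnS leq_eqVlt => /predU1P[->|jk Aj]; first by right.
        by left; exists j.
      move=> [[j /= jk Aj]|Ak]; first by exists j => //=; exact: leq_trans jk _.
      by exists k => /=.
    rewrite !indicE in_setU /clamp; case: (x \in U k); case: (x \in A k) => /=.
    * by rewrite (max_idPr _)// (min_idPl _)// lerDl.
    * by rewrite addr0 (max_idPr _)// (min_idPl _).
    * by rewrite add0r (max_idPr _)// (min_idPl _).
    * by rewrite addr0 (max_idPr _)// (min_idPr _).
  + move=> x; apply: cvg_near_cst.
    have [[j _ Aj]|nA] := pselect ((\bigcup_k A k) x).
      exists j.+1 => // k /= jk; rewrite !indicE !mem_set//; exists j => //.
    by apply: nearW => k; rewrite !indicE !memNset// => -[j _ Aj]; apply: nA; exists j.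
  + by move=> k x; rewrite indicE ger0_norm// lern1 leq_b1.
  + by apply: tcont_bounded_sets => // x; rewrite normr1.
Qed.

Lemma tcont_indic (A : set 'rV[R]_n) : measurable A -> tcont (\1_A : 'rV[R]_n -> R).
Proof.
have [D0 DC DU] := D_sigma.
suff H : measurable `<=` D by exact: H.
move=> {A}.
apply: smallest_sub => //; rewrite -bigcup_seq => B [i _ [A mA <-]].
rewrite setTI.
have : (@RGenOInfty.G R).-sigma.-measurable A by rewrite -RGenOInfty.measurableE.
move: A {mA}.
suff : <<s @RGenOInfty.G R >> `<=` [set A | D ((fun x : 'rV[R]_n => x ord0 i) @^-1` A)] by [].
apply: smallest_sub; first split => /=.
- by rewrite preimage_set0.
- by move=> A DA; rewrite setTD preimage_setC -setTD; exact: DC.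
- by move=> A DA; rewrite preimage_bigcup; exact: DU.
- move=> _ [a ->] /=; have := tcont_ray i a; rewrite /D/=; congr tcont; congr indic.
  by apply/seteqP; split => x /=; rewrite in_itv/= andbT.
Qed.

Lemma tcont_sum I (s : seq I) (F : I -> 'rV[R]_n -> R) :
  (forall i, tcont (F i)) -> tcont (fun x => \sum_(i <- s) F i x).
Proof.
move=> tF; elim: s => [|i s IH].
  have := @tcont_cst 0; rewrite normr0 => /(_ ler01); congr tcont.
  by apply/funext => x; rewrite big_nil.
by have := tcontD (tF i) IH; congr tcont; apply/funext => x; rewrite big_cons.
Qed.

Import HBNNSimple.

Lemma tcont_ge0 f : measurable_fun setT f -> (forall x, 0 <= f x) ->
  (forall L, square_integrable (cube L) f) -> tcont f.
Proof.
move=> mf f0 sf.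
have mEf : measurable_fun setT (EFin \o f) by exact/measurable_EFinP.
pose s := nnsfun_approx measurableT mEf.
have cs x : s k x @[k --> \oo] --> f x.
  have := @cvg_nnsfun_approx _ _ _ _ measurableT _ mEf (fun x _ => f0 x) x I.
  by move=> /fine_cvgP[].
apply: (@tcont_dominated (fun k => s k) _ f) => //.
- move=> k; rewrite (_ : (s k : _ -> _) = (fun x => \sum_(r <- finmap.enum_fset (fset_set (range (s k)))) r * \1_(s k @^-1` [set r]) x)).
    by apply: tcont_sum => r; apply: tcontZ; exact: tcont_indic.
  by apply/funext => x; rewrite fimfunE fsbig_finite.
- move=> k x; rewrite ger0_norm//.
  rewrite -(cvg_lim _ (cs x))//; apply: nondecreasing_cvgn_le.
    by move=> a b ab; exact/lefP/nd_nnsfun_approx.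
  by apply/cvg_ex; exists (f x); exact: cs.
Qed.

Lemma tcont_sqi f : square_integrable setT f -> tcont f.
Proof.
move=> [mf sf].
have aux g : measurable_fun setT g -> (forall x, 0 <= g x) -> (forall x, g x <= `|f x|) -> tcont g.
  move=> mg g0 gf; apply: tcont_ge0 => // L; split; first exact: measurable_funTS.
  apply: le_lt_trans sf.
  apply: (@le_trans _ _ (\int[mu]_x ((g x) ^+ 2)%:E)%E).
    apply: ge0_subset_integral => //; first exact: measurable_cube.
      exact/measurable_EFinP/measurable_funX.
    by move=> x _; rewrite lee_fin sqr_ge0.
  apply: ge0_le_integral => //.
  - by move=> x _; rewrite lee_fin sqr_ge0.
  - exact/measurable_EFinP/measurable_funX.
  - exact/measurable_EFinP/measurable_funX.
  - move=> x _; rewrite lee_fin -[leRHS]real_normK ?num_real//.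
    by rewrite lerXn2r ?nnegrE.
have := tcontD (aux (fun x => Num.max (f x) 0) _ _ _) (tcontZ (-1) (aux (fun x => Num.max (- f x) 0) _ _ _)).
have E : (fun x => Num.max (f x) 0 + -1 * Num.max (- f x) 0) = f.
  apply/funext => x; have [h|/ltW h] := leP 0 (f x).
    by rewrite (max_idPr _) ?oppr_le0// mulr0 addr0.
  by rewrite (max_idPl _) ?oppr_ge0// mulN1r opprK add0r.
rewrite E; apply.
- exact: measurable_maxr.
- by move=> x; rewrite le_max lexx orbT.
- by move=> x; rewrite ge_max normr_ge0 ler_norm.
- by apply: measurable_maxr => //; exact: measurableT_comp.
- by move=> x; rewrite le_max lexx orbT.
- by move=> x; rewrite ge_max normr_ge0 -normrN ler_norm.
Qed.

End tcont.

(** * Mollification *)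

Section smooth_lines.
Context (R : realType) (n : nat).
Implicit Types (f g : 'rV[R]_n -> R) (x y z : 'rV[R]_n).
Local Notation e_ i := (delta_mx ord0 i : 'rV[R]_n).

Lemma is_derive_line f z i t : derivable f (z + t *: e_ i) (e_ i) ->
  is_derive t 1 (fun s : R => f (z + s *: e_ i)) (partial i f (z + t *: e_ i)).
Proof.
move=> df.
have E : (fun h : R => h^-1 *: (((fun s : R => f (z + s *: e_ i)) \o shift t) (h *: 1)
      - f (z + t *: e_ i))) =
    (fun h : R => h^-1 *: ((f \o shift (z + t *: e_ i)) (h *: e_ i) - f (z + t *: e_ i))).
  apply/funext => h /=; congr (_ *: (f _ - _)).
  by rewrite /shift/= scalerDl addrCA [h *: 1]mulr1.
by split; [rewrite /derivable E|rewrite /derive E].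
Qed.

Lemma mvt_line f z i h : (forall x, derivable f x (e_ i)) ->
  exists2 c, `|c| <= `|h| & f (z + h *: e_ i) - f z = h * partial i f (z + c *: e_ i).
Proof.
move=> df; pose g (s : R) := f (z + s *: e_ i).
pose dg (s : R) := partial i f (z + s *: e_ i).
have gd (s : R) : is_derive s 1 g (dg s) by apply: is_derive_line; exact: df.
have cg a b : {within `[a, b], continuous g}.
  apply: derivable_within_continuous => s _.
  by have [] := gd s.
have g0 : g 0 = f z by rewrite /g scale0r addr0.
have [h0|h0] := leP 0 h.
  have [c ch] := MVT_segment h0 (fun s _ => gd s) (cg _ _).
  rewrite g0 subr0 => H; exists c; last by rewrite -/(g h) H mulrC.
  by move: ch; rewrite in_itv/= => /andP[c0 ch]; rewrite !ger0_norm.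
have [c ch] := MVT_segment (ltW h0) (fun s _ => gd s) (cg _ _).
rewrite g0 sub0r => H; exists c; last by rewrite -/(g h) -opprB H mulrN opprK mulrC.
move: ch; rewrite in_itv/= => /andP[ch c0].
by rewrite !ler0_norm ?(ltW h0)// lerN2.
Qed.

(** Only partial derivatives are at hand, so the increment is covered one coordinate at a time, with
    the mean value theorem on each piece. The list [s] is there for the induction. *)
Lemma lipschitz_line f (B : R) (h : 'I_n -> R) (s : seq 'I_n) x : 0 <= B ->
  (forall i x, derivable f x (e_ i)) -> (forall i x, `|partial i f x| <= B) ->
  `|f (x + \sum_(i <- s) h i *: e_ i) - f x| <= B * \sum_(i <- s) `|h i|.
Proof.
move=> B0 df fB; elim: s => [|i s IH].
  by rewrite !big_nil addr0 subrr normr0 mulr0.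
rewrite !big_cons; have [c _ E] := mvt_line (x + \sum_(j <- s) h j *: e_ j) (h i) (df i).
rewrite addrCA [h i *: _ + _]addrC.
rewrite (_ : f _ - f x = (f (x + \sum_(j <- s) h j *: e_ j + h i *: e_ i) - f (x + \sum_(j <- s) h j *: e_ j))
  + (f (x + \sum_(j <- s) h j *: e_ j) - f x)); last by rewrite addrA subrK.
rewrite (le_trans (ler_normD _ _))// mulrDr lerD// E normrM mulrC.
by rewrite ler_wpM2r.
Qed.

Lemma taylor_line f (B : R) (h : 'I_n -> R) (s : seq 'I_n) x : 0 <= B ->
  (forall i x, derivable f x (e_ i)) ->
  (forall i j x, derivable (partial i f) x (e_ j)) ->
  (forall i j x, `|partial j (partial i f) x| <= B) ->
  `|f (x + \sum_(i <- s) h i *: e_ i) - f x - \sum_(i <- s) h i * partial i f x| <=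
  B * (\sum_(i <- s) `|h i|) ^+ 2.
Proof.
move=> B0 df ddf fB; elim: s => [|i s IH].
  by rewrite !big_nil addr0 subrr subr0 normr0 expr0n mulr0.
rewrite !big_cons; set w := \sum_(j <- s) h j *: e_ j; set N := \sum_(j <- s) `|h j|.
have N0 : 0 <= N by exact: sumr_ge0.
have [c ch E] := mvt_line (x + w) (h i) (df i).
have H := @lipschitz_line (partial i f) B h s x B0 (ddf i) (fB i).
have H2 : `|partial i f (x + w + c *: e_ i) - partial i f x| <= B * (N + `|h i|).
  have [c2 _ E2] := mvt_line (x + w) c (ddf i i).
  rewrite (_ : _ - _ = (partial i f (x + w + c *: e_ i) - partial i f (x + w)) +
     (partial i f (x + w) - partial i f x)); last by rewrite addrA subrK.
  rewrite (le_trans (ler_normD _ _))// addrC mulrDr lerD//.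
  by rewrite E2 normrM mulrC ler_pM.
rewrite addrCA [h i *: _ + _]addrC -/w.
rewrite (_ : _ - _ - _ = (h i * (partial i f (x + w + c *: e_ i) - partial i f x)) +
   (f (x + w) - f x - \sum_(j <- s) h j * partial j f x)); last first.
  by rewrite mulrBr -E; ring.
rewrite (le_trans (ler_normD _ _))// normrM.
apply: (@le_trans _ _ (`|h i| * (B * (N + `|h i|)) + B * N ^+ 2)).
  by rewrite lerD// ler_wpM2l.
have hi : 0 <= `|h i| by [].
rewrite -subr_ge0 (_ : _ - _ = B * (`|h i| * N)); last by ring.
by rewrite mulr_ge0// mulr_ge0.
Qed.

Lemma row_sum_delta (h : 'rV[R]_n) : h = \sum_i h ord0 i *: e_ i.
Proof. by rewrite {1}(row_sum_delta h). Qed.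

Lemma sum_norm_dot (h : 'rV[R]_n) : (\sum_i `|h ord0 i|) ^+ 2 <= n%:R * dot h h.
Proof.
have := cauchy_schwarz (\row_i `|h ord0 i|) (const_mx 1 : 'rV[R]_n).
rewrite /dot; under eq_bigr do rewrite !mxE mulr1.
under [X in _ <= X * _]eq_bigr do rewrite !mxE -expr2 real_normK ?num_real// expr2.
move=> /le_trans; apply; rewrite mulrC ler_wpM2r ?dot_ge0//.
under eq_bigr do rewrite !mxE mulr1.
by rewrite sumr_const card_ord.
Qed.

Lemma taylor2 f (B : R) x y : 0 <= B ->
  (forall i x, derivable f x (e_ i)) ->
  (forall i j x, derivable (partial i f) x (e_ j)) ->
  (forall i j x, `|partial j (partial i f) x| <= B) ->
  `|f y - f x - dot (y - x) (\row_i partial i f x)| <= B * n%:R * dot (y - x) (y - x).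
Proof.
move=> B0 df ddf fB.
have := taylor_line (fun i => (y - x) ord0 i) (index_enum _) x B0 df ddf fB.
rewrite -row_sum_delta (addrC x) subrK => H.
rewrite (_ : dot _ (\row__ _) = \sum_i (y - x) ord0 i * partial i f x); last first.
  by apply: eq_bigr => i _; rewrite !mxE.
by rewrite (le_trans H)// -mulrA ler_wpM2l// sum_norm_dot.
Qed.

Lemma lipschitz_partial f (B : R) x y : 0 <= B ->
  (forall i x, derivable f x (e_ i)) -> (forall i x, `|partial i f x| <= B) ->
  `|f y - f x| <= B * \sum_i `|(y - x) ord0 i|.
Proof.
move=> B0 df fB.
have := lipschitz_line (fun i => (y - x) ord0 i) (index_enum _) x B0 df fB.
by rewrite -row_sum_delta (addrC x) subrK.
Qed.

End smooth_lines.

Section bsmooth.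
Context (R : realType) (n : nat).
Implicit Types (f g : 'rV[R]_n -> R) (x : 'rV[R]_n).
Local Notation e_ i := (delta_mx ord0 i : 'rV[R]_n).

(* [m] times differentiable, with bounded partial derivatives. *)
Fixpoint bsmooth (m : nat) f : Prop :=
  [/\ continuous f, exists B : R, forall x, `|f x| <= B &
      if m is m'.+1 then
        forall i, (forall x, derivable f x (e_ i)) /\ bsmooth m' (partial i f)
      else True].

Lemma bsmoothW m f : bsmooth m.+1 f -> bsmooth m f.
Proof.
elim: m f => [|m IH] f [cf bf H]; first by split.
by split => // i; have [df /IH] := H i.
Qed.

Lemma bsmooth_smooth f : (forall m, bsmooth m f) -> smooth f.
Proof.
move=> bf s; have {}bf : forall m, bsmooth m (partials s f).
  elim: s => [//|i s IH] m /=; have [_ _ H] := IH m.+1.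
  by have [] := H i.
split; first by case: (bf 0%N).
by move=> i x; have [_ _ H] := bf 1%N; have [] := H i.
Qed.

Lemma bsmoothD m f g : bsmooth m f -> bsmooth m g -> bsmooth m (fun x => f x + g x).
Proof.
elim: m f g => [|m IH] f g [cf [B fB] Hf] [cg [C gC] Hg]; split.
- by move=> x; exact: continuousD (cf x) (cg x).
- by exists (B + C) => x; rewrite (le_trans (ler_normD _ _))// lerD.
- by [].
- by move=> x; exact: continuousD (cf x) (cg x).
- by exists (B + C) => x; rewrite (le_trans (ler_normD _ _))// lerD.
- move=> i; have [df Df] := Hf i; have [dg Dg] := Hg i; split.
    by move=> x; exact: derivableD.
  have := IH _ _ Df Dg; congr bsmooth.
  by apply/funext => x; rewrite /partial deriveD.
Qed.

Lemma bsmoothM m f g : bsmooth m f -> bsmooth m g -> bsmooth m (fun x => f x * g x).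
Proof.
elim: m f g => [|m IH] f g [cf [B fB] Hf] [cg [C gC] Hg]; split.
- by move=> x; exact: continuousM (cf x) (cg x).
- by exists (B * C) => x; rewrite normrM ler_pM.
- by [].
- by move=> x; exact: continuousM (cf x) (cg x).
- by exists (B * C) => x; rewrite normrM ler_pM.
- move=> i; have [df Df] := Hf i; have [dg Dg] := Hg i; split.
    by move=> x; exact: derivableM.
  have fm : bsmooth m f by apply: bsmoothW; split => //; exists B.
  have gm : bsmooth m g by apply: bsmoothW; split => //; exists C.
  have := bsmoothD (IH _ _ fm Dg) (IH _ _ gm Df); congr bsmooth.
  by apply/funext => x; rewrite /partial deriveM.
Qed.

Lemma bsmooth_cst m (a : R) : bsmooth m (fun=> a).
Proof.
have ca (b : R) : continuous (fun _ : 'rV[R]_n => b) by exact: cst_continuous.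
elim: m a => [|m IH] a; split => //; try by exists `|a|.
- move=> i; split; first by move=> x; exact: derivable_cst.
  have := IH 0; congr bsmooth; apply/funext => x.
  by rewrite /partial derive_cst.
Qed.

Lemma bsmooth_prod m I (s : seq I) (F : I -> 'rV[R]_n -> R) :
  (forall i, bsmooth m (F i)) -> bsmooth m (fun x => \prod_(i <- s) F i x).
Proof.
move=> bF; elim: s => [|i s IH].
  have := bsmooth_cst m 1; congr bsmooth.
  by apply/funext => x; rewrite big_nil.
by have := bsmoothM (bF i) IH; congr bsmooth; apply/funext => x; rewrite big_cons.
Qed.

Fixpoint bsmooth1 (m : nat) (f : R -> R) : Prop :=
  [/\ continuous f, exists B : R, forall t, `|f t| <= B &
      if m is m'.+1 then
        exists2 df : R -> R, (forall t : R, is_derive t 1 f (df t)) & bsmooth1 m' df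
      else True].

Lemma bsmooth_coord m (f : R -> R) (a b : R) (i : 'I_n) : bsmooth1 m f ->
  bsmooth m (fun x => f (a * x ord0 i + b)).
Proof.
have caff : continuous (fun x : 'rV[R]_n => a * x ord0 i + b).
  move=> x; apply: (@continuousD _ _ _ (fun x : 'rV[R]_n => a * x ord0 i) (fun=> b)); last exact: cst_continuous.
  apply: (@continuousM _ _ (fun=> a) (fun x : 'rV[R]_n => x ord0 i)); first exact: cst_continuous.
  exact: coord_continuous.
have cc (h : R -> R) : continuous h -> continuous (fun x : 'rV[R]_n => h (a * x ord0 i + b)).
  by move=> ch x; apply: (@continuous_comp _ _ _ (fun x : 'rV[R]_n => a * x ord0 i + b) h); [exact: caff|exact: ch].
elim: m f => [|m IH] f [cf [B fB] Hf]; split.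
- exact: cc.
- by exists B.
- by [].
- exact: cc.
- by exists B.
- move=> j; have [df dfE bdf] := Hf.
  have key x : is_derive x (e_ j) (fun x => f (a * x ord0 i + b))
      ((j == i)%:R * a * df (a * x ord0 i + b)).
    pose g (t : R) := f (a * t + b).
    have dg (t : R) : is_derive t 1 g (a * df (a * t + b)).
      have daff : is_derive t 1 (fun t : R => a * t + b) a.
        have := @is_deriveD R R R (a *: (id : R -> R)) (cst b) t 1 _ _
          (@is_deriveZ R R R id a t 1 1 (is_derive_id t 1)) (is_derive_cst b t 1).
        by congr is_derive; rewrite addr0 [_ *: _]mulr1.
      have := @is_derive1_comp R f (fun t : R => a * t + b) t _ _ (dfE _) daff.
      by rewrite mulrC.
    have E : (fun h : R => h^-1 *: (((fun x => f (a * x ord0 i + b)) \o shift x) (h *: e_ j)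
        - f (a * x ord0 i + b))) =
      (fun h : R => h^-1 *: ((g \o shift (x ord0 i)) (h *: (j == i)%:R) - g (x ord0 i))).
      apply/funext => h /=; congr (_ *: (f (a * _ + b) - _)).
      by rewrite !mxE eqxx/= eq_sym.
    have [gd gv] : is_derive (x ord0 i) (j == i)%:R g ((j == i)%:R * a * df (a * x ord0 i + b)).
      have [_|_] := eqVneq j i; first by rewrite mul1r; exact: dg.
      by rewrite !mul0r; exact: is_derive0.
    by split; [rewrite /derivable E|rewrite /derive E].
  split; first by move=> x; have [] := key x.
  have := bsmoothM (bsmooth_cst m ((j == i)%:R * a)) (IH _ bdf); congr bsmooth.
  by apply/funext => x; rewrite /partial; have [_ ->] := key x.
Qed.

End bsmooth.

(** * A smooth bump function *)

Section flat.
Context (R : realType).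

(** The functions exp(-1/t) / t^j, extended by 0. Derivatives of members are linear combinations of
    members, so a single induction proves smoothness and boundedness at every order. *)
Definition flat (j : nat) (t : R) : R :=
  if 0 < t then t ^- j * expR (- t^-1) else 0.

Lemma flat_ge0 j t : 0 <= flat j t.
Proof.
rewrite /flat; case: ifP => // t0.
by rewrite mulr_ge0 ?expR_ge0// invr_ge0 exprn_ge0// ltW.
Qed.

(** Together with the uniform bound [flat_le], this makes [flat j] of order t^2 at 0, so that its
    derivative there is 0. *)
Lemma flatS2 j t : flat j t = t ^+ 2 * flat j.+2 t.
Proof.
rewrite /flat; case: ifPn => t0; last by rewrite mulr0.
rewrite mulrA; congr (_ * _); rewrite -!exprVn -[j.+2]addn2 exprD mulrCA.
by rewrite -exprMn divff ?gt_eqF// expr1n mulr1.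
Qed.

(** With u = 1/t this is u^j <= j! exp(u), a single term of the exponential series. *)
Lemma flat_le j t : flat j t <= j`!%:R.
Proof.
rewrite /flat; case: ifPn => // t0.
case: j => [|j].
  by rewrite expr0 invr1 mul1r expR_le1 oppr_le0 invr_ge0 ltW.
rewrite expRN ler_pdivrMr ?expR_gt0// -exprVn.
have t1 : 0 <= t^-1 by rewrite invr_ge0 ltW.
rewrite mulrC -ler_pdivrMr ?ltr0n ?fact_gt0//.
by rewrite (le_trans _ (expR_ge1Dxn j t1))// lerDr.
Qed.

Lemma is_derive_flat j (t : R) :
  is_derive t (1 : R) (flat j) (flat j.+2 t - j%:R * flat j.+1 t).
Proof.
have [t0|t0|->] := ltgtP t 0.
- rewrite /flat !ltNge (ltW t0)/= mulr0 subr0.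
  apply: (@near_eq_is_derive R R^o R^o (cst 0)).
    near=> s; rewrite /flat ltNge (_ : s <= 0)//.
    by apply: ltW; near: s; exact: lt_nbhsl.
- pose g (r : R) := r ^+ j * expR (- r).
  have dg (r : R) : is_derive r 1 g (j%:R * r ^+ j.-1 * expR (- r) - r ^+ j * expR (- r)).
    have d1 : is_derive r 1 (fun s : R => s ^+ j) (j%:R * r ^+ j.-1).
      split; first exact: exprn_derivable.
      by case: j @g => [|k] g; [rewrite (_ : (fun s : R => s ^+ 0) = cst 1) ?derive_cst ?mul0r|rewrite exp_derive [_ *: 1]mulr1].
    have d2 := @is_derive1_comp R expR (-%R) r _ _ (is_derive_expR (- r)) (is_deriveNid r 1).
    have := @is_deriveM R R _ _ r 1 _ _ d1 d2.
    by congr is_derive; rewrite /GRing.scale/=; ring.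
  have dv : is_derive t 1 (fun s : R => s^-1) (- t ^- 2).
    have tn0 : t != 0 by rewrite gt_eqF.
    have := @is_deriveV R id t 1 1 tn0 (is_derive_id t 1).
    by congr is_derive; rewrite [_ *: _]mulr1.
  apply: (@near_eq_is_derive R R^o R^o (g \o (fun s : R => s^-1))).
    near=> s; rewrite /flat (_ : 0 < s) /g/= ?exprVn//.
    by near: s; exact: lt_nbhsr.
  have := @is_derive1_comp R g (fun s : R => s^-1) t _ _ (dg _) dv.
  congr is_derive; rewrite /flat t0 -!exprVn.
  case: j @g dg => [|j] g dg /=; first by rewrite !mul0r; ring.
  by rewrite !exprS; ring.
- rewrite /flat ltxx mulr0 subr0.
  have key : (fun h : R => h^-1 *: ((flat j \o shift 0) (h *: 1) - flat j 0)) @ 0^' --> (0 : R).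
    pose C := (j.+2`!%:R : R).
    apply/cvgrPdist_le => e e0.
    have C0 : 0 < C by rewrite ltr0n fact_gt0.
    near=> h.
    have h0 : h != 0 by near: h; exact: nbhs_dnbhs_neq.
    have he : `|h| <= e / C.
      near: h; apply: nbhs_dnbhs; near=> h; rewrite -[h]subr0 -normrN opprB.
      by near: h; apply: cvgr_dist_le; rewrite ?divr_gt0//; exact: cvg_id.
    rewrite sub0r normrN /= addr0 [h *: 1]mulr1 {2}/flat ltxx subr0 flatS2.
    rewrite [_ *: _]mulrA expr2 mulrA mulVf// mul1r normrM.
    rewrite (ger0_norm (flat_ge0 _ _)) (le_trans (ler_wpM2l _ (flat_le _ _)))//.
    by rewrite -ler_pdivlMr.
  split; first by apply/cvg_ex; exists 0.
  exact/cvg_lim.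
Unshelve. all: by end_near. Qed.
Lemma bsmooth1D m (f g : R -> R) : bsmooth1 m f -> bsmooth1 m g ->
  bsmooth1 m (fun x => f x + g x).
Proof.
elim: m f g => [|m IH] f g [cf [B fB] Hf] [cg [C gC] Hg]; split.
- by move=> x; exact: continuousD (cf x) (cg x).
- by exists (B + C) => x; rewrite (le_trans (ler_normD _ _))// lerD.
- by [].
- by move=> x; exact: continuousD (cf x) (cg x).
- by exists (B + C) => x; rewrite (le_trans (ler_normD _ _))// lerD.
- have [df dfE bdf] := Hf; have [dg dgE bdg] := Hg.
  exists (fun x => df x + dg x); last exact: IH.
  by move=> t; exact: is_deriveD.
Qed.

Lemma bsmooth1Z m (a : R) (f : R -> R) : bsmooth1 m f ->
  bsmooth1 m (fun x => a * f x).
Proof.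
elim: m f => [|m IH] f [cf [B fB] Hf]; split.
- by move=> x; exact: continuousM (@cst_continuous _ _ a x) (cf x).
- by exists (`|a| * B) => x; rewrite normrM ler_wpM2l.
- by [].
- by move=> x; exact: continuousM (@cst_continuous _ _ a x) (cf x).
- by exists (`|a| * B) => x; rewrite normrM ler_wpM2l.
- have [df dfE bdf] := Hf.
  exists (fun x => a * df x); last exact: IH.
  by move=> t; exact: is_deriveZ.
Qed.

Lemma bsmooth1_flat m j : bsmooth1 m (flat j).
Proof.
have cf k : continuous (flat k).
  move=> t; apply: differentiable_continuous; apply/derivable1_diffP.
  by have [] := is_derive_flat k t.
have bf k : exists B : R, forall t, `|flat k t| <= B.
  by exists k`!%:R => t; rewrite ger0_norm ?flat_ge0// flat_le.
elim: m j => [|m IH] j; split => //.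
exists (fun t => flat j.+2 t + (- j%:R) * flat j.+1 t).
  by move=> t; rewrite mulNr; exact: is_derive_flat.
by apply: bsmooth1D => //; exact: bsmooth1Z.
Qed.

End flat.

Section bump.
Context (R : realType) (n : nat).
Local Notation mu := (lebesgue_row R n).
Local Notation e_ i := (delta_mx ord0 i : 'rV[R]_n).

Lemma bsmooth_shift m (f : 'rV[R]_n -> R) (a : 'rV[R]_n) : bsmooth m f ->
  bsmooth m (fun x => f (x - a)).
Proof.
have cs (h : 'rV[R]_n -> R) : continuous h -> continuous (fun x : 'rV[R]_n => h (x - a)).
  move=> ch x; apply: (@continuous_comp _ _ _ (fun x : 'rV[R]_n => x - a) h x); last exact: ch.
  exact: (continuousB (@cvg_id _ _) (@cst_continuous _ _ a x)).
elim: m f => [|m IH] f [cf [B fB] Hf]; split; try exact: cs; try by exists B.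
  by [].
move=> i; have [df Df] := Hf i.
have E x : (fun h : R => h^-1 *: (((fun x => f (x - a)) \o shift x) (h *: e_ i) - f (x - a))) =
    (fun h : R => h^-1 *: ((f \o shift (x - a)) (h *: e_ i) - f (x - a))).
  by apply/funext => h /=; rewrite addrA.
split; first by move=> x; rewrite /derivable E; exact: df.
have := IH _ Df; congr bsmooth; apply/funext => x.
by rewrite /partial [in RHS]/derive E.
Qed.

Lemma exists_bump (d : R) : 0 < d -> exists rho : 'rV[R]_n -> R,
  [/\ forall m, bsmooth m rho, forall z, 0 <= rho z,
      forall z, ~ cube d z -> rho z = 0 & \int[mu]_z rho z = 1].
Proof.
move=> d0.
(* In each coordinate the two factors are simultaneously positive exactly when [|z ord0 i| < d]. The
   product is positive on an open ball, whence the positive integral by which it is normalized. *)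
pose b (z : 'rV[R]_n) := \prod_i (flat 0 (1 * z ord0 i + d) * flat 0 ((-1) * z ord0 i + d)).
have sb m : bsmooth m b.
  by apply: bsmooth_prod => i; apply: bsmoothM; apply: bsmooth_coord; exact: bsmooth1_flat.
have b0 z : 0 <= b z by apply: prodr_ge0 => i _; rewrite mulr_ge0 ?flat_ge0.
have bd z : ~ cube d z -> b z = 0.
  move=> zd; have [i zi] : exists i, d < `|z ord0 i|.
    by apply/not_existsP => H; apply: zd => i; rewrite leNgt; exact/negP.
  rewrite /b (bigD1 i)//= [X in X * _](_ : _ = 0) ?mul0r//.
  move: zi; rewrite /flat mul1r mulN1r; case: (leP 0 (z ord0 i)) => zi.
    rewrite ger0_norm// => dz; rewrite [X in _ * X]ifF ?mulr0//.
    by apply/negbTE; rewrite -leNgt; lra.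
  rewrite ltr0_norm// => dz; rewrite ifF ?mul0r//.
  by apply/negbTE; rewrite -leNgt; lra.
have [cb [B bB] _] := sb 0%N.
have mb : measurable_fun setT b by exact: continuous_measurable_row.
have B0 : 0 <= B by exact: le_trans (bB 0).
have bs : bdd_supp B d b.
  split => // x; rewrite b0/=.
  by rewrite (le_trans (ler_norm _)).
have fin := bdd_supp_fin_num (ltW d0) bs.
pose c := \int[mu]_z b z.
have c0 : 0 < c.
  rewrite lt_neqAle eq_sym; apply/andP; split; last by apply: Rintegral_ge0.
  apply/negP => /eqP c00.
  have : (\int[mu]_z `|(b z)%:E| = 0)%E.
    under eq_integral do rewrite gee0_abs ?lee_fin//.
    by rewrite -[LHS]fineK//; congr EFin; exact: c00.
  move/(ae_eq_integral_abs mu measurableT).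
  move=> /(_ _)/wrap[]; first exact/measurable_EFinP.
  move=> [N [mN N0 sub]].
  pose U := (ball (0 : 'rV[R]_n) d)^°.
  have := @open_lebesgue_row_gt0 R n U (@open_interior _ _).
  move=> /(_ _)/wrap[]; first by exists 0; exact: nbhsx_ballx.
  rewrite ltNge => /negP; apply.
  rewrite -N0; apply: le_measure; rewrite ?inE//.
    by apply: open_measurable_row; exact: open_interior.
  move=> z /interior_subset zd; apply: sub => /= /(_ I) [] /eqP.
  rewrite gt_eqF//; apply: prodr_gt0 => i _.
  have [_ /(_ ord0 i)] := zd; rewrite /ball/= mxE sub0r normrN ltr_norml => /andP[z1 z2].
  rewrite /flat mul1r mulN1r !ifT ?mulr_gt0 ?expR_gt0//; lra.
exists (fun z => c^-1 * b z); split.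
- by move=> m; apply: bsmoothM => //; exact: bsmooth_cst.
- by move=> z; rewrite mulr_ge0// invr_ge0 ltW.
- by move=> z /bd ->; rewrite mulr0.
- rewrite RintegralZl//; first by rewrite mulVf// gt_eqF.
  apply/integrableP; split; first exact/measurable_EFinP.
  under eq_integral do rewrite /= ger0_norm//.
  by rewrite ltey_eq fin.
Qed.

End bump.

(** * Mollified functions and their gradients *)

Section mollify.
Context (R : realType) (n : nat).
Local Notation mu := (lebesgue_row R n).
Local Notation e_ i := (delta_mx ord0 i : 'rV[R]_n).

Lemma Rintegral_sum I (s : seq I) (D : set 'rV[R]_n) (F : I -> 'rV[R]_n -> R) : measurable D ->
  (forall i, mu.-integrable D (EFin \o F i)) ->
  \int[mu]_(x in D) (\sum_(i <- s) F i x) = \sum_(i <- s) \int[mu]_(x in D) F i x.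
Proof.
move=> mD iF.
have isum t : mu.-integrable D (EFin \o (fun x => \sum_(i <- t) F i x)).
  rewrite (_ : EFin \o _ = (fun x => \sum_(i <- t) (F i x)%:E)%E); last first.
    by apply/funext => x /=; rewrite sumEFin.
  by apply: integrable_sum => // i _; exact: iF.
elim: s => [|i s IH].
  rewrite big_nil; under eq_Rintegral do rewrite big_nil.
  by rewrite /Rintegral integral0.
under eq_Rintegral do rewrite big_cons.
by rewrite big_cons -IH RintegralD.
Qed.

Lemma Rintegral_shift (f : 'rV[R]_n -> R) (z : 'rV[R]_n) : measurable_fun setT f ->
  \int[mu]_x f (x - z) = \int[mu]_x f x.
Proof.
move=> mf; rewrite /Rintegral; congr fine.
have mE : measurable_fun setT (EFin \o f) by exact/measurable_EFinP.
rewrite integralE [in RHS]integralE; congr (_ - _)%E.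
  rewrite -(@ge0_integral_shift R n (fun x => ((EFin \o f)^\+ x)%E) z)//.
    by apply: eq_integral => x _; rewrite !funeposE.
  exact: measurable_funepos mE.
rewrite -(@ge0_integral_shift R n (fun x => ((EFin \o f)^\- x)%E) z)//.
  by apply: eq_integral => x _; rewrite !funenegE.
exact: measurable_funeneg mE.
Qed.

Lemma sqi_bddM (D : set 'rV[R]_n) (u v : 'rV[R]_n -> R) (B : R) : measurable D ->
  square_integrable D u -> measurable_fun D v -> (forall x, D x -> `|v x| <= B) ->
  square_integrable D (fun x => v x * u x).
Proof.
move=> mD [mu_ su] mv vB; split; first exact: measurable_funM.
apply: (@le_lt_trans _ _ (\int[mu]_(x in D) ((B ^+ 2)%:E * (u x ^+ 2)%:E))%E).
  apply: ge0_le_integral => //.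
  - by move=> x _; rewrite lee_fin sqr_ge0.
  - by apply/measurable_EFinP/measurable_funX; exact: measurable_funM.
  - apply/measurable_EFinP; apply: measurable_funM => //.
    exact: measurable_funX.
  - move=> x Dx; rewrite -EFinM lee_fin exprMn ler_wpM2r ?sqr_ge0//.
    rewrite -[leLHS]real_normK ?num_real// lerXn2r ?nnegrE ?vB//.
    by rewrite (le_trans _ (vB x Dx)).
rewrite ge0_integralZl//.
- by rewrite lte_mul_pinfty// lee_fin sqr_ge0.
- by apply/measurable_EFinP/measurable_funX.
- by move=> x _; rewrite lee_fin sqr_ge0.
- by rewrite lee_fin sqr_ge0.
Qed.

Lemma sqi_patch (D : set 'rV[R]_n) u : measurable D -> square_integrable D u ->
  square_integrable setT (u \_ D).
Proof.
move=> mD [mu_ su]; split; first exact/(measurable_restrictT _ mD).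
move: su; rewrite integral_mkcond; congr (_ < _)%E; apply: eq_integral => x _.
by rewrite !patchE; case: ifPn => //; rewrite expr0n.
Qed.

Lemma sqi_shiftT u z : square_integrable setT u ->
  square_integrable setT (fun x : 'rV[R]_n => u (x - z)).
Proof.
move=> [mu_ su]; split; first exact: measurable_comp_shift.
rewrite (@ge0_integral_shift R n (fun x => (u x ^+ 2)%:E) z)//.
  exact/measurable_EFinP/measurable_funX.
by move=> x; rewrite lee_fin sqr_ge0.
Qed.

Lemma partial_shift i (f : 'rV[R]_n -> R) (a x : 'rV[R]_n) :
  partial i (fun z => f (z - a)) x = partial i f (x - a).
Proof.
rewrite /partial /derive (_ : (fun h : R => h^-1 *: _) =
  (fun h : R => h^-1 *: ((f \o shift (x - a)) (h *: e_ i) - f (x - a))))//.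
by apply/funext => h /=; rewrite addrA.
Qed.

Lemma compact_cube_shift (d : R) (a : 'rV[R]_n) : compact [set z : 'rV[R]_n | cube d (z - a)].
Proof.
rewrite (_ : [set z | _] =
  [set v : 'rV[R]_n | forall i, `[a ord0 i - d, a ord0 i + d]%classic (v ord0 i)]).
  by apply: (@rV_compact R n (fun i => `[a ord0 i - d, a ord0 i + d]%classic)) => i; exact: segment_compact.
apply/seteqP; split => z /= H i; have := H i; rewrite /= !mxE ?in_itv/=.
  by rewrite ler_norml => /andP[? ?]; apply/andP; split; lra.
by move=> /andP[? ?]; rewrite ler_norml; apply/andP; split; lra.
Qed.

(** Convolution with the reflected kernel: [fun z => rho (z - x)] is then directly a test function
    of [Om] whenever [x] is far enough from the boundary. *)
Definition mollify (Om : set 'rV[R]_n) (rho f : 'rV[R]_n -> R) x :=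
  \int[mu]_(z in Om) (f z * rho (z - x)).

Section fixed_bump.
Variables (Om : set 'rV[R]_n) (rho : 'rV[R]_n -> R).
Hypotheses (oO : open Om) (bO : bounded_set Om).
Hypothesis rhos : forall m, bsmooth m rho.

Let mO : measurable Om. Proof. exact: open_measurable_row. Qed.

Let Ooo : (mu Om < +oo)%E. Proof. exact: bounded_lebesgue_row_lty. Qed.

Let mrho : measurable_fun setT rho.
Proof. by apply: continuous_measurable_row; case: (rhos 0%N). Qed.

Let sqi1 : square_integrable Om (fun=> 1).
Proof. by apply: (sqi_bounded mO (B := 1)) => // x _; rewrite normr1. Qed.

Let sqi_rho x : square_integrable Om (fun z => rho (z - x)).
Proof.
have [_ [B rB] _] := rhos 0%N.
apply: (sqi_bounded mO (B := B)) => //.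
by apply: measurable_funTS; exact: (measurable_comp_shift x mrho).
Qed.

Let int_abs f : square_integrable Om f -> mu.-integrable Om (EFin \o (fun x => `|f x|)).
Proof.
move=> sf; have := integrable_norm (sqiM mO sf sqi1).
by congr integrable; apply/funext => x /=; rewrite mulr1.
Qed.

Lemma mollify_bounded f : square_integrable Om f -> exists B, forall x, `|mollify Om rho f x| <= B.
Proof.
move=> sf; have [_ [B rB] _] := rhos 0%N.
have B0 : 0 <= B by exact: le_trans (rB 0).
exists (B * \int[mu]_(z in Om) `|f z|) => x.
rewrite (le_trans (le_normr_Rintegral _ _))//; first exact: sqiM.
rewrite -RintegralZl//; last exact: int_abs.
apply: le_Rintegral => //.
- exact: integrable_norm (sqiM mO sf (sqi_rho x)).
- by apply: RintegrableZl => //; exact: int_abs.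
- by move=> z _; rewrite normrM mulrC ler_wpM2r.
Qed.

Lemma mollify_continuous f : square_integrable Om f -> continuous (mollify Om rho f).
Proof.
move=> sf x; have [_ _ r1] := rhos 1%N.
have dr i y : derivable rho y (delta_mx ord0 i) by have [] := r1 i.
have /choice[B rB] : forall i, exists B, forall y, `|partial i rho y| <= B.
  by move=> i; have [_ []] := r1 i.
pose C := \sum_i `|B i|.
have C0 : 0 <= C by exact: sumr_ge0.
have rC i y : `|partial i rho y| <= C.
  rewrite (le_trans (rB i y))// (le_trans (ler_norm _))//.
  by rewrite /C (bigD1 i)//= lerDl sumr_ge0.
pose I := \int[mu]_(z in Om) `|f z|.
have I0 : 0 <= I by exact: Rintegral_ge0.
have key y : `|mollify Om rho f x - mollify Om rho f y| <= (C * \sum_i `|(x - y) ord0 i|) * I.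
  rewrite /mollify -RintegralB//; [|exact: sqiM|exact: sqiM].
  have s2 : square_integrable Om (fun z => rho (z - x) - rho (z - y)) by exact: sqiB.
  have -> : \int[mu]_(z in Om) (f z * rho (z - x) - f z * rho (z - y)) =
      \int[mu]_(z in Om) (f z * (rho (z - x) - rho (z - y))).
    by apply: eq_Rintegral => z _; rewrite mulrBr.
  rewrite (le_trans (le_normr_Rintegral _ _))//; first exact: sqiM.
  rewrite /I -RintegralZl//; last exact: int_abs.
  apply: le_Rintegral => //.
  - exact: integrable_norm (sqiM mO sf s2).
  - by apply: RintegrableZl => //; exact: int_abs.
  - move=> z _; rewrite normrM mulrC ler_wpM2r//.
    rewrite (le_trans (lipschitz_partial _ _ C0 dr rC))// le_eqVlt; apply/orP; left; apply/eqP.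
    congr (C * _); apply: eq_bigr => i _; rewrite -normrN; congr (`|_|).
    by rewrite !mxE; ring.
apply/(@cvgrPdist_le R R^o _ (nbhs x)) => e e0.
pose K := C * n%:R * I + 1.
have K0 : 0 < K by rewrite ltr_wpDl// !mulr_ge0.
have eK : 0 < e / K by rewrite divr_gt0.
apply/nbhs_ballP; exists (e / K) => //= y [_ xy].
rewrite (le_trans (key y))//.
apply: (@le_trans _ _ (C * (n%:R * (e / K)) * I)).
  rewrite ler_wpM2r// ler_wpM2l//.
  rewrite (le_trans (ler_sum _ (fun i _ => _ : _ <= e / K)))//.
    by move=> i _; have := xy ord0 i; rewrite /ball/= !mxE => /ltW.
  by rewrite sumr_const card_ord mulr_natl.
rewrite [leLHS](_ : _ = (C * n%:R * I) * (e / K)); last by ring.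
rewrite mulrCA ler_piMr ?(ltW e0)// ler_pdivrMr// mul1r /K lerDl//.
Qed.

(** The second-order Taylor formula for [rho] is integrated against [f]; the weak gradient turns the
    first-order term into the mollified [g]. This is the pointwise inequality that Prekopa-Leindler
    needs. [M] depends on neither point, and only [x] has to be away from the boundary. *)
Lemma mollify_grad f (g : 'I_n -> 'rV[R]_n -> R) : sobolev1 Om f g ->
  exists2 M : R, 0 <= M & forall (d : R) (x y : 'rV[R]_n), (forall z, ~ cube d z -> rho z = 0) ->
  (forall z, cube d (z - x) -> Om z) ->
  mollify Om rho f x - mollify Om rho f y <=
  dot (\row_i mollify Om rho (g i) x) (x - y) + M * dot (x - y) (x - y).
Proof.
move=> [sf sg wg]; have [_ _ r2] := rhos 2%N.
have dr i y : derivable rho y (delta_mx ord0 i) by have [] := r2 i.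
have ddr i j y : derivable (partial i rho) y (delta_mx ord0 j).
  by have [_ [_ _ /(_ j)[]]] := r2 i.
have /choice[B rB] : forall p : 'I_n * 'I_n, exists B, forall y, `|partial p.2 (partial p.1 rho) y| <= B.
  by move=> p; have [_ [_ _ /(_ p.2)[_ []]]] := r2 p.1.
pose C := \sum_p `|B p|.
have C0 : 0 <= C by exact: sumr_ge0.
have rC i j y : `|partial j (partial i rho) y| <= C.
  rewrite (le_trans (rB (i, j) y))// (le_trans (ler_norm _))//.
  by rewrite /C (bigD1 (i, j))//= lerDl sumr_ge0.
pose I := \int[mu]_(z in Om) `|f z|.
exists (C * n%:R * I); first by rewrite !mulr_ge0// Rintegral_ge0.
move=> d x y rd Ox.
have sp i : square_integrable Om (fun z => partial i rho (z - x)).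
  have [_ [cp [b pb] _]] := r2 i.
  apply: (sqi_bounded mO (B := b)) => //.
  apply: measurable_funTS; apply: measurable_comp_shift.
  exact: continuous_measurable_row.
have gE i : \int[mu]_(z in Om) (f z * partial i rho (z - x)) = - mollify Om rho (g i) x.
  have tf : test_function Om (fun z => rho (z - x)).
    split; first by apply: bsmooth_smooth => m; exact: bsmooth_shift.
    exists [set z | cube d (z - x)]; split => //; last by move=> z /= zx; exact: rd.
    exact: compact_cube_shift.
  rewrite /mollify -(wg _ tf i); apply: eq_Rintegral => z _; congr (_ * _).
  by rewrite partial_shift.
have sq : square_integrable Om (fun z => dot (x - y) (\row_i partial i rho (z - x))).
  rewrite (_ : (fun z => _) = (fun z => \sum_i (x - y) ord0 i * partial i rho (z - x))).
    by apply: sqi_sum => // i; exact: sqiZ.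
  by apply/funext => z; apply: eq_bigr => i _; rewrite !mxE.
have E : dot (\row_i mollify Om rho (g i) x) (x - y) =
    - \int[mu]_(z in Om) (f z * dot (x - y) (\row_i partial i rho (z - x))).
  transitivity (- \int[mu]_(z in Om) (\sum_i (x - y) ord0 i * (f z * partial i rho (z - x)))).
    rewrite Rintegral_sum//; last by move=> i; apply: RintegrableZl => //; exact: sqiM.
    rewrite -sumrN; apply: eq_bigr => i _.
    by rewrite RintegralZl//; [rewrite gE !mxE mulrN opprK mulrC|exact: sqiM].
  congr (- _); apply: eq_Rintegral => z _; rewrite /dot mulr_sumr.
  by apply: eq_bigr => i _; rewrite !mxE mulrCA.
rewrite E -lerBlDl opprK.
have s2 : square_integrable Om (fun z => rho (z - x) - rho (z - y)) by exact: sqiB.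
have s3 := sqiD mO s2 sq.
have -> : mollify Om rho f x - mollify Om rho f y +
   \int[mu]_(z in Om) (f z * dot (x - y) (\row_i partial i rho (z - x))) =
   \int[mu]_(z in Om) (f z * (rho (z - x) - rho (z - y) + dot (x - y) (\row_i partial i rho (z - x)))).
  rewrite /mollify -RintegralB//; [|exact: sqiM|exact: sqiM].
  rewrite -RintegralD//; [|by apply: RintegrableB => //; exact: sqiM|exact: sqiM].
  by apply: eq_Rintegral => z _; rewrite mulrDr mulrBr.
rewrite (le_trans (ler_norm _))// (le_trans (le_normr_Rintegral _ _))//; first exact: sqiM.
rewrite mulrAC -RintegralZl//; last exact: int_abs.
apply: le_Rintegral => //.
- exact: integrable_norm (sqiM mO sf s3).
- by apply: RintegrableZl => //; exact: int_abs.
- move=> z _; rewrite normrM mulrC ler_wpM2r//.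
  have := taylor2 (z - x) (z - y) C0 dr ddr rC.
  rewrite (_ : z - y - (z - x) = x - y); last by apply/rowP => k; rewrite !mxE; ring.
  by rewrite -normrN; congr (`|_| <= _); ring.
Qed.

End fixed_bump.

(** Jensen's inequality for the probability density [rho], proved by integrating (g - m)^2 rho >=
    0. *)
Lemma mollify_jensen (f rho : 'rV[R]_n -> R) (d : R) (x : 'rV[R]_n) : square_integrable setT f ->
  (forall m, bsmooth m rho) -> (forall z, 0 <= rho z) -> (forall z, ~ cube d z -> rho z = 0) ->
  \int[mu]_z rho z = 1 ->
  (((mollify setT rho f x - f x) ^+ 2)%:E <=
   \int[mu]_w ((f (w + x)%R - f x) ^+ 2 * rho w)%:E)%E.
Proof.
move=> sf rs r0 rd r1; pose D : set 'rV[R]_n := cube d.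
have mD : measurable D by exact: measurable_cube.
have Doo : (mu D < +oo)%E by exact: cube_lty.
have [cr [B rB] _] := rs 0%N.
have mr : measurable_fun setT rho by exact: continuous_measurable_row.
pose g w := f (w + x)%R - f x.
have sfx : square_integrable setT (fun w : 'rV[R]_n => f (w + x)).
  by have := sqi_shiftT (- x) sf; congr square_integrable; apply/funext => w; rewrite opprK.
have sg : square_integrable D g.
  apply: sqiB => //; first exact: sqiS sfx.
  exact: (sqi_bounded mD (B := `|f x|)).
have srho : square_integrable D rho.
  by apply: (sqi_bounded mD (B := B)) => //; exact: measurable_funTS.
have sgr : square_integrable D (fun w => rho w * g w).
  by apply: (sqi_bddM (B := B)) => //; exact: measurable_funTS.
have toD (h : 'rV[R]_n -> R) : (forall w, ~ D w -> h w = 0) -> \int[mu]_w h w = \int[mu]_(w in D) h w.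
  move=> h0; rewrite [RHS]Rintegral_mkcond; apply: eq_Rintegral => w _.
  by rewrite patchE; case: ifPn => // /negP; rewrite inE => /h0.
have r1D : \int[mu]_(w in D) rho w = 1 by rewrite -toD.
have ir : mu.-integrable D (EFin \o rho) by exact: (integrable_bounded mD (B := B) Doo srho.1).
set m := mollify setT rho f x - f x.
have mE : m = \int[mu]_(w in D) (g w * rho w).
  transitivity (\int[mu]_(w in D) (f (w + x)%R * rho w) - \int[mu]_(w in D) (f x * rho w)).
    rewrite RintegralZl// r1D mulr1 -toD; last by move=> w /rd ->; rewrite mulr0.
    rewrite /m; congr (_ - _); rewrite /mollify.
    rewrite -[RHS](Rintegral_shift x).
      by apply: eq_Rintegral => z _; rewrite subrK.
    by apply: measurable_funM => //; exact: sfx.1.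
  rewrite -RintegralB//.
  - by apply: eq_Rintegral => w _; rewrite mulrBl.
  - by apply: sqiM => //; exact: sqiS sfx.
  - by apply: RintegrableZl.
have i2 : mu.-integrable D (EFin \o (fun w => g w ^+ 2 * rho w)).
  have := sqiM mD sg sgr; congr integrable; apply/funext => w /=.
  by rewrite mulrCA mulrC expr2.
have i1 : mu.-integrable D (EFin \o (fun w => g w * rho w)) by exact: sqiM.
have -> : (\int[mu]_w ((f (w + x)%R - f x) ^+ 2 * rho w)%:E =
    (\int[mu]_(w in D) (g w ^+ 2 * rho w))%:E)%E.
  rewrite -toD; last by move=> w /rd ->; rewrite mulr0.
  rewrite /Rintegral fineK//.
  have := i2; move=> /(integrable_fin_num mD).
  rewrite integral_mkcond (_ : (_ \_ D) = (fun w => ((f (w + x)%R - f x) ^+ 2 * rho w)%:E))//.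
  by apply/funext => w; rewrite patchE; case: ifPn => // /negP; rewrite inE => /rd ->; rewrite mulr0.
rewrite lee_fin.
have : 0 <= \int[mu]_(w in D) ((g w ^+ 2 * rho w - (2 * m) * (g w * rho w)) + m ^+ 2 * rho w).
  apply: Rintegral_ge0 => w _.
  rewrite (_ : _ + _ = (g w - m) ^+ 2 * rho w); last by ring.
  by rewrite mulr_ge0// sqr_ge0.
rewrite RintegralD//; [|by apply: RintegrableB => //; exact: RintegrableZl|exact: RintegrableZl].
rewrite RintegralB//; last exact: RintegrableZl.
rewrite !RintegralZl// -mE r1D; lra.
Qed.

(** Once [f] is extended by zero outside [Om], Jensen and Tonelli bound the error by an average,
    over [w] in the support of [rho], of the squared L^2 distance between [f] and its translate by
    [w]. The radius [d0] is thus uniform in [rho]. *)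
Lemma mollify_l2 (Om : set 'rV[R]_n) (f : 'rV[R]_n -> R) (e : R) :
  open Om -> bounded_set Om -> square_integrable Om f -> 0 < e ->
  exists2 d0 : R, 0 < d0 & forall rho : 'rV[R]_n -> R,
    (forall m, bsmooth m rho) -> (forall z, 0 <= rho z) -> (forall z, ~ cube d0 z -> rho z = 0) ->
    \int[mu]_z rho z = 1 ->
    (\int[mu]_(x in Om) ((mollify Om rho f x - f x) ^+ 2)%:E <= e%:E)%E.
Proof.
move=> oO bO sf e0; have mO : measurable Om by exact: open_measurable_row.
have sf' := sqi_patch mO sf; set f' := f \_ Om in sf'.
have [L L0 OL] := bounded_set_cube bO.
have [mf' _ /(_ L e e0)[d0 d00 tc]] := tcont_sqi sf'.
exists d0 => // rho rs r0 rd r1.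
have [cr [B rB] _] := rs 0%N.
have mr : measurable_fun setT rho by exact: continuous_measurable_row.
have mL := @measurable_cube R n L.
have mm : measurable_fun setT (mollify Om rho f).
  by apply: continuous_measurable_row; exact: mollify_continuous.
pose phi (p : 'rV[R]_n * 'rV[R]_n) := (\1_(cube L) p.1 * ((f' (p.2 + p.1)%R - f' p.1) ^+ 2 * rho p.2))%:E.
have mphi : measurable_fun setT phi.
  apply/measurable_EFinP; apply: measurable_funM.
    by apply: measurableT_comp => //; exact: measurable_indic.
  apply: measurable_funM; last exact: measurableT_comp.
  apply: measurable_funX; apply: measurable_funB; last exact: measurableT_comp.
  apply: measurableT_comp => //; apply: measurable_row => i.
  rewrite (_ : (fun p => _) = (fun p : 'rV[R]_n * 'rV[R]_n => p.2 ord0 i + p.1 ord0 i)).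
    by apply: measurable_funD; apply: (measurableT_comp (measurable_row_coord i)).
  by apply/funext => p; rewrite mxE.
have phi0 p : (0 <= phi p)%E by rewrite lee_fin mulr_ge0// mulr_ge0// sqr_ge0.
apply: (@le_trans _ _ (\int[mu]_x \int[mu]_w phi (x, w))%E).
  rewrite integral_mkcond; apply: ge0_le_integral => //.
  - by move=> x _; rewrite patchE; case: ifP => // _; rewrite lee_fin sqr_ge0.
  - apply/(measurable_restrictT _ mO); apply/measurable_EFinP/measurable_funX.
    by apply: measurable_funB; [exact: measurable_funTS|exact: sf.1].
  - exact: (measurable_fun_fubini_tonelli_F phi mphi phi0).
  - move=> x _; rewrite patchE; case: ifPn => [/set_mem Ox|_]; last exact: integral_ge0.
    have -> : mollify Om rho f x = mollify setT rho f' x.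
      rewrite /mollify Rintegral_mkcond; apply: eq_Rintegral => z _.
      by rewrite /f' !patchE; case: ifP => //; rewrite mul0r.
    have -> : f x = f' x by rewrite /f' patchE mem_set.
    rewrite (le_trans (mollify_jensen x sf' rs r0 rd r1))//.
    apply: ge0_le_integral => //.
    + by move=> w _; rewrite lee_fin mulr_ge0// sqr_ge0.
    + apply/measurable_EFinP; apply: measurable_funM => //.
      apply: measurable_funX; apply: measurable_funB => //.
      by have := measurable_comp_shift (- x) mf'; congr measurable_fun; apply/funext => w; rewrite opprK.
    + exact: (measurableT_comp mphi (measurable_pair1 x)).
    + by move=> w _; rewrite /phi lee_fin indicE mem_set ?mul1r//; exact: OL.
rewrite (fubini_tonelli phi mphi phi0).
apply: (@le_trans _ _ (\int[mu]_w (e%:E * (rho w)%:E))%E).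
  apply: ge0_le_integral => //.
  - by move=> w _; exact: integral_ge0.
  - exact: (measurable_fun_fubini_tonelli_G phi mphi phi0).
  - by apply/measurable_EFinP; exact: measurable_funM.
  - move=> w _.
    have [wd|/rd rw] := pselect (cube d0 w); last first.
      rewrite rw mule0 integral0_eq// => x _.
      by rewrite /phi/= rw !mulr0.
    rewrite [leLHS](_ : _ = (rho w)%:E * \int[mu]_(x in cube L) ((f' (x - - w)%R - f' x) ^+ 2)%:E)%E.
      rewrite muleC lee_wpmul2r ?lee_fin//; apply: tc => i.
      by rewrite mxE normrN; exact: wd.
    rewrite -ge0_integralZl//; last first.
    + by rewrite lee_fin.
    + by move=> x _; rewrite lee_fin sqr_ge0.
    + apply/measurable_EFinP; apply: measurable_funX; apply: measurable_funTS.
      by apply: measurable_funB => //; exact: measurable_comp_shift.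
    rewrite [RHS]integral_mkcond; apply: eq_integral => x _.
    rewrite /phi/= patchE indicE opprK (addrC x w).
    by case: ifP => _; rewrite ?mul0r// mul1r -EFinM mulrC.
rewrite ge0_integralZl//; last exact: ltW.
- rewrite (_ : (\int[mu]_w (rho w)%:E)%E = 1%E) ?mule1//.
  rewrite -[LHS]fineK; first by congr EFin.
  have bs : bdd_supp B d0 rho.
    split => // x; rewrite r0/= (le_trans (ler_norm _))//.
  exact: bdd_supp_fin_num (ltW d00) bs.
- exact/measurable_EFinP.
- by move=> w _; rewrite lee_fin.
Qed.

Lemma mollification (Om : set 'rV[R]_n) (u : 'rV[R]_n -> R) g (e eta : R) :
  open Om -> bounded_set Om -> sobolev1 Om u g -> 0 < e -> 0 < eta ->
  exists (F : 'rV[R]_n -> R) (G : 'rV[R]_n -> 'rV[R]_n) (B M : R),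
    [/\ measurable_fun setT F /\ (forall i, measurable_fun setT (fun x => G x ord0 i)),
        forall x, `|F x| <= B /\ (forall i, `|G x ord0 i| <= B),
        0 <= M /\ (forall x y, (forall z, cube eta (z - x) -> Om z) ->
          F x - F y <= dot (G x) (x - y) + M * dot (x - y) (x - y)),
        (\int[mu]_(x in Om) ((F x - u x) ^+ 2)%:E <= e%:E)%E &
        forall i, (\int[mu]_(x in Om) ((G x ord0 i - g i x) ^+ 2)%:E <= e%:E)%E].
Proof.
move=> oO bO sug e0 eta0; have [su sg _] := sug.
have [d1 d10 H1] := mollify_l2 oO bO su e0.
have /choice[d2 H2] : forall i, exists d : R, 0 < d /\ forall rho : 'rV[R]_n -> R,
    (forall m, bsmooth m rho) -> (forall z, 0 <= rho z) -> (forall z, ~ cube d z -> rho z = 0) ->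
    \int[mu]_z rho z = 1 ->
    (\int[mu]_(x in Om) ((mollify Om rho (g i) x - g i x) ^+ 2)%:E <= e%:E)%E.
  by move=> i; have [d d0 H] := mollify_l2 oO bO (sg i) e0; exists d.
(* A single radius for [u] and all components of the gradient, at most [eta] so that the first-order
   inequality holds at distance [eta] from the boundary. *)
pose d := \big[Num.min/Num.min d1 eta]_i d2 i.
have dd1 : d <= d1 by rewrite (le_trans (bigmin_le_id _ _ _ _))// ge_min lexx.
have deta : d <= eta by rewrite (le_trans (bigmin_le_id _ _ _ _))// ge_min lexx orbT.
have dd2 i : d <= d2 i by exact: bigmin_le_cond.
have d0 : 0 < d.
  by apply: lt_bigmin => [|i _]; [rewrite lt_min d10|have [] := H2 i].
have [rho [rs r0 rd r1]] := @exists_bump R n d d0.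
have cw (d' : R) z : d <= d' -> ~ cube d' z -> rho z = 0.
  by move=> dd' zd; apply: rd => zd'; apply: zd => i; rewrite (le_trans (zd' i)).
have [Bu hu] := mollify_bounded oO bO rs su.
have /choice[Bg hg] : forall i, exists B, forall x, `|mollify Om rho (g i) x| <= B.
  by move=> i; exact: mollify_bounded.
have [M M0 hM] := mollify_grad oO bO rs sug.
exists (mollify Om rho u), (fun x => \row_i mollify Om rho (g i) x).
exists (`|Bu| + \sum_i `|Bg i|), M; split.
- split; first by apply: continuous_measurable_row; exact: mollify_continuous.
  move=> i; rewrite (_ : (fun x => _) = mollify Om rho (g i)).
    by apply: continuous_measurable_row; exact: mollify_continuous.
  by apply/funext => x; rewrite mxE.
- move=> x; split.
    rewrite (le_trans (hu x))// (le_trans (ler_norm _))// lerDl.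
    exact: sumr_ge0.
  move=> i; rewrite mxE (le_trans (hg i x))// (le_trans (ler_norm _))//.
  by rewrite (bigD1 i)//= addrCA lerDl addr_ge0// sumr_ge0.
- split => // x y Ox; apply: (hM d) => // z zx; apply: Ox => i.
  by rewrite (le_trans (zx i)).
- by apply: H1 => // z; exact: cw.
- move=> i; under eq_integral do rewrite mxE.
  have [_ H] := H2 i; apply: H => // z; exact: cw.
Qed.

End mollify.

(** * Poincare inequality on a union of cells *)

Section covering.
Context (R : realType) (n : nat).
Local Notation mu := (lebesgue_row R n).
Local Notation K0 := (8 * expR 2^-1 : R).

Lemma Rintegral_null (D : set 'rV[R]_n) (h : 'rV[R]_n -> R) : measurable D -> measurable_fun D h ->
  mu D = 0%E -> \int[mu]_(x in D) h x = 0.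
Proof.
move=> mD mh D0; rewrite /Rintegral (_ : (\int[mu]_(x in D) (h x)%:E)%E = 0%E)//.
by apply: (null_set_integral mD) => //; exact/measurable_EFinP.
Qed.

Lemma Rintegral_sqr_le (D : set 'rV[R]_n) (h : 'rV[R]_n -> R) : measurable D -> (mu D < +oo)%E ->
  square_integrable D h ->
  (\int[mu]_(x in D) h x) ^+ 2 <= fine (mu D) * \int[mu]_(x in D) (h x ^+ 2).
Proof.
move=> mD Doo sh; set V := fine (mu D).
have s1 : square_integrable D (fun=> 1).
  by apply: (sqi_bounded mD (B := 1)) => // x _; rewrite normr1.
have ih : mu.-integrable D (EFin \o h).
  by have := sqiM mD sh s1; congr integrable; apply/funext => x /=; rewrite mulr1.
have i2 := sqi_integrable sh.
have V0 : 0 <= V by exact: fine_ge0.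
have [/eqP V00|Vn0] := boolP (V == 0).
  rewrite V00 mul0r Rintegral_null ?expr0n//; first by case: sh.
  by rewrite -[LHS]fineK ?ge0_fin_numE// -/V V00.
have Vp : 0 < V by rewrite lt_neqAle eq_sym Vn0.
set I := \int[mu]_(x in D) h x; set J := \int[mu]_(x in D) (h x ^+ 2).
pose m := I / V.
have : 0 <= \int[mu]_(x in D) ((h x ^+ 2 - (2 * m) * h x) + m ^+ 2).
  apply: Rintegral_ge0 => x _; rewrite (_ : _ + _ = (h x - m) ^+ 2) ?sqr_ge0//; ring.
rewrite RintegralD//.
- rewrite RintegralB//; last exact: RintegrableZl.
  rewrite RintegralZl// Rintegral_cst// -/V -/I -/J.
  have -> : J - 2 * m * I + m ^+ 2 * V = (V * J - I ^+ 2) / V by rewrite /m; field.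
  by rewrite pmulr_lge0 ?invr_gt0// subr_ge0.
- by apply: RintegrableB => //; exact: RintegrableZl.
- by apply: (integrable_bounded mD (B := `|m ^+ 2|)).
Qed.

(** Dominated convergence. Membership in [A k] is only asked eventually, so the sets may fail to be
    nested. *)
Lemma cvg_Rintegral_exhaust (D : set 'rV[R]_n) (A : nat -> set 'rV[R]_n) (h : 'rV[R]_n -> R) :
  measurable D -> (forall k, measurable (A k)) -> mu.-integrable D (EFin \o h) ->
  (forall x, D x -> \forall k \near \oo, A k x) ->
  \int[mu]_(x in D `&` A k) h x @[k --> \oo] --> \int[mu]_(x in D) h x.
Proof.
move=> mD mA ih DA.
under eq_fun do rewrite Rintegral_mkcondr.
have mh : measurable_fun D h by apply/measurable_EFinP; case/integrableP: ih.
have := @dominated_convergence _ _ R mu D mD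
  (fun k x => ((h \_ (A k)) x)%:E) (EFin \o h) (fun x => `|(EFin \o h) x|%E).
case.
- move=> k; apply/measurable_EFinP.
  rewrite (_ : h \_ (A k) = (fun x => h x * \1_(A k) x)).
    by apply: measurable_funM => //; exact: measurable_indic.
  by apply/funext => x; rewrite patchE indicE; case: ifP; rewrite ?mulr1 ?mulr0.
- by apply/measurable_EFinP.
- apply: aeW => x Dx; apply: cvg_near_cst.
  by apply: filterS (DA x Dx) => k Ax /=; rewrite patchE mem_set.
- exact: integrable_abse.
- apply: aeW => x k _ /=; rewrite patchE; case: ifP => // _.
  by rewrite normr0 lee_fin.
move=> _ _ h3; apply: fine_cvg; apply: cvg_trans h3 _.
by rewrite /Rintegral fineK// (integrable_fin_num mD ih).
Qed.

Lemma le_mean_sqr (D : set 'rV[R]_n) (F u : 'rV[R]_n -> R) : measurable D ->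
  square_integrable D F -> square_integrable D u ->
  \int[mu]_(x in D) (F x ^+ 2) <=
    2 * \int[mu]_(x in D) (u x ^+ 2) + 2 * \int[mu]_(x in D) ((F x - u x) ^+ 2).
Proof.
move=> mD sF su; have sB := sqiB mD sF su.
rewrite -!RintegralZl//; [|exact: sqi_integrable|exact: sqi_integrable].
rewrite -RintegralD//; [|by apply: RintegrableZl => //; exact: sqi_integrable..].
apply: le_Rintegral => //; first exact: sqi_integrable.
  by apply: RintegrableD => //; apply: RintegrableZl => //; exact: sqi_integrable.
by move=> x _; have := sqr_ge0 (F x - 2 * u x); nra.
Qed.

Lemma fine_sqr_le (Om D : set 'rV[R]_n) (f : 'rV[R]_n -> R) (e : R) : measurable Om -> measurable D ->
  D `<=` Om -> square_integrable Om f ->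
  (\int[mu]_(x in Om) (f x ^+ 2)%:E <= e%:E)%E -> \int[mu]_(x in D) (f x ^+ 2) <= e.
Proof.
move=> mO mD DO sf fe; rewrite -lee_fin; apply: le_trans fe.
rewrite /Rintegral fineK; last exact: (integrable_fin_num mD (sqi_integrable (sqiS mD mO DO sf))).
apply: ge0_subset_integral => //; last by move=> x _; rewrite lee_fin sqr_ge0.
by apply/measurable_EFinP/measurable_funX; case: sf.
Qed.

Section cell.
Variables (Om : set 'rV[R]_n) (p : 'rV[R]_n) (rho : R) (u : 'rV[R]_n -> R) (g : 'I_n -> 'rV[R]_n -> R).
Hypotheses (oO : open Om) (bO : bounded_set Om) (cO : convex Om) (rho0 : 0 < rho).
Hypothesis (sug : sobolev1 Om u g).

Let mO : measurable Om. Proof. exact: open_measurable_row. Qed.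
Let Ooo : (mu Om < +oo)%E. Proof. exact: bounded_lebesgue_row_lty. Qed.
Let su : square_integrable Om u. Proof. by case: sug. Qed.
Let sg i : square_integrable Om (g i). Proof. by case: sug. Qed.

(* The cell stays away from the boundary of [Om], where [u] can be mollified. *)
Lemma inner_cell_poincare (C : set 'rV[R]_n) (eta : R) : measurable C -> convex C -> 0 < eta ->
  (forall x, C x -> dot (x - p) (x - p) <= rho ^+ 2) ->
  (forall x, C x -> forall z, cube eta (z - x) -> Om z) ->
  fine (mu C) * \int[mu]_(x in C) (u x ^+ 2) <=
  4 * (\int[mu]_(x in C) u x) ^+ 2 +
  4 * K0 * rho ^+ 2 * fine (mu C) * \int[mu]_(x in C) (\sum_i g i x ^+ 2).
Proof.
move=> mC cC eta0 Cp Ceta.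
have CO : C `<=` Om.
  by move=> x Cx; apply: (Ceta x Cx) => i; rewrite subrr mxE normr0 ltW.
have Coo : (mu C < +oo)%E by apply: le_lt_trans Ooo; apply: le_measure; rewrite ?inE.
set V := fine (mu C); have V0 : 0 <= V by exact: fine_ge0.
have K00 : 0 <= K0 by rewrite mulr_ge0// expR_ge0.
have suC : square_integrable C u by exact: sqiS su.
have sgC i : square_integrable C (g i) by exact: sqiS (sg i).
apply/ler_addgt0Pr => e e0.
have KV : 0 <= K0 * rho ^+ 2 * V := mulr_ge0 (mulr_ge0 K00 (sqr_ge0 _)) V0.
(* [A] dominates the sum of the coefficients with which the mollification error enters below: the
   terms in [V] come from [u], the one in [n%:R] from the components of the gradient, and the 1
   keeps [A] positive. *)
pose A := 8 * V + 4 * (K0 * rho ^+ 2 * V) * n%:R + 1.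
have A0 : 0 < A by rewrite ltr_wpDl// addr_ge0//; [exact: mulr_ge0|by rewrite mulr_ge0// mulr_ge0].
have eA : 0 < e / A by rewrite divr_gt0.
have [F [G [B [M [[mF mG] FGB [M0 FM] Fu Gg]]]]] := mollification oO bO sug eA eta0.
have sF : square_integrable Om F.
  by apply: (sqi_bounded mO (B := B)) => //; [exact: measurable_funTS|move=> x _; case: (FGB x)].
have sG i : square_integrable Om (fun x => G x ord0 i).
  apply: (sqi_bounded mO (B := B)) => //; first exact: measurable_funTS.
  by move=> x _; case: (FGB x).
have sFC : square_integrable C F by exact: sqiS sF.
have sGC i : square_integrable C (fun x => G x ord0 i) by exact: sqiS (sG i).
have B0 : 0 <= B by have [b _] := FGB 0; exact: le_trans b.
have {}Fu : \int[mu]_(x in C) ((F x - u x) ^+ 2) <= e / A.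
  by apply: (fine_sqr_le mO) Fu => //; exact: sqiB.
have {}Gg i : \int[mu]_(x in C) ((G x ord0 i - g i x) ^+ 2) <= e / A.
  by apply: (fine_sqr_le mO) (Gg i) => //; exact: sqiB.
have mGG : measurable_fun C (fun x => dot (G x) (G x)).
  apply: measurable_funTS; apply: measurable_dot; exact: measurable_row.
have GB x : dot (G x) (G x) <= n%:R * B ^+ 2.
  rewrite /dot (le_trans (ler_sum _ (fun i _ => _ : _ <= B ^+ 2)))//.
    move=> i _; rewrite -expr2 -real_normK ?num_real// lerXn2r ?nnegrE//.
    by case: (FGB x).
  by rewrite sumr_const card_ord mulr_natl.
have key := @poincare_C11 R n C p rho mC cC rho0 Cp F G (Num.max B (n%:R * B ^+ 2)) M
  (measurable_funTS mF) mGG.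
have {}key : V * \int[mu]_(x in C) (F x ^+ 2) <= (\int[mu]_(x in C) F x) ^+ 2 +
  K0 * rho ^+ 2 * V * \int[mu]_(x in C) dot (G x) (G x).
  apply: key => //.
  - by move=> x _; rewrite le_max; have [-> _] := FGB x.
  - by move=> x _; rewrite le_max GB orbT.
  - by move=> x y Cx Cy; apply: FM; exact: Ceta.
have h1 : \int[mu]_(x in C) (u x ^+ 2) <= 2 * \int[mu]_(x in C) (F x ^+ 2) + 2 * (e / A).
  have := le_mean_sqr mC suC sFC.
  rewrite (_ : \int[mu]_(x in C) ((u x - F x) ^+ 2) = \int[mu]_(x in C) ((F x - u x) ^+ 2)).
    by move: Fu; lra.
  by apply: eq_Rintegral => x _; ring.
have h2 : (\int[mu]_(x in C) F x) ^+ 2 <= 2 * (\int[mu]_(x in C) u x) ^+ 2 + 2 * (V * (e / A)).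
  have h := Rintegral_sqr_le mC Coo (sqiB mC sFC suC).
  have s1 : square_integrable C (fun=> 1).
    by apply: (sqi_bounded mC (B := 1)) => // x _; rewrite normr1.
  have intg f : square_integrable C f -> mu.-integrable C (EFin \o f).
    by move=> sf; have := sqiM mC sf s1; congr integrable; apply/funext => x /=; rewrite mulr1.
  rewrite RintegralB in h; [|by []|exact: intg|exact: intg].
  have h' : V * \int[mu]_(x in C) ((F x - u x) ^+ 2) <= V * (e / A) by rewrite ler_wpM2l.
  move: h h'; rewrite -/V; set a := \int[mu]_(x in C) F x; set b := \int[mu]_(x in C) u x.
  by have := sqr_ge0 (a - 2 * b); nra.
have h3 : \int[mu]_(x in C) dot (G x) (G x) <=
    2 * \int[mu]_(x in C) (\sum_i g i x ^+ 2) + 2 * (n%:R * (e / A)).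
  rewrite [X in 2 * X]Rintegral_sum//; last by move=> i; exact: sqi_integrable.
  rewrite [leLHS](_ : _ = \sum_i \int[mu]_(x in C) (G x ord0 i ^+ 2)); last first.
    rewrite /dot -Rintegral_sum//; last by move=> i; exact: sqi_integrable.
  have -> : 2 * (n%:R * (e / A)) = \sum_(i < n) 2 * (e / A).
    by rewrite sumr_const card_ord -mulr_natl; ring.
  rewrite mulr_sumr -big_split/=; apply: ler_sum => i _.
  have := le_mean_sqr mC (sGC i) (sgC i); have := Gg i; lra.
have h4 : V * \int[mu]_(x in C) (u x ^+ 2) <= 2 * (V * \int[mu]_(x in C) (F x ^+ 2)) + 2 * (V * (e / A)).
  by rewrite mulrCA [X in _ + X]mulrCA -mulrDr ler_wpM2l.
have h5 : K0 * rho ^+ 2 * V * \int[mu]_(x in C) dot (G x) (G x) <=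
   K0 * rho ^+ 2 * V * (2 * \int[mu]_(x in C) (\sum_i g i x ^+ 2) + 2 * (n%:R * (e / A))).
  exact: ler_wpM2l.
have h6 : A * (e / A) = e by rewrite mulrCA divff ?mulr1// gt_eqF.
have VeA : 0 <= V * (e / A) by rewrite mulr_ge0// ltW.
apply: (le_trans h4).
have eE : e = 8 * (V * (e / A)) + 4 * (K0 * rho ^+ 2 * V * n%:R * (e / A)) + e / A.
  by rewrite -{1}h6; move: (e / A) => a; rewrite /A; ring.
move: eE (ltW eA) VeA key h2 h5; set eA' := e / A.
set U := \int[mu]_(x in C) (\sum_i g i x ^+ 2); set W := \int[mu]_(x in C) dot (G x) (G x).
rewrite (_ : K0 * rho ^+ 2 * V * (2 * U + 2 * (n%:R * eA')) =
  2 * (K0 * rho ^+ 2 * V * U) + 2 * (K0 * rho ^+ 2 * V * n%:R * eA')); last by ring.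
rewrite (_ : 4 * K0 * rho ^+ 2 * V * U = 4 * (K0 * rho ^+ 2 * V * U)); last by ring.
lra.
Qed.

(** The cell may touch the boundary of [Om]. It is intersected with the image [A k] of [Om] under
    the contraction of ratio [1 - s k] towards a point of the cell. This keeps it convex and away
    from the boundary, and exhausts it as [s k] tends to 0; all the integrals converge. *)
Lemma cell_poincare (C : set 'rV[R]_n) : measurable C -> convex C -> C `<=` Om ->
  (forall x, C x -> dot (x - p) (x - p) <= rho ^+ 2) ->
  fine (mu C) * \int[mu]_(x in C) (u x ^+ 2) <=
  4 * (\int[mu]_(x in C) u x) ^+ 2 +
  4 * K0 * rho ^+ 2 * fine (mu C) * \int[mu]_(x in C) (\sum_i g i x ^+ 2).
Proof.
move=> mC cC CO Cp.
have suC : square_integrable C u by exact: sqiS su.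
have sgC i : square_integrable C (g i) by exact: sqiS (sg i).
have Coo : (mu C < +oo)%E by apply: le_lt_trans Ooo; apply: le_measure; rewrite ?inE.
have s1 : square_integrable C (fun=> 1).
  by apply: (sqi_bounded mC (B := 1)) => // x _; rewrite normr1.
have [[x0 Cx0]|C0] := pselect (exists x, C x); last first.
  have C00 : mu C = 0%E.
    by rewrite (_ : C = set0) ?measure0//; apply/seteqP; split => // x Cx; apply: C0; exists x.
  by rewrite C00/= mul0r mulr0 mul0r addr0 mulr_ge0// sqr_ge0.
have Ox0 := CO _ Cx0.
have [r r0 rO] : exists2 r : R, 0 < r & forall w, cube r w -> Om (x0 + w).
  have /nbhs_ballP[r /= r0 rO] := open_nbhs_nbhs (conj oO Ox0).
  exists (r / 2); first by rewrite divr_gt0.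
  move=> w wr; apply: rO; split => // i j; rewrite (ord1 i) /ball/= !mxE.
  rewrite opprD addrA subrr sub0r normrN (le_lt_trans (wr j))// ltr_pdivrMr//.
  by rewrite ltr_pMr// ltr1n.
(* The shift by 2 keeps [s k] below 1 from the start, and makes the ratio [(1 - s k)^-1] equal to 1
   + 1/(k+1). *)
pose s (k : nat) : R := k.+2%:R^-1.
have s0 k : 0 < s k by rewrite invr_gt0.
have s1' k : s k < 1 by rewrite invf_lt1// ltr1n.
have t0 k : 0 < 1 - s k by rewrite subr_gt0.
pose f k (x : 'rV[R]_n) := (1 - s k)^-1 *: (x - x0) + x0.
pose A k := f k @^-1` Om.
have mA k : measurable (A k).
  have := measurable_row_affine (1 - s k)^-1 (x0 - (1 - s k)^-1 *: x0) measurableT mO.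
  rewrite setTI; congr measurable; apply/funext => x; rewrite /A /f /preimage/=.
  by congr Om; apply/rowP => i; rewrite !mxE; ring.
(* A point [z] near [x] is the convex combination, with weights [1 - s k] and [s k], of [f k x],
   which is in [Om], and of a point of the cube of half-side [r] around [x0]. *)
have AO k x : A k x -> forall z, cube (s k * r) (z - x) -> Om z.
  move=> Akx z zx.
  rewrite (_ : z = (1 - s k) *: f k x + (1 - (1 - s k)) *: (x0 + (s k)^-1 *: (z - x))).
    apply: cO => //; first by rewrite (ltW (t0 k)) lerBlDr lerDl (ltW (s0 k)).
    apply: rO => i; rewrite mxE normrM ger0_norm ?invr_ge0 ?(ltW (s0 k))// mulrC ler_pdivrMr// mulrC.
    exact: zx.
  apply/rowP => i; rewrite /f !mxE; field.
  by rewrite !gt_eqF.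
have Aev x : C x -> \forall k \near \oo, A k x.
  move=> Cx; have Ox := CO _ Cx.
  have /nbhs_ballP[e /= e0 eO] := open_nbhs_nbhs (conj oO Ox).
  pose N := \sum_i `|(x - x0) ord0 i| + 1.
  have N0 : 0 < N by rewrite ltr_wpDl// sumr_ge0.
  have eN : 0 < e / N by rewrite divr_gt0.
  have := near_infty_natSinv_lt (PosNum eN); apply: filterS => k /= ke.
  apply: eO; split => // i j; rewrite (ord1 i) /ball/=.
  have -> : x ord0 j - f k x ord0 j = - (k.+1%:R^-1 * (x - x0) ord0 j).
    rewrite /f !mxE /s -[k.+2]addn1 -[k.+1]addn1 !natrD; field.
    by rewrite !gt_eqF// -?addrA ltr_wpDl.
  rewrite normrN normrM ger0_norm ?invr_ge0//.
  apply: (@le_lt_trans _ _ (k.+1%:R^-1 * N)).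
    rewrite ler_wpM2l ?invr_ge0// /N (bigD1 j)//= -addrA lerDl addr_ge0// sumr_ge0//.
  by rewrite -ltr_pdivlMr.
have ex h : square_integrable C h ->
    \int[mu]_(x in C `&` A k) (h x ^+ 2) @[k --> \oo] --> \int[mu]_(x in C) (h x ^+ 2).
  by move=> sh; apply: cvg_Rintegral_exhaust => //; exact: sqi_integrable.
have iu : mu.-integrable C (EFin \o u).
  by have := sqiM mC suC s1; congr integrable; apply/funext => x /=; rewrite mulr1.
have ev : fine (mu (C `&` A k)) @[k --> \oo] --> fine (mu C).
  have := @cvg_Rintegral_exhaust C A (fun=> 1) mC mA.
  rewrite Rintegral_cst// mul1r (_ : (fun k => _) = (fun k => fine (mu (C `&` A k)))); last first.
    by apply/funext => k; rewrite Rintegral_cst ?mul1r//; exact: measurableI.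
  apply => //; have := sqiM mC s1 s1; congr integrable; apply/funext => x /=; by rewrite mulr1.
have eg : \int[mu]_(x in C `&` A k) (\sum_i g i x ^+ 2) @[k --> \oo] -->
    \int[mu]_(x in C) (\sum_i g i x ^+ 2).
  apply: cvg_Rintegral_exhaust => //.
  rewrite (_ : EFin \o _ = (fun x => \sum_i (g i x ^+ 2)%:E)%E); last first.
    by apply/funext => x /=; rewrite sumEFin.
  by apply: integrable_sum => // i _; exact: sqi_integrable.
have eu := cvg_Rintegral_exhaust mC mA iu Aev.
have hL : fine (mu (C `&` A k)) * \int[mu]_(x in C `&` A k) (u x ^+ 2) @[k --> \oo] -->
    fine (mu C) * \int[mu]_(x in C) (u x ^+ 2) by exact: cvgM (ev) (ex _ suC).
have hR : 4 * (\int[mu]_(x in C `&` A k) u x * \int[mu]_(x in C `&` A k) u x) +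
    4 * K0 * rho ^+ 2 * fine (mu (C `&` A k)) * \int[mu]_(x in C `&` A k) (\sum_i g i x ^+ 2)
    @[k --> \oo] --> 4 * (\int[mu]_(x in C) u x * \int[mu]_(x in C) u x) +
    4 * K0 * rho ^+ 2 * fine (mu C) * \int[mu]_(x in C) (\sum_i g i x ^+ 2).
  apply: cvgD; first by apply: cvgM; [exact: cvg_cst|exact: cvgM].
  by apply: cvgM => //; apply: cvgM => //; exact: cvg_cst.
rewrite expr2; apply: (ler_cvg_to hL hR).
apply: nearW => k; rewrite -expr2.
apply: (@inner_cell_poincare _ (s k * r)).
- exact: measurableI.
- move=> x y t t01 [Cx Ax] [Cy Ay]; split; first exact: cC.
  rewrite /A /= (_ : f k _ = t *: f k x + (1 - t) *: f k y); first exact: cO.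
  by apply/rowP => i; rewrite /f !mxE; ring.
- by rewrite mulr_gt0.
- by move=> x [Cx _]; exact: Cp.
- by move=> x [_ Ax]; exact: AO.
Qed.

End cell.

Lemma measurable_cvx_cell (m : nat) (Om : set 'rV[R]_n) (p : 'I_m -> 'rV[R]_n) (i : 'I_m) :
  measurable Om -> measurable [set x | Om x /\ forall j : 'I_m,
    dot (x - p i) (x - p i) <= dot (x - p j) (x - p j) /\
    ((j < i)%N -> dot (x - p i) (x - p i) < dot (x - p j) (x - p j))].
Proof.
move=> mO; apply: measurableI => //.
have md j : measurable_fun setT (fun x : 'rV[R]_n => dot (x - p j) (x - p j)).
  by apply: measurable_dot; exact: measurable_shift.
apply: measurable_forall_ord => j.
apply: (@measurableI _ _ [set x | dot (x - p i) (x - p i) <= dot (x - p j) (x - p j)]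
    [set x | (j < i)%N -> dot (x - p i) (x - p i) < dot (x - p j) (x - p j)]).
  rewrite (_ : [set x | _] = [set x | dot (x - p i) (x - p i) - dot (x - p j) (x - p j) <= 0]).
    by apply: measurable_le_cst; exact: measurable_funB.
  by apply/seteqP; split => x /=; rewrite subr_le0.
have [ji|ji] := boolP (j < i)%N; last first.
  by rewrite (_ : [set x | _] = setT)//; apply/seteqP; split.
rewrite (_ : [set x | _] = [set x | dot (x - p i) (x - p i) - dot (x - p j) (x - p j) < 0]).
  by apply: measurable_lt_cst; exact: measurable_funB.
by apply/seteqP; split => x /=; rewrite subr_lt0 => H; [exact: H|move=> _].
Qed.

(* The cells are those of the Voronoi diagram of the [p i], ties being resolved in
   favour of the smaller index. *)
Lemma covering_poincare (m : nat) (Om : set 'rV[R]_n) (p : 'I_m -> 'rV[R]_n) (rho : R) :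
  open Om -> bounded_set Om -> convex Om -> 0 < rho ->
  (forall x, Om x -> exists i, dot (x - p i) (x - p i) <= rho ^+ 2) ->
  exists (E : 'I_m -> set 'rV[R]_n) (C : R),
    [/\ forall i, measurable (E i) /\ E i `<=` Om, 0 <= C &
     forall u g, sobolev1 Om u g ->
       \int[mu]_(x in Om) (u x ^+ 2) <=
       C * \sum_i (\int[mu]_(x in E i) u x) ^+ 2 +
       4 * K0 * rho ^+ 2 * \int[mu]_(x in Om) (\sum_i g i x ^+ 2)].
Proof.
move=> oO bO cO rho0 Op; have mO : measurable Om by exact: open_measurable_row.
have Ooo : (mu Om < +oo)%E by exact: bounded_lebesgue_row_lty.
pose d i (x : 'rV[R]_n) := dot (x - p i) (x - p i).
pose E i := [set x | Om x /\ forall j : 'I_m, d i x <= d j x /\ ((j < i)%N -> d i x < d j x)].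
have mE i : measurable (E i) by exact: measurable_cvx_cell.
have EO i : E i `<=` Om by move=> x [].
have cE i : convex (E i).
  move=> x y t t01 [Ox Ex] [Oy Ey]; split; first exact: cO.
  (* The quadratic parts cancel: a difference of two squared distances is affine in the point, so
     the cells are convex. *)
  have id j : d j (t *: x + (1 - t) *: y) - d i (t *: x + (1 - t) *: y) =
      t * (d j x - d i x) + (1 - t) * (d j y - d i y).
    rewrite /d /dot -!sumrB !mulr_sumr -big_split/=; apply: eq_bigr => k _.
    by rewrite !mxE; ring.
  have /andP[t0 t1] := t01; rewrite -subr_ge0 in t1.
  move=> j; have [x1 x2] := Ex j; have [y1 y2] := Ey j; split.
    by rewrite -subr_ge0 id addr_ge0// mulr_ge0// subr_ge0.
  move=> ji; have {}x2 := x2 ji; have {}y2 := y2 ji.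
  rewrite -subr_gt0 id; rewrite -subr_gt0 in x2; rewrite -subr_gt0 in y2.
  have [t00|tn0] := eqVneq t 0; first by rewrite t00 mul0r add0r subr0 mul1r.
  rewrite ltr_wpDr ?mulr_ge0 ?(ltW y2)// mulr_gt0// lt_neqAle eq_sym tn0.
  by have /andP[] := t01.
have Erho i x : E i x -> d i x <= rho ^+ 2.
  by move=> [Ox Ex]; have [j xj] := Op x Ox; have [+ _] := Ex j; move=> /le_trans; apply.
have Eex x : Om x -> exists i, E i x.
  move=> Ox; have [i0 _] := Op x Ox.
  have [i1 _ hi1] : extremum_spec <=%R xpredT (d^~ x) [arg min_(i < i0) d i x]%O by exact: arg_minP.
  have P1 : [forall j, d i1 x <= d j x] by apply/forallP => j; exact: hi1.
  have [i /forallP hi him] := @arg_minnP _ i1 (fun i => [forall j, d i x <= d j x]) (@nat_of_ord m) P1.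
  exists i; split => // j; split; first exact: hi.
  move=> ji; rewrite ltNge; apply/negP => dji.
  have /him : [forall k, d j x <= d k x] by apply/forallP => k; exact: le_trans (hi k).
  by rewrite leqNgt ji.
have Euniq x i j : E i x -> E j x -> i = j.
  move=> [_ Ei] [_ Ej]; apply/val_inj; apply/eqP; rewrite eqn_leq; apply/andP; split.
    rewrite leqNgt; apply/negP => ji; have [_ /(_ ji)] := Ei j; have [+ _] := Ej i.
    by move=> h1 h2; have := le_lt_trans h1 h2; rewrite ltxx.
  rewrite leqNgt; apply/negP => ij; have [_ /(_ ij)] := Ej i; have [+ _] := Ei j.
  by move=> h1 h2; have := le_lt_trans h1 h2; rewrite ltxx.
have sumE (h : 'rV[R]_n -> R) : mu.-integrable Om (EFin \o h) ->
    \int[mu]_(x in Om) h x = \sum_i \int[mu]_(x in E i) h x.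
  move=> ih; transitivity (\int[mu]_(x in Om) (\sum_i (h \_ (E i)) x)).
    apply: eq_Rintegral => x /set_mem Ox; have [i Ei] := Eex x Ox.
    rewrite (bigD1 i)//= patchE mem_set// big1 ?addr0// => j ji.
    rewrite patchE; case: ifPn => // /set_mem Ej; move/eqP: ji; case.
    exact: Euniq Ej Ei.
  rewrite Rintegral_sum//.
    by apply: eq_bigr => i _; rewrite -Rintegral_mkcondr setIidr.
  move=> i; apply: (@integrableS _ _ _ mu setT) => //.
  have := (@integrable_mkcond _ _ _ mu _ (EFin \o h) (mE i)).1 (integrableS mO (mE i) (@EO i) ih).
  by rewrite restrict_EFin.
pose V i := fine (mu (E i)).
have V0 i : 0 <= V i by exact: fine_ge0.
(* On a null cell the coefficient is 4 / 0 = 0, which is consistent because all integrals over it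
   vanish. *)
exists E, (\sum_i 4 / V i); split=> //.
  by apply: sumr_ge0 => i _; rewrite divr_ge0.
move=> u g sug; have [su sg _] := sug.
have sgi : mu.-integrable Om (EFin \o (fun x => \sum_i g i x ^+ 2)).
  rewrite (_ : EFin \o _ = (fun x => \sum_i (g i x ^+ 2)%:E)%E); last first.
    by apply/funext => x /=; rewrite sumEFin.
  by apply: integrable_sum => // i _; exact: sqi_integrable.
rewrite sumE//; last exact: sqi_integrable.
rewrite (sumE _ sgi) !mulr_sumr -big_split/=; apply: ler_sum => i _.
have := cell_poincare oO bO cO rho0 sug (mE i) (cE i) (@EO i) (Erho i).
rewrite -/(V i); set U := \int[mu]_(x in E i) (u x ^+ 2); set I := \int[mu]_(x in E i) u x.
set W := \int[mu]_(x in E i) _ => key.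
have W0 : 0 <= W by apply: Rintegral_ge0 => x _; apply: sumr_ge0 => k _; exact: sqr_ge0.
have K00 : 0 <= 4 * K0 * rho ^+ 2 * W by rewrite !mulr_ge0 ?expR_ge0 ?(ltW rho0).
apply: (@le_trans _ _ (4 / V i * I ^+ 2 + 4 * K0 * rho ^+ 2 * W)); last first.
  rewrite lerD2r ler_wpM2r ?sqr_ge0// (bigD1 i)//= lerDl sumr_ge0// => k _.
  by rewrite divr_ge0.
have [Vi0|Vn0] := eqVneq (V i) 0.
  rewrite [U](_ : _ = 0); first by rewrite Vi0 invr0 mulr0 mul0r add0r.
  apply: Rintegral_null => //.
    apply: measurable_funX; apply: measurable_funS su.1 => //; exact: EO.
  have Eoo : (mu (E i) < +oo)%E by apply: le_lt_trans Ooo; apply: le_measure; rewrite ?inE.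
  by rewrite -[LHS]fineK ?ge0_fin_numE// -/(V i) Vi0.
have Vp : 0 < V i by rewrite lt_neqAle eq_sym Vn0 V0.
rewrite -(ler_pM2l Vp) (le_trans key)// le_eqVlt; apply/orP; left; apply/eqP.
by field.
Qed.

End covering.

(** * Spectral theorem for a pair of forms *)

(** The discriminant inequality, including a vanishing leading coefficient, where an affine function
    that is nonnegative everywhere must be constant. This case arises because the forms are only
    semidefinite. *)
Lemma quad_ge0 (R : realType) (A B C : R) : 0 <= A -> (forall t, 0 <= A * t ^+ 2 + 2 * B * t + C) ->
  B ^+ 2 <= A * C.
Proof.
rewrite le_eqVlt => /orP[/eqP <- H|A0 H].
  have [->|B0] := eqVneq B 0; first by rewrite expr0n mul0r.
  have := H (- (C + 1) / (2 * B)).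
  have -> : 0 * (- (C + 1) / (2 * B)) ^+ 2 + 2 * B * (- (C + 1) / (2 * B)) + C = -1.
    by field.
  by rewrite ler0N1.
have := H (- B / A).
have -> : A * (- B / A) ^+ 2 + 2 * B * (- B / A) + C = (A * C - B ^+ 2) / A.
  by field; rewrite gt_eqF.
by rewrite pmulr_lge0 ?invr_gt0// subr_ge0.
Qed.

Lemma exists_left_kernel (R : fieldType) p q (M : 'M[R]_(q, p)) : (p < q)%N ->
  exists2 c : 'rV[R]_q, c != 0 & c *m M = 0.
Proof.
move=> pq; have : kermx M != 0.
  rewrite kermx_eq0; apply/negP => /eqP rM.
  by have := rank_leq_col M; rewrite rM leqNgt pq.
move=> /rowV0Pn[c /sub_kermxP cM c0]; by exists c.
Qed.

Section spectral.
Context (R : realType) (V : lmodType R).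
Variable H : set V.
Hypothesis H0 : H 0.
Hypothesis HL : forall (t : R) x y, H x -> H y -> H (t *: x + y).

(** The axioms are relative to [H], since the integrals defining the forms are additive only on
    integrable data. The forms are merely semidefinite because functions equal almost everywhere are
    not identified. *)
Definition psd_form (q : V -> V -> R) := [/\ forall x y, H x -> H y -> q x y = q y x,
  forall (t : R) x y z, H x -> H y -> H z -> q (t *: x + y) z = t * q x z + q y z &
  forall x, H x -> 0 <= q x x].

Lemma HZ (t : R) x : H x -> H (t *: x).
Proof. by move=> Hx; rewrite -[_ *: _]addr0; exact: HL. Qed.

Lemma HD x y : H x -> H y -> H (x + y).
Proof. by move=> Hx Hy; rewrite -[x]scale1r; exact: HL. Qed.

Lemma HB x y : H x -> H y -> H (x - y).
Proof. by move=> Hx Hy; rewrite addrC -scaleN1r; exact: HL. Qed.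

Lemma Hsum I (s : seq I) (c : I -> R) (w : I -> V) : (forall i, H (w i)) ->
  H (\sum_(i <- s) c i *: w i).
Proof.
by move=> Hw; elim: s => [|i s IH]; rewrite ?big_nil// big_cons; exact: HL.
Qed.

Section form.
Variable q : V -> V -> R.
Hypothesis pq : psd_form q.

Lemma psd_sym x y : H x -> H y -> q x y = q y x. Proof. by case: pq => + _ _; exact. Qed.

Lemma form_ge0 x : H x -> 0 <= q x x. Proof. by case: pq => _ _; exact. Qed.

Lemma formL t x y z : H x -> H y -> H z -> q (t *: x + y) z = t * q x z + q y z.
Proof. by case: pq => _ + _; exact. Qed.

Lemma form0 z : H z -> q 0 z = 0.
Proof.
move=> Hz; have := formL 1 H0 H0 Hz; rewrite scale1r addr0 mul1r => h.
by apply: (addrI (q 0 z)); rewrite addr0.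
Qed.

Lemma formZ t x z : H x -> H z -> q (t *: x) z = t * q x z.
Proof. by move=> Hx Hz; rewrite -[t *: x]addr0 formL// form0// addr0. Qed.

Lemma formD x y z : H x -> H y -> H z -> q (x + y) z = q x z + q y z.
Proof. by move=> *; rewrite -[x in LHS]scale1r formL// mul1r. Qed.

Lemma formB x y z : H x -> H y -> H z -> q (x - y) z = q x z - q y z.
Proof. by move=> *; rewrite addrC -scaleN1r formL// mulN1r addrC. Qed.

Lemma form_sum I (s : seq I) (c : I -> R) (w : I -> V) z : (forall i, H (w i)) -> H z ->
  q (\sum_(i <- s) c i *: w i) z = \sum_(i <- s) c i * q (w i) z.
Proof.
move=> Hw Hz; elim: s => [|i s IH]; first by rewrite !big_nil form0.
by rewrite !big_cons formL// ?IH//; exact: Hsum.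
Qed.

Lemma form_expand (t : R) x y : H x -> H y ->
  q (t *: x + y) (t *: x + y) = t ^+ 2 * q x x + 2 * t * q x y + q y y.
Proof.
move=> Hx Hy; have Hz := HL t Hx Hy.
rewrite formL// ![q _ (_ + _)]psd_sym// !formL// (psd_sym Hy Hx); ring.
Qed.

Lemma form_expandB x y : H x -> H y -> q (x - y) (x - y) = q x x - 2 * q x y + q y y.
Proof.
move=> Hx Hy; rewrite -[y]opprK opprK addrC -scaleN1r form_expand// (psd_sym Hy Hx); ring.
Qed.

Lemma form_parallelogram x y : H x -> H y ->
  q (x - y) (x - y) + q (x + y) (x + y) = 2 * q x x + 2 * q y y.
Proof.
move=> Hx Hy; rewrite form_expandB// -[x in q (x + y) _]scale1r -[x in q _ (x + y)]scale1r.
rewrite form_expand//; ring.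
Qed.

Lemma form_cs x y : H x -> H y -> q x y ^+ 2 <= q x x * q y y.
Proof.
move=> Hx Hy; apply: quad_ge0; first exact: form_ge0.
move=> t; have := form_ge0 (HL t Hx Hy); rewrite form_expand//; congr (0 <= _); ring.
Qed.

Lemma form_cvg (z_ : nat -> V) z (Q : R) : (forall m, H (z_ m)) -> H z ->
  (forall m, q (z_ m) (z_ m) <= Q) ->
  (forall e : R, 0 < e -> exists N, forall m, (N <= m)%N -> q (z_ m - z) (z_ m - z) <= e) ->
  forall e : R, 0 < e -> exists N, forall m, (N <= m)%N -> `|q (z_ m) (z_ m) - q z z| <= e.
Proof.
move=> Hz_ Hz zQ cz e e0.
have Q0 : 0 <= Q by exact: le_trans (form_ge0 (Hz_ 0%N)) (zQ 0%N).
(* Weights for Young's inequality: [s] makes [s * q x x] at most e/2, and then [d] makes (1 + 1/s)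
   [q y y] at most e/2. *)
pose s := e / (2 * (Q + 1)).
have s0 : 0 < s by rewrite divr_gt0// mulr_gt0// ltr_wpDl.
pose d := e / 2 / (1 + s^-1).
have t0 : 0 < 1 + s^-1 by rewrite addr_gt0// invr_gt0.
have d0 : 0 < d by rewrite !divr_gt0.
have [N HN] := cz d d0; exists N => m Nm.
have := HN m Nm; have Hd := HB (Hz_ m) Hz.
set x := z_ m; set y := x - z => yd.
have Hx : H x by exact: Hz_.
have -> : z = x - y by rewrite opprB addrC subrK.
rewrite form_expandB//.
have cs := form_cs Hx Hd; rewrite -/y in cs.
have qx0 := form_ge0 Hx; have qy0 := form_ge0 Hd; rewrite -/y in qy0.
have young : `|2 * q x y| <= s * q x x + q y y / s.
  have Y0 : 0 <= s * q x x + q y y / s.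
    by apply: addr_ge0; [exact: mulr_ge0 (ltW s0) _|exact: divr_ge0 _ (ltW s0)].
  rewrite -(@ler_pXn2r _ 2) ?nnegrE//.
  rewrite real_normK ?num_real// exprMn.
  apply: (@le_trans _ _ (4 * (q x x * q y y))); first by rewrite -natrX ler_wpM2l.
  have := sqr_ge0 (s * q x x - q y y / s).
  have -> : (s * q x x - q y y / s) ^+ 2 = (s * q x x + q y y / s) ^+ 2 - 4 * (q x x * q y y).
    by field; rewrite gt_eqF.
  by rewrite subr_ge0.
have h1 : s * q x x <= e / 2.
  apply: (@le_trans _ _ (s * (Q + 1))).
    by rewrite ler_wpM2l ?(ltW s0)// (le_trans (zQ m))// lerDl.
  by rewrite le_eqVlt; apply/orP; left; apply/eqP; rewrite /s; field; rewrite gt_eqF// ltr_wpDl.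
have h2 : q y y * (1 + s^-1) <= e / 2 by rewrite -ler_pdivlMr.
rewrite mulrDr mulr1 in h2.
rewrite (_ : q x x - _ = 2 * q x y - q y y); last by ring.
rewrite (le_trans (ler_normB _ _))// (ger0_norm qy0); lra.
Qed.

End form.

Section minimize.
Variables a b : V -> V -> R.
Hypotheses (pa : psd_form a) (pb : psd_form b).
(* Replaces the compact embedding of [a] into [b]: [b] is small where finitely many
   bounded linear forms vanish. *)
Hypothesis tot : forall d : R, 0 < d -> exists (m : nat) (l : 'I_m -> V -> R) (C B : R),
  [/\ 0 <= C, forall i x y, H x -> H y -> l i (x - y) = l i x - l i y,
   forall i x, H x -> l i x ^+ 2 <= B * b x x &
   forall x, H x -> b x x <= d * a x x + C * \sum_i l i x ^+ 2].
Hypothesis compl : forall z_ : nat -> V, (forall m, H (z_ m)) ->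
  (forall e : R, 0 < e -> exists N, forall i j, (N <= i)%N -> (N <= j)%N ->
    a (z_ i - z_ j) (z_ i - z_ j) + b (z_ i - z_ j) (z_ i - z_ j) <= e) ->
  exists2 z, H z & forall e : R, 0 < e -> exists N, forall i, (N <= i)%N ->
    a (z_ i - z) (z_ i - z) + b (z_ i - z) (z_ i - z) <= e.

(* An ultrafilter containing a sublevel set is [b]-Cauchy, which spares the
   extraction of convergent subsequences. *)
Lemma ultra_cauchy (G : set_system V) (S : set V) (Q : R) : UltraFilter G -> G S -> S `<=` H ->
  (forall x, S x -> a x x <= Q /\ b x x <= Q) ->
  forall e : R, 0 < e -> exists2 D, G D & forall x y, D x -> D y -> b (x - y) (x - y) <= e.
Proof.
move=> UG GS SH SQ e e0.
have [x1 Sx1] := filter_ex GS.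
have Q0 : 0 <= Q by have [+ _] := SQ _ Sx1; apply: le_trans; exact: (form_ge0 pa (SH _ Sx1)).
(* By the parallelogram identity [a (x - y) (x - y)] is at most 4 Q, so its contribution after
   multiplication by [d] is at most e/2. Below, [r] is chosen likewise for the linear forms, whose
   squared differences are at most 4 r. *)
pose d := e / 2 / (4 * Q + 1).
have q0 : 0 < 4 * Q + 1 by rewrite ltr_wpDl// mulr_ge0.
have d0 : 0 < d by rewrite !divr_gt0.
have [m [l [C [B [C0 lB lb bl]]]]] := tot d0.
pose r := e / 2 / (4 * C * m%:R + 1).
have r'0 : 0 < 4 * C * m%:R + 1 by rewrite ltr_wpDl// !mulr_ge0.
have r0 : 0 < r by rewrite !divr_gt0.
pose s := Num.sqrt r; have s0 : 0 < s by rewrite sqrtr_gt0.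
(* The image of the ultrafilter under [l i] lives in a compact segment and clusters at some [c].
   Being an ultrafilter, it then contains the preimage of every neighbourhood of [c]. *)
have lcl i : exists c, G [set x | `|l i x - c| <= s].
  have lG : G (l i @^-1` `[- (`|B| * Q + 1), `|B| * Q + 1]%classic).
    apply: filterS GS => x Sx /=; rewrite in_itv/= -ler_norml.
    rewrite -(@ler_pXn2r _ 2) ?nnegrE ?addr_ge0 ?mulr_ge0// real_normK ?num_real//.
    rewrite (le_trans (lb i x (SH _ Sx)))//.
    apply: (@le_trans _ _ (`|B| * Q)).
      apply: (@le_trans _ _ (`|B| * b x x)).
        by rewrite ler_wpM2r ?ler_norm//; exact: (form_ge0 pb (SH _ Sx)).
      by rewrite ler_wpM2l//; case: (SQ _ Sx).
    have : 0 <= `|B| * Q by rewrite mulr_ge0.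
    by move: (`|B| * Q) => t t0; nra.
  have [c [_ clc]] := @segment_compact _ _ _ (l i @ G) _ lG.
  exists c; have [//|GC] := in_ultra_setVsetC [set x | `|l i x - c| <= s] UG.
  have nb : nbhs c [set y | `|y - c| <= s].
    by apply/nbhs_ballP; exists s => // y; rewrite /ball/= distrC; exact: ltW.
  have lGC : (l i @ G) [set y | ~ `|y - c| <= s] by exact: GC.
  by have [y []] := clc _ _ lGC nb.
have [c Gc] := choice lcl.
exists (S `&` [set x | forall i, `|l i x - c i| <= s]).
  apply: filterI => //.
  have := @filter_forall _ _ (fun i x => `|l i x - c i| <= s) G _ Gc.
  by apply.
move=> x y [Sx xl] [Sy yl]; have Hx := SH _ Sx; have Hy := SH _ Sy.
apply: (le_trans (bl _ (HB Hx Hy))).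
have h1 : a (x - y) (x - y) <= 4 * Q.
  have := form_parallelogram pa Hx Hy; have := form_ge0 pa (HD Hx Hy).
  have [+ _] := SQ _ Sx; have [+ _] := SQ _ Sy; lra.
have h2 : \sum_i l i (x - y) ^+ 2 <= m%:R * (4 * r).
  rewrite mulrC mulr_natr -[in leRHS](card_ord m) -sumr_const; apply: ler_sum => i _.
  rewrite lB// (_ : l i x - l i y = (l i x - c i) - (l i y - c i)); last by ring.
  have : `|(l i x - c i) - (l i y - c i)| <= 2 * s.
    by rewrite (le_trans (ler_normB _ _))// mulr2n mulrDl mul1r lerD.
  move=> h; rewrite -[leLHS]real_normK ?num_real//.
  rewrite (_ : 4 * r = (2 * s) ^+ 2); last by rewrite exprMn sqr_sqrtr ?(ltW r0)// -natrX.
  by rewrite lerXn2r// nnegrE mulr_ge0// ltW.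
have h3 : d * a (x - y) (x - y) <= e / 2.
  rewrite /d mulrAC ler_pdivrMr// ler_wpM2l ?divr_ge0 ?(ltW e0)//.
  by rewrite (le_trans h1)// lerDl.
have h4 : C * \sum_i l i (x - y) ^+ 2 <= e / 2.
  apply: (@le_trans _ _ (4 * C * m%:R * r)).
    by apply: (le_trans (ler_wpM2l C0 h2)); rewrite le_eqVlt; apply/orP; left; apply/eqP; ring.
  rewrite /r mulrA ler_pdivrMr// mulrC ler_wpM2l ?divr_ge0 ?(ltW e0)//.
  by rewrite lerDl.
by rewrite [leRHS]splitr lerD.
Qed.

(** The Rayleigh quotient attains its infimum on [K]. Near-minimizers taken along an ultrafilter
    form a [b]-Cauchy sequence; the parallelogram identity upgrades this to Cauchy for [a + b], so
    completeness applies. Only closedness for [b] is asked of [K]. *)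
Lemma exists_minimizer (K : set V) (T : R) : K `<=` H ->
  (forall (t : R) x y, K x -> K y -> K (t *: x + y)) ->
  (forall z_ z, (forall m, K (z_ m)) -> H z ->
    (forall e : R, 0 < e -> exists N, forall i, (N <= i)%N -> b (z_ i - z) (z_ i - z) <= e) -> K z) ->
  (exists2 w, K w & 0 < b w w /\ a w w <= T * b w w) ->
  exists (lam : R) z, [/\ lam <= T, K z, b z z = 1, a z z = lam &
    forall x, K x -> lam * b x x <= a x x].
Proof.
move=> KH KL Kc [w Kw [bw aw]].
have KZ (t : R) x : K x -> K (t *: x).
  move=> Kx; have := KL (t - 1) x x Kx Kx.
  by rewrite scalerBl scale1r subrK.
pose A := [set t | exists2 x, K x & b x x = 1 /\ a x x = t].
have normed x : K x -> 0 < b x x -> exists2 y, K y & b y y = 1 /\ a y y = a x x / b x x.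
  move=> Kx bx; pose t := (Num.sqrt (b x x))^-1; have Hx := KH _ Kx.
  have t2 : t ^+ 2 = (b x x)^-1 by rewrite exprVn sqr_sqrtr// ltW.
  exists (t *: x); first exact: KZ.
  have q2 q : psd_form q -> q (t *: x) (t *: x) = t ^+ 2 * q x x.
    by move=> pq; rewrite (formZ pq _ Hx (HZ t Hx)) (psd_sym pq Hx (HZ t Hx)) (formZ pq _ Hx Hx) mulrA.
  by rewrite !q2// t2 mulVf ?gt_eqF// mulrC.
have A0 : A !=set0 by have [y Ky [by1 ay]] := normed _ Kw bw; exists (a w w / b w w); exists y.
have lA : lbound A 0 by move=> t [x Kx [_ <-]]; exact: (form_ge0 pa (KH _ Kx)).
have hA : has_inf A by split => //; exists 0.
pose lam := inf A; have lam0 : 0 <= lam by exact: lb_le_inf.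
have lamK x : K x -> lam * b x x <= a x x.
  move=> Kx; have := form_ge0 pb (KH _ Kx); rewrite le_eqVlt => /orP[/eqP <-|bx].
    by rewrite mulr0; exact: (form_ge0 pa (KH _ Kx)).
  have [y Ky [by1 ay]] := normed _ Kx bx.
  rewrite -ler_pdivlMr// -ay; apply: ge_inf; first by exists 0.
  by exists y.
have lamT : lam <= T by rewrite -(ler_pM2r bw) (le_trans (lamK _ Kw)).
pose S (t : R) := [set x | K x /\ b x x = 1 /\ a x x <= lam + t].
have S0 t : 0 < t -> S t !=set0.
  move=> t0; have [_ [x Kx [bx <-]] ax] := inf_adherent t0 hA.
  by exists x; split => //; split => //; exact: ltW.
pose F0 : set_system V := [set X | exists2 t, 0 < t & S t `<=` X].
have FF : ProperFilter F0.
  split; first by move=> [t t0 St]; have [x Sx] := S0 t t0; exact: St Sx.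
  split.
  - by exists 1.
  - move=> X Y [t t0 Xt] [t' t'0 Yt]; exists (Num.min t t'); first by rewrite lt_min t0.
    move=> x [Kx [bx ax]]; split; [apply: Xt|apply: Yt]; split => //; split => //.
      by rewrite (le_trans ax)// lerD2l ge_min lexx.
    by rewrite (le_trans ax)// lerD2l ge_min lexx orbT.
  - by move=> X Y XY [t t0 Xt]; exists t => //; exact: subset_trans XY.
have [G [UG FG]] := ultraFilterLemma FF.
have GS t : 0 < t -> G (S t) by move=> t0; apply: FG; exists t.
have cau := @ultra_cauchy G (S 1) (Num.max (lam + 1) 1) UG (GS _ ltr01) _ _.
have {}cau : forall e : R, 0 < e -> exists2 D, G D & forall x y, D x -> D y -> b (x - y) (x - y) <= e.
  apply: cau; first by move=> x [/KH].
  by move=> x [Kx [-> ax]]; rewrite !le_max ax lexx orbT.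
pose s (m : nat) : R := m.+1%:R^-1.
have s0 m : 0 < s m by rewrite invr_gt0.
have /choice[D0 D0P] : forall m, exists D, G D /\ forall x y, D x -> D y -> b (x - y) (x - y) <= s m.
  by move=> m; have [D GD DP] := cau _ (s0 m); exists D.
pose D m := D0 m `&` S (s m).
have GD m : G (D m) by apply: filterI; [case: (D0P m)|exact: GS].
have GDm m : G [set x | forall i : 'I_m.+1, D i x].
  have := @filter_forall _ _ (fun (i : 'I_m.+1) x => D i x) G _ (fun i => GD i).
  by apply.
(* [z_ m] is taken in all the [D i] with i <= m at once, so that any two late terms lie in a common
   small set. *)
have /choice[z_ zP] : forall m, exists x, forall i, (i <= m)%N -> D i x.
  move=> m; have [x xP] := filter_ex (GDm m); exists x => i im.
  exact: (xP (Ordinal (im : (i < m.+1)%N))).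
have zK m : K (z_ m) by have [_ []] := zP m m (leqnn m).
have zb m : b (z_ m) (z_ m) = 1 by have [_ [_ []]] := zP m m (leqnn m).
have za i m : (i <= m)%N -> a (z_ m) (z_ m) <= lam + s i by move=> im; have [_ [_ []]] := zP m i im.
have small (e : R) : 0 < e -> exists N, s N <= e.
  move=> e0; have [N _ /(_ N (leqnn N)) Ne] := near_infty_natSinv_lt (PosNum e0).
  by exists N; exact: ltW.
have zc i j N : (N <= i)%N -> (N <= j)%N -> b (z_ i - z_ j) (z_ i - z_ j) <= s N.
  move=> Ni Nj; have [_ H1] := D0P N; apply: H1; first by case: (zP i N Ni).
  by case: (zP j N Nj).
have Hz m : H (z_ m) by exact: KH.
(* The sum [z_ i + z_ j] is in [K], so its energy is at least [lam] times its [b]-norm squared. Two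
   parallelogram identities then bound the energy of the difference by 4 s N + lam b(z_i - z_j). *)
have zac i j N : (N <= i)%N -> (N <= j)%N -> a (z_ i - z_ j) (z_ i - z_ j) <= (4 + lam) * s N.
  move=> Ni Nj; have pp := form_parallelogram pa (Hz i) (Hz j).
  have pb' := form_parallelogram pb (Hz i) (Hz j); rewrite !zb in pb'.
  have Kd : K (z_ i + z_ j) by rewrite -[z_ i]scale1r; exact: KL.
  have := lamK _ Kd; have := zc i j N Ni Nj; have := za N i Ni; have := za N j Nj.
  move: pb' pp; set u := b (_ - _) _; set v := b (_ + _) _.
  move=> h1 h2 h3 h4 h5 h6; have h7 : lam * u <= lam * s N by rewrite ler_wpM2l.
  have h8 : lam * v = 4 * lam - lam * u by rewrite -[v](addKr u) h1; ring.
  lra.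
have [e e0|z Hzz zz] := compl Hz.
  pose e' := e / (5 + lam); have L0 : 0 < 5 + lam by rewrite ltr_pwDl.
  have [N Ne] := small e' (divr_gt0 e0 L0).
  exists N => i j Ni Nj; have h1 := zc i j N Ni Nj; have h2 := zac i j N Ni Nj.
  have : (5 + lam) * s N <= e by rewrite -ler_pdivlMl// mulrC.
  lra.
have zzb e : 0 < e -> exists N, forall i, (N <= i)%N -> b (z_ i - z) (z_ i - z) <= e.
  move=> e0; have [N HN] := zz e e0; exists N => i Ni; apply: le_trans (HN i Ni).
  by rewrite lerDr; exact: (form_ge0 pa (HB (Hz i) Hzz)).
have zza e : 0 < e -> exists N, forall i, (N <= i)%N -> a (z_ i - z) (z_ i - z) <= e.
  move=> e0; have [N HN] := zz e e0; exists N => i Ni; apply: le_trans (HN i Ni).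
  by rewrite lerDl; exact: (form_ge0 pb (HB (Hz i) Hzz)).
have Kz : K z by exact: Kc zzb.
have bz : b z z = 1.
  apply/eqP; rewrite -subr_eq0 -normr_le0; apply/ler_addgt0Pr => e e0; rewrite add0r.
  have [//|N HN] := form_cvg pb Hz Hzz (Q := 1) _ zzb e0; first by move=> m; rewrite zb.
  by have := HN N (leqnn N); rewrite zb distrC.
have az : a z z = lam.
  apply/eqP; rewrite eq_le; apply/andP; split; last by have := lamK _ Kz; rewrite bz mulr1.
  apply/ler_addgt0Pr => e e0; have e20 : 0 < e / 2 by rewrite divr_gt0.
  have [m|N HN] := form_cvg pa Hz Hzz (Q := lam + s 0%N) _ zza e20; first exact: za.
  have [N' HN'] := small _ e20.
  have := HN (maxn N N') (leq_maxl _ _); have := za N' (maxn N N') (leq_maxr _ _).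
  by rewrite ler_norml => ? /andP[]; lra.
by exists lam, z.
Qed.

(** Eigenvectors are found one at a time, each minimizing the Rayleigh quotient on the
    [b]-orthogonal complement of the previous ones. That complement imposes j < k + 1 linear
    conditions, so it meets the span of the [w i], and the minimum is at most [T]. Only the indices
    up to [k] of [lam] and [e] are meaningful. *)
Lemma spectral_theorem (k : nat) (w : 'I_k.+1 -> V) (T : R) : (forall i, H (w i)) ->
  (forall c : 'I_k.+1 -> R, a (\sum_i c i *: w i) (\sum_i c i *: w i) <=
     T * b (\sum_i c i *: w i) (\sum_i c i *: w i)) ->
  (forall c : 'I_k.+1 -> R, b (\sum_i c i *: w i) (\sum_i c i *: w i) = 0 -> forall i, c i = 0) ->
  exists (lam : nat -> R) (e : nat -> V),
    (forall i, (i <= k)%N -> [/\ H (e i), lam i <= T & forall v, H v -> a (e i) v = lam i * b (e i) v]) /\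
    (forall i j, (i <= k)%N -> (j <= k)%N -> b (e i) (e j) = (i == j)%:R).
Proof.
move=> Hw aT b0.
suff main : forall j, (j <= k.+1)%N -> exists (lam : nat -> R) (e : nat -> V),
    (forall i, (i < j)%N -> [/\ H (e i), lam i <= T & forall v, H v -> a (e i) v = lam i * b (e i) v]) /\
    (forall i i', (i < j)%N -> (i' < j)%N -> b (e i) (e i') = (i == i')%:R).
  exact: (main k.+1 (leqnn _)).
elim=> [_|j IH jk]; first by exists (fun=> 0), (fun=> 0).
have [lam [e [eP eO]]] := IH (ltnW jk).
have He i : (i < j)%N -> H (e i) by move=> /eP[].
pose K := [set z | H z /\ forall i, (i < j)%N -> b z (e i) = 0].
have [c c0 cM] := @exists_left_kernel R j k.+1 (\matrix_(i, l) b (w i) (e l)) jk.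
have [|||l [z [lT Kz bz az lK]]] := @exists_minimizer K T (fun x => @proj1 _ _).
- move=> t x y [Hx Kx] [Hy Ky]; split; first exact: HL.
  by move=> i ij; rewrite (formL pb)// ?Kx// ?Ky// ?mulr0 ?addr0//; exact: He.
- move=> z_ z Kz_ Hz zz; split => // i ij.
  apply/eqP; rewrite -sqrf_eq0 -normr_le0 normrX real_normK ?num_real//.
  apply/ler_addgt0Pr => d d0; rewrite add0r; have [N HN] := zz d d0.
  have Hzi m : H (z_ m) by case: (Kz_ m).
  apply: le_trans (HN N (leqnn N)).
  have := form_cs pb (HB (Hzi N) Hz) (He _ ij).
  rewrite (formB pb)//; last exact: He.
  by rewrite (Kz_ N).2// sub0r sqrrN eO// eqxx mulr1.
- pose W := \sum_i c ord0 i *: w i.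
  have HW : H W by exact: Hsum.
  exists W.
    split => // i ij; rewrite (form_sum pb)//; last exact: He.
    by have := congr1 (fun M : 'rV[R]_j => M ord0 (Ordinal ij)) cM; rewrite !mxE; under eq_bigr do rewrite !mxE.
  split; last exact: aT.
  rewrite lt_neqAle eq_sym; apply/andP; split; last exact: form_ge0.
  apply/negP => /eqP /b0 ci; move/eqP: c0; apply.
  by apply/rowP => i; rewrite mxE ci.
have [Hz Kzi] := Kz.
have eig v : H v -> a z v = l * b z v.
  move=> Hv; pose p := \sum_(i < j) b v (e i) *: e i.
  have Hp : H p by apply: Hsum => i; exact: He.
  pose v' := v - p.
  have Hv' : H v' by exact: HB.
  have Kv' : K v'.
    split => // i ij; rewrite (formB pb)//; last exact: He.
    rewrite (form_sum pb); [|by move=> t; exact: He|exact: He].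
    rewrite (bigD1 (Ordinal ij))//= eO// eqxx mulr1 big1 ?addr0 ?subrr// => t ti.
    by rewrite eO// (_ : (t == i :> nat) = false) ?mulr0//; apply: negbTE; exact: ti.
  have bzp : b z p = 0.
    rewrite (psd_sym pb)// (form_sum pb)//; last by move=> t; exact: He.
    by rewrite big1// => t _; rewrite (psd_sym pb (He _ (ltn_ord t)) Hz) Kzi ?mulr0.
  have azp : a z p = 0.
    rewrite (psd_sym pa)// (form_sum pa)//; last by move=> t; exact: He.
    rewrite big1// => t _; have [Ht _ ->] := eP _ (ltn_ord t) => //.
    by rewrite (psd_sym pb Ht Hz) Kzi ?mulr0.
  (* The form a - l b is nonnegative on [K] and vanishes at [z], so its cross term with any
     direction [v'] of [K] vanishes. Directions outside [K] differ from one of [K] by a combination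
     [p] of earlier eigenvectors, orthogonal to [z] for both forms. *)
  have key : a z v' - l * b z v' = 0.
    have Aq : 0 <= a v' v' - l * b v' v' by rewrite subr_ge0; exact: lK.
    have := @quad_ge0 R (a v' v' - l * b v' v') (a z v' - l * b z v') 0 Aq.
    rewrite mulr0 => h; apply/eqP; rewrite -sqrf_eq0 eq_le sqr_ge0 andbT; apply: h => t.
    have Kt : K (t *: v' + z).
      split; first exact: HL.
      by move=> i ij; rewrite (formL pb)// ?Kv'.2// ?Kzi// ?mulr0 ?addr0//; exact: He.
    have := lK _ Kt; rewrite !form_expand// bz az (psd_sym pa Hv' Hz) (psd_sym pb Hv' Hz).
    lra.
  have -> : v = v' + p by rewrite subrK.
  rewrite (psd_sym pa)//; last exact: HD.
  rewrite (psd_sym pb)//; last exact: HD.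
  rewrite (formD pa Hv' Hp Hz) (formD pb Hv' Hp Hz).
  rewrite (psd_sym pa Hv' Hz) (psd_sym pa Hp Hz) (psd_sym pb Hv' Hz) (psd_sym pb Hp Hz).
  rewrite bzp azp !addr0; lra.
exists (fun i => if i == j then l else lam i), (fun i => if i == j then z else e i).
split.
  move=> i; rewrite ltnS leq_eqVlt; case: eqVneq => [-> _|ij /= ij']; first by split.
  exact: eP.
have ltj i : (i < j.+1)%N -> i != j -> (i < j)%N.
  by rewrite ltnS leq_eqVlt => /predU1P[->|//]; rewrite eqxx.
move=> i i' ij1 i'j1; case: (eqVneq i j) => [ij|ij]; case: (eqVneq i' j) => [i'j|i'j].
- by rewrite ij i'j eqxx bz.
- by rewrite Kzi ?ltj// ij eq_sym (negbTE i'j).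
- by rewrite (psd_sym pb)// ?Kzi ?ltj// ?i'j ?(negbTE ij)//; apply/He/ltj.
- by rewrite eO ?ltj.
Qed.

End minimize.
End spectral.

(** * The Sobolev space as a complete space *)

(** The permitted step is exactly h k - h (k+1), so t - h is nondecreasing and t + h nonincreasing.
    The limit is squeezed between them, which gives the rate as well. *)
Lemma dyadic_cvg (R : realType) (t : nat -> R) (s : R) : 0 <= s ->
  (forall k, `|t k.+1 - t k| <= s * 2^-1 ^+ k) ->
  exists2 l, t k @[k --> \oo] --> l & forall k, `|t k - l| <= 2 * s * 2^-1 ^+ k.
Proof.
move=> s0 ts; pose h (k : nat) : R := 2 * s * 2^-1 ^+ k.
have hS k : h k.+1 = h k - s * 2^-1 ^+ k by rewrite /h exprS; field.
have h0 : h k @[k --> \oo] --> 0.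
  have := @cvg_geometric R (2 * s) 2^-1; apply.
  by rewrite ger0_norm ?invr_ge0// invf_lt1// ltr1n.
have hge k : 0 <= h k by rewrite mulr_ge0 ?mulr_ge0 ?exprn_ge0 ?invr_ge0.
have step k := ts k; have lo k : t k - h k <= t k.+1 - h k.+1.
  by have := ts k; rewrite hS ler_norml => /andP[]; lra.
have up k : t k.+1 + h k.+1 <= t k + h k.
  by have := ts k; rewrite hS ler_norml => /andP[]; lra.
have nd : nondecreasing_seq (fun k => t k - h k) by apply/nondecreasing_seqP.
have ni : nonincreasing_seq (fun k => t k + h k) by apply/nonincreasing_seqP.
have cu : cvgn (fun k => t k + h k).
  apply: nonincreasing_is_cvgn => //; exists (t 0%N - h 0%N) => _ [k _ <-].
  by have := nd _ _ (leq0n k); have := hge k; lra.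
have tl : t k @[k --> \oo] --> limn (fun k => t k + h k).
  have : t k + h k - h k @[k --> \oo] --> limn (fun k => t k + h k) - 0 := cvgB cu h0.
  rewrite subr0 (_ : (fun k => t k + h k - h k) = t); first by apply.
  by apply/funext => k; rewrite addrK.
exists (limn (fun k => t k + h k)) => // k; rewrite ler_norml -/(h k).
have l2 : limn (fun k => t k + h k) <= t k + h k.
  exact: (nonincreasing_cvgn_ge ni cu).
have cd : (fun k => t k - h k) @ \oo --> limn (fun k => t k + h k).
  by rewrite -[X in _ --> X]subr0; exact: cvgB.
have l1 : t k - h k <= limn (fun k => t k + h k).
  by rewrite -(cvg_lim _ cd)//; apply: nondecreasing_cvgn_le => //; apply/cvg_ex; eexists; exact: cd.
by apply/andP; split; lra.
Qed.

Section riesz_fischer.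
Context (R : realType) (n : nat).
Local Notation mu := (lebesgue_row R n).
Variable D : set 'rV[R]_n.
Hypothesis mD : measurable D.

(** Along a subsequence with squared increments of integral at most 8^-k, the series [S] of the 4^k
    d_k^2 has integral at most 2. Where [S] is finite, the increments are at most 2^-k sqrt(S), so
    the subsequence converges with squared error at most 4 * 4^-k S; integrating this bound gives
    the L^2 convergence. *)
Lemma sqi_complete (f : nat -> 'rV[R]_n -> R) : (forall m, square_integrable D (f m)) ->
  (forall e : R, 0 < e -> exists N, forall i j, (N <= i)%N -> (N <= j)%N ->
     \int[mu]_(x in D) ((f i x - f j x) ^+ 2) <= e) ->
  exists2 g, square_integrable D g & forall e : R, 0 < e -> exists N, forall i, (N <= i)%N ->
     \int[mu]_(x in D) ((f i x - g x) ^+ 2) <= e.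
Proof.
move=> sf cf.
have /choice[N0 N0P] : forall k : nat, exists N, forall i j, (N <= i)%N -> (N <= j)%N ->
    \int[mu]_(x in D) ((f i x - f j x) ^+ 2) <= 8^-1 ^+ k.
  by move=> k; apply: cf; rewrite exprn_gt0// invr_gt0.
(* Summing makes the indices nondecreasing, at least [N0 k] and at least [k], all at once. *)
pose N k := (\sum_(j < k.+1) (N0 j).+1)%N.
have NN k : (N0 k <= N k)%N by rewrite /N big_ord_recr/= (leq_trans (leqnSn _))// leq_addl.
have NS k : (N k <= N k.+1)%N by rewrite /N [leqRHS]big_ord_recr/= leq_addr.
have Nk k : (k <= N k)%N.
  by elim: k => // k IH; rewrite (leq_ltn_trans IH)// /N [ltnRHS]big_ord_recr/= addnS ltnS leq_addr.
pose F k := f (N k); pose d k x := F k.+1 x - F k x.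
have sF k : square_integrable D (F k) by exact: sf.
have sd k : square_integrable D (d k) by exact: sqiB.
have dk k : \int[mu]_(x in D) (d k x ^+ 2) <= 8^-1 ^+ k.
  by apply: N0P; [exact: leq_trans (NN k) (NS k)|exact: NN].
pose S x := (\sum_(k <oo) ((4 ^+ k * d k x ^+ 2)%:E : \bar R))%E.
have t0 k x : (0 <= ((4 ^+ k * d k x ^+ 2)%:E : \bar R))%E.
  by rewrite lee_fin mulr_ge0 ?sqr_ge0// exprn_ge0.
have S0 x : (0 <= S x)%E by exact: nneseries_ge0.
have md k : measurable_fun D (fun x => ((4 ^+ k * d k x ^+ 2)%:E : \bar R)).
  apply/measurable_EFinP; apply: measurable_funM => //; apply: measurable_funX.
  by case: (sd k).
have mS : measurable_fun D S.
  exact: (@ge0_emeasurable_sum _ _ _ D _ xpredT).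
have intS : (\int[mu]_(x in D) S x <= 2%:E)%E.
  rewrite integral_nneseries//.
  apply: (@le_trans _ _ (\sum_(k <oo) (2^-1 ^+ k : R)%:E)%E).
    apply: lee_nneseries => [k _ _|k _]; first exact: integral_ge0.
    have -> : (\int[mu]_(x in D) (4 ^+ k * d k x ^+ 2)%:E =
        (4 ^+ k * \int[mu]_(x in D) (d k x ^+ 2))%:E)%E.
      rewrite -RintegralZl//; last exact: sqi_integrable.
      rewrite /Rintegral fineK//; apply: (integrable_fin_num mD).
      by apply: RintegrableZl => //; exact: sqi_integrable.
    have p4 : 0 <= 4 ^+ k :> R by exact: exprn_ge0.
    rewrite lee_fin; apply: (le_trans (ler_wpM2l p4 (dk k))).
    rewrite -exprMn le_eqVlt; apply/orP; left; apply/eqP; congr (_ ^+ _); by field.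
  apply: lime_le; first by apply: is_cvg_nneseries => k _ _; rewrite lee_fin exprn_ge0// invr_ge0.
  apply: nearW => k; rewrite sumEFin lee_fin.
  suff -> : \sum_(0 <= i < k) 2^-1 ^+ i = 2 - 2 * 2^-1 ^+ k :> R.
    by rewrite gerBl mulr_ge0// exprn_ge0// invr_ge0.
  elim: k => [|k IH]; first by rewrite big_nil expr0 mulr1 subrr.
  by rewrite big_nat_recr//= IH exprS; field.
have term k x : (((4 ^+ k * d k x ^+ 2)%:E : \bar R) <= S x)%E.
  apply: le_trans (@nneseries_lim_ge _ _ xpredT 0%N k.+1 _); last by move=> *; exact: t0.
  by rewrite big_nat_recr//= leeDr// sume_ge0// => i _; exact: t0.
pose A := [set x | (S x < +oo)%E].
have lim_ex x : exists l : R, A x -> F k x @[k --> \oo] --> l /\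
    forall k, (((F k x - l) ^+ 2)%:E <= (4 * 4^-1 ^+ k)%:E * S x)%E.
  have [Ax|] := pselect (A x); last by exists 0.
  have Sf : S x \is a fin_num by rewrite ge0_fin_numE.
  pose s := Num.sqrt (fine (S x)).
  have s2 : s ^+ 2 = fine (S x) by rewrite sqr_sqrtr// fine_ge0.
  have [k|l Fl Fk] := @dyadic_cvg R (F ^~ x) s (sqrtr_ge0 _).
    have := term k x; rewrite -[S x]fineK// lee_fin -s2 => h.
    have s0 : 0 <= s * 2^-1 ^+ k by rewrite mulr_ge0 ?sqrtr_ge0// exprn_ge0// invr_ge0.
    rewrite -(@ler_pXn2r _ 2) ?nnegrE// real_normK ?num_real//.
    rewrite exprMn -exprM mulnC exprM (_ : 2^-1 ^+ 2 = 4^-1 :> R); last by field.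
    by rewrite exprVn ler_pdivlMr ?exprn_gt0// mulrC.
  exists l => _; split => // k; rewrite -[S x]fineK// -EFinM lee_fin -s2.
  have s0 : 0 <= 2 * s * 2^-1 ^+ k by rewrite mulr_ge0 ?mulr_ge0 ?sqrtr_ge0// exprn_ge0// invr_ge0.
  rewrite -[leLHS]real_normK ?num_real//.
  rewrite (_ : 4 * 4^-1 ^+ k * s ^+ 2 = (2 * s * 2^-1 ^+ k) ^+ 2).
    by rewrite lerXn2r ?nnegrE.
  rewrite !exprMn -exprM mulnC exprM (_ : 2^-1 ^+ 2 = 4^-1 :> R); last by field.
  by ring.
have [g0 g0P] := choice lim_ex.
(* Where [S] is infinite the value 0 is harmless: the right-hand side of the error bound is then
   [+oo]. *)
pose g x := if pselect (A x) then g0 x else 0.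
have Fg k x : D x -> (((F k x - g x) ^+ 2)%:E <= (4 * 4^-1 ^+ k)%:E * S x)%E.
  move=> Dx; rewrite /g; case: pselect => [Ax|nA].
    by have [_] := g0P x Ax; exact.
  have -> : S x = +oo%E by apply/eqP; rewrite -leye_eq leNgt; exact/negP.
  by rewrite gt0_muley ?leey// lte_fin mulr_gt0// exprn_gt0// invr_gt0.
have mA : measurable (D `&` A).
  have := mS mD [set~ +oo%E] (measurableC (emeasurable_set1 _)).
  congr measurable; apply/seteqP; split => x [Dx] /= Sx; split => //; rewrite /A/=.
    by rewrite ltey; exact/eqP.
  by move=> Soo; move: Sx; rewrite /A/= Soo.
have mg : measurable_fun D g.
  apply: (@measurable_fun_cvg _ _ _ D (fun k x => F k x * \1_(D `&` A) x)).
    move=> k; apply: measurable_funM; first by case: (sF k).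
    by apply: measurable_funTS; exact: measurable_indic.
  move=> x Dx; rewrite /g; case: pselect => [Ax|nA].
    have [gl _] := g0P x Ax; rewrite (_ : (fun k => _) = F ^~ x)//.
    by apply/funext => k; rewrite indicE mem_set ?mulr1.
  rewrite (_ : (fun k => _) = fun=> 0); first exact: cvg_cst.
  by apply/funext => k; rewrite indicE memNset ?mulr0// => -[].
have Fgi k : (\int[mu]_(x in D) ((F k x - g x) ^+ 2)%:E <= (8 * 4^-1 ^+ k)%:E)%E.
  apply: (@le_trans _ _ (\int[mu]_(x in D) ((4 * 4^-1 ^+ k)%:E * S x))%E).
    apply: ge0_le_integral => //.
    - by move=> x _; rewrite lee_fin sqr_ge0.
    - apply/measurable_EFinP/measurable_funX; apply: measurable_funB => //.
      by case: (sF k).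
    - exact: measurable_funeM.
    - by move=> x Dx; exact: Fg.
  have c0 : 0 <= 4 * 4^-1 ^+ k :> R by rewrite mulr_ge0// exprn_ge0// invr_ge0.
  rewrite ge0_integralZl//.
  rewrite (_ : 8 * 4^-1 ^+ k = (4 * 4^-1 ^+ k) * 2); last by ring.
  by rewrite [leRHS]EFinM; apply: lee_pmul => //; exact: integral_ge0.
have sFg k : square_integrable D (fun x => F k x - g x).
  split; last exact: le_lt_trans (Fgi k) (ltry _).
  by apply: measurable_funB => //; case: (sF k).
have sg : square_integrable D g.
  have := sqiB mD (sF 0%N) (sFg 0%N); congr square_integrable; apply/funext => x.
  by rewrite opprB addrCA subrr addr0.
exists g => // e e0.
have e4 : 0 < e / 4 by rewrite divr_gt0.
have [M MP] := cf _ e4.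
have [k [Mk ke]] : exists k, (M <= N k)%N /\ 8 * 4^-1 ^+ k <= e / 4 :> R.
  have : geometric (8 : R) 4^-1 k @[k --> \oo] --> 0.
    by apply: cvg_geometric; rewrite ger0_norm ?invr_ge0// invf_lt1// ltr1n.
  move=> /cvgrPdist_le /(_ _ e4)[k0 _ k0P].
  exists (maxn k0 M); split; first exact: leq_trans (leq_maxr _ _) (Nk _).
  have := k0P (maxn k0 M) (leq_maxl _ _); rewrite sub0r normrN.
  by apply: le_trans; exact: ler_norm.
exists M => i Mi.
have h1 := MP i (N k) Mi Mk.
have h2 : \int[mu]_(x in D) ((F k x - g x) ^+ 2) <= e / 4.
  rewrite -lee_fin; apply: le_trans (le_trans (Fgi k) _); last by rewrite lee_fin.
  by rewrite /Rintegral fineK//; exact: (integrable_fin_num mD (sqi_integrable (sFg k))).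
have h3 := le_mean_sqr mD (sqiB mD (sf i) sg) (sqiB mD (sf i) (sF k)).
apply: (le_trans h3).
rewrite [X in _ + 2 * X](_ : _ = \int[mu]_(x in D) ((F k x - g x) ^+ 2)); last first.
  by apply: eq_Rintegral => x _; congr (_ ^+ _); ring.
by move: h1 h2; rewrite -/(F k); lra.
Qed.

End riesz_fischer.

Section sobolev.
Context (R : realType) (n : nat).
Local Notation mu := (lebesgue_row R n).
Local Notation K0 := (8 * expR 2^-1 : R).

Lemma continuous_bounded_cube (f : 'rV[R]_n -> R) (L : R) : 0 <= L -> continuous f ->
  exists B : R, forall x, cube L x -> `|f x| <= B.
Proof.
move=> L0 cf.
have cc : compact (@cube R n L).
  have := @compact_cube_shift R n L 0; congr compact.
  by apply/seteqP; split => x /=; rewrite subr0.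
have c0 : cube L (0 : 'rV[R]_n) by move=> i; rewrite mxE normr0.
have [c _ cP] := @EVT_max_rV R n f _ (ex_intro _ _ c0) cc (continuous_subspaceT cf).
have cNf : continuous (fun x => - f x) by move=> x; apply: continuousN; exact: cf.
have [d _ dP] := @EVT_max_rV R n _ _ (ex_intro _ _ c0) cc (continuous_subspaceT cNf).
exists (`|f c| + `|f d|) => x /mem_set xL.
have h1 := cP _ xL; have h2 := dP _ xL; rewrite ler_norml.
have := ler_norm (f c); have := ler_norm (- f d); have := normr_ge0 (f c); have := normr_ge0 (f d).
by rewrite normrN => *; apply/andP; split; lra.
Qed.

Lemma finite_net (L rho : R) : 0 < rho -> exists (m : nat) (p : 'I_m -> 'rV[R]_n),
  forall x, cube L x -> exists i, dot (x - p i) (x - p i) <= rho ^+ 2.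
Proof.
(* A grid of step [s]: the n coordinates give a squared error of at most n s^2, below rho^2. *)
move=> rho0; pose s := rho / n.+1%:R.
have s0 : 0 < s by rewrite divr_gt0.
pose N := (Num.truncn (2 * L / s)).+1.
pose T := {ffun 'I_n -> 'I_N}.
exists #|T|, (fun i => \row_j (- L + ((enum_val i : T) j)%:R * s)) => x xL.
have t0 j : 0 <= (x ord0 j + L) / s.
  by rewrite divr_ge0 ?(ltW s0)//; have := xL j; rewrite ler_norml => /andP[]; lra.
have tN j : (Num.truncn ((x ord0 j + L) / s) < N)%N.
  rewrite ltnS truncn_ge_nat; last first.
    rewrite divr_ge0 ?(ltW s0)//; have := xL j; have := normr_ge0 (x ord0 j); lra.
  have /andP[h _] := truncn_itv (t0 j); apply: le_trans h _.
  rewrite ler_pM2r ?invr_gt0//; have := xL j; rewrite ler_norml => /andP[]; lra.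
exists (enum_rank ([ffun j => Ordinal (tN j)] : T)).
apply: (@le_trans _ _ (\sum_(j < n) s ^+ 2)).
  apply: ler_sum => j _; rewrite -expr2 !mxE enum_rankK ffunE/=.
  have /andP[h1 h2] := truncn_itv (t0 j).
  rewrite ler_pdivlMr// in h1; rewrite ltr_pdivrMr// -natr1 mulrDl mul1r in h2.
  rewrite ler_sqr ?nnegrE ?(ltW s0)//; lra.
rewrite sumr_const card_ord -mulr_natl /s expr_div_n.
rewrite mulrA ler_pdivrMr ?exprn_gt0// mulrC ler_wpM2l ?sqr_ge0//.
by rewrite -natrX ler_nat (leq_trans (leqnSn n))// leq_pmulr.
Qed.

Section domain.
Variable Om : set 'rV[R]_n.
Hypotheses (oO : open Om) (bO : bounded_set Om).

Let mO : measurable Om. Proof. exact: open_measurable_row. Qed.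
Let Ooo : (mu Om < +oo)%E. Proof. exact: bounded_lebesgue_row_lty. Qed.

Let V : lmodType R := (('rV[R]_n -> R^o) * ('I_n -> 'rV[R]_n -> R^o))%type.

(** A point is a function together with a chosen weak gradient, without passing to classes modulo
    almost everywhere equality. Both forms are then plain integrals of the pair. *)
Definition H1 : set V := [set z | sobolev1 Om z.1 z.2].
Definition l2form (z w : V) : R := \int[mu]_(x in Om) (z.1 x * w.1 x).
Definition dirichlet (z w : V) : R := \int[mu]_(x in Om) (\sum_i z.2 i x * w.2 i x).

Lemma test_function_sqi phi : test_function Om phi ->
  square_integrable Om phi /\ forall i, square_integrable Om (partial i phi).
Proof.
move=> [sphi _]; have [L L0 OL] := bounded_set_cube bO.
have csqi f : continuous f -> square_integrable Om f.
  move=> cf; have [B fB] := continuous_bounded_cube (ltW L0) cf.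
  apply: (sqi_bounded mO (B := B)) => //.
    by apply: measurable_funTS; exact: continuous_measurable_row.
  by move=> x /OL; exact: fB.
split; first by apply: csqi; have [] := sphi [::].
by move=> i; apply: csqi; have [] := sphi [:: i].
Qed.

Lemma H1_0 : H1 0.
Proof.
split=> [|i|phi tphi i]; [exact: sqi0|exact: sqi0|].
have z0 h : \int[mu]_(x in Om) (0 * h x : R) = 0.
  by under eq_Rintegral do rewrite mul0r; rewrite Rintegral_cst ?mul0r.
by apply: etrans (z0 _) _; rewrite -[LHS]oppr0; congr (- _); apply/esym; exact: z0.
Qed.

Lemma H1_linear (t : R) (z w : V) : H1 z -> H1 w -> H1 (t *: z + w).
Proof.
move=> [su sg wg] [sv sh wh]; split.
- exact: (sqiD mO (sqiZ mO t su) sv).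
- by move=> i; exact: (sqiD mO (sqiZ mO t (sg i)) (sh i)).
- move=> phi tphi i; have [sphi /(_ i) sdphi] := test_function_sqi tphi.
  have /= E (u v p : 'rV[R]_n -> R) : square_integrable Om u -> square_integrable Om v -> square_integrable Om p ->
      \int[mu]_(x in Om) ((t * u x + v x) * p x) =
      t * \int[mu]_(x in Om) (u x * p x) + \int[mu]_(x in Om) (v x * p x).
    move=> hu hv hp; rewrite -[LHS]/(ip Om (fun x => t * u x + v x) p) (ipDl mO (sqiZ mO t hu) hv hp).
    by rewrite (ipZl mO).
  rewrite [LHS](E _ _ _ su sv sdphi) (wg _ tphi) (wh _ tphi).
  by rewrite [in RHS](E _ _ _ (sg i) (sh i) sphi) opprD mulrN.
Qed.

Lemma psd_l2form : psd_form H1 l2form.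
Proof.
split.
- by move=> z w _ _; exact: (ipC Om z.1 w.1).
- move=> t z w v [su _ _] [sw _ _] [sv _ _].
  rewrite -[LHS]/(ip Om (fun x => t * z.1 x + w.1 x) v.1) (ipDl mO (sqiZ mO t su) sw sv).
  by rewrite (ipZl mO).
- by move=> z _; exact: ip_ge0.
Qed.

Lemma dirichletE z w : H1 z -> H1 w -> dirichlet z w = \sum_i ip Om (z.2 i) (w.2 i).
Proof.
move=> [_ sg _] [_ sh _]; rewrite /dirichlet Rintegral_sum// => i.
exact: sqiM.
Qed.

Lemma psd_dirichlet : psd_form H1 dirichlet.
Proof.
split.
- move=> z w Hz Hw; rewrite !dirichletE//; apply: eq_bigr => i _; exact: ipC.
- move=> t z w v Hz Hw Hv; have Hs := H1_linear t Hz Hw; rewrite !dirichletE// mulr_sumr -big_split/=.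
  apply: eq_bigr => i _; have [_ /(_ i) sg _] := Hz; have [_ /(_ i) sw _] := Hw; have [_ /(_ i) sv _] := Hv.
  rewrite -[LHS]/(ip Om (fun x => t * z.2 i x + w.2 i x) (v.2 i)) (ipDl mO (sqiZ mO t sg) sw sv).
  by rewrite (ipZl mO).
- by move=> z Hz; rewrite dirichletE// sumr_ge0// => i _; exact: ip_ge0.
Qed.

Lemma ip_cs u v : square_integrable Om u -> square_integrable Om v ->
  ip Om u v ^+ 2 <= ip Om u u * ip Om v v.
Proof.
move=> su sv; pose W : lmodType R := 'rV[R]_n -> R^o.
have HL (t : R) (x y : W) : square_integrable Om x -> square_integrable Om y ->
    square_integrable Om (t *: x + y) by move=> sx sy; exact: (sqiD mO (sqiZ mO t sx) sy).
apply: (@form_cs R W (square_integrable Om) HL (ip Om) _ u v su sv).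
split=> [x y _ _|t x y z sx sy sz|x _]; [exact: ipC| |exact: ip_ge0].
  rewrite -[LHS]/(ip Om (fun w => t * x w + y w) z) (ipDl mO (sqiZ mO t sx) sy sz).
  by rewrite (ipZl mO).
Qed.

(** The function and each component of the gradient converge separately in L^2. For a fixed test
    function both sides of the weak gradient identity are L^2-continuous by Cauchy-Schwarz, so the
    identity survives in the limit. *)
Lemma H1_complete (z_ : nat -> V) : (forall m, H1 (z_ m)) ->
  (forall e : R, 0 < e -> exists N, forall i j, (N <= i)%N -> (N <= j)%N ->
    dirichlet (z_ i - z_ j) (z_ i - z_ j) + l2form (z_ i - z_ j) (z_ i - z_ j) <= e) ->
  exists2 z, H1 z & forall e : R, 0 < e -> exists N, forall i, (N <= i)%N ->
    dirichlet (z_ i - z) (z_ i - z) + l2form (z_ i - z) (z_ i - z) <= e.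
Proof.
move=> Hz cz.
have Hd i j : H1 (z_ i - z_ j) by exact: (@HB R V H1 H1_linear _ _ (Hz i) (Hz j)).
have ipE (u v : 'rV[R]_n -> R) : \int[mu]_(x in Om) ((u x - v x) ^+ 2) =
    ip Om (fun x => u x - v x) (fun x => u x - v x).
  by apply: eq_Rintegral => x _; rewrite expr2.
have c1 : forall e : R, 0 < e -> exists N, forall i j, (N <= i)%N -> (N <= j)%N ->
    \int[mu]_(x in Om) (((z_ i).1 x - (z_ j).1 x) ^+ 2) <= e.
  move=> e e0; have [N NP] := cz e e0; exists N => i j Ni Nj.
  apply: le_trans (NP i j Ni Nj); rewrite ipE.
  by rewrite lerDr; have [_ _] := psd_dirichlet; apply.
have c2 k : forall e : R, 0 < e -> exists N, forall i j, (N <= i)%N -> (N <= j)%N ->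
    \int[mu]_(x in Om) (((z_ i).2 k x - (z_ j).2 k x) ^+ 2) <= e.
  move=> e e0; have [N NP] := cz e e0; exists N => i j Ni Nj.
  apply: le_trans (NP i j Ni Nj); rewrite ipE dirichletE// (bigD1 k)//= -addrA lerDl.
  rewrite addr_ge0//; last by have [_ _] := psd_l2form; apply.
  by apply: sumr_ge0 => l _; exact: ip_ge0.
have su m : square_integrable Om (z_ m).1 by case: (Hz m).
have sg k m : square_integrable Om ((z_ m).2 k) by case: (Hz m).
have [u su0 uP] := sqi_complete mO su c1.
have /choice[g gP] : forall k, exists g, square_integrable Om g /\ forall e : R, 0 < e ->
    exists N, forall i, (N <= i)%N -> \int[mu]_(x in Om) (((z_ i).2 k x - g x) ^+ 2) <= e.
  by move=> k; have [g sgk gk] := sqi_complete mO (sg k) (c2 k); exists g.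
have sg0 k : square_integrable Om (g k) by case: (gP k).
pose z : V := (u, g).
have Hzz : H1 z.
  split => // phi tphi i; have [sphi /(_ i) sdphi] := test_function_sqi tphi.
  apply/eqP; rewrite -addr_eq0 -sqrf_eq0 eq_le sqr_ge0 andbT.
  apply/ler_addgt0Pr => e e0; rewrite add0r.
  set P := ip Om (partial i phi) (partial i phi); set Q := ip Om phi phi.
  have P0 : 0 <= P by exact: ip_ge0.
  have Q0 : 0 <= Q by exact: ip_ge0.
  pose d := e / (2 * P + 2 * Q + 1).
  have q0 : 0 < 2 * P + 2 * Q + 1 by rewrite ltr_wpDl// addr_ge0// mulr_ge0.
  have d0 : 0 < d by rewrite divr_gt0.
  have [N NP] := uP d d0; have [_ /(_ d d0)[N' NP']] := gP i.
  have := NP _ (leq_maxl N N'); have := NP' _ (leq_maxr N N'); set m := maxn N N'.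
  rewrite !ipE => h1 h2.
  have [_ _ /(_ _ tphi i) wm] := Hz m.
  have su' := sqiB mO (su m) su0; have sg' := sqiB mO (sg i m) (sg0 i).
  have k1 := ip_cs su' sdphi; have k2 := ip_cs sg' sphi.
  have b1 : ip Om (fun x => (z_ m).1 x - u x) (partial i phi) =
      \int[mu]_(x in Om) ((z_ m).1 x * partial i phi x) - \int[mu]_(x in Om) (u x * partial i phi x).
    rewrite -RintegralB//; [|exact: sqiM|exact: sqiM].
    by apply: eq_Rintegral => x _; rewrite mulrBl.
  have b2 : ip Om (fun x => (z_ m).2 i x - g i x) phi =
      \int[mu]_(x in Om) ((z_ m).2 i x * phi x) - \int[mu]_(x in Om) (g i x * phi x).
    rewrite -RintegralB//; [|exact: sqiM|exact: sqiM].
    by apply: eq_Rintegral => x _; rewrite mulrBl.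
  have E : \int[mu]_(x in Om) (u x * partial i phi x) + \int[mu]_(x in Om) (g i x * phi x) =
    - (ip Om (fun x => (z_ m).1 x - u x) (partial i phi) + ip Om (fun x => (z_ m).2 i x - g i x) phi).
    by rewrite b1 b2 wm; ring.
  rewrite E; move: k1 k2; rewrite -/P -/Q.
  set A := ip _ _ (partial i phi); set B := ip _ _ phi => k1 k2.
  apply: (@le_trans _ _ (2 * (A ^+ 2 + B ^+ 2))).
    by have := sqr_ge0 (A - B); nra.
  have k1' : A ^+ 2 <= d * P by rewrite (le_trans k1)// ler_wpM2r.
  have k2' : B ^+ 2 <= d * Q by rewrite (le_trans k2)// ler_wpM2r.
  have : d * (2 * P + 2 * Q + 1) = e by rewrite /d divfK// gt_eqF.
  by move: (ltW d0); lra.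
exists z => // e e0.
pose d := e / (n.+1%:R); have d0 : 0 < d by rewrite divr_gt0.
have [N NP] := uP d d0.
have /choice[M MP] : forall k, exists M, forall i, (M <= i)%N ->
  \int[mu]_(x in Om) (((z_ i).2 k x - g k x) ^+ 2) <= d.
  by move=> k; have [_ /(_ d d0)] := gP k.
exists (maxn N (\max_k M k)) => i; rewrite geq_max => /andP[Ni Mi].
have Hdz : H1 (z_ i - z) by exact: (@HB R V H1 H1_linear _ _ (Hz i) Hzz).
rewrite dirichletE//.
have -> : e = \sum_(k < n) d + d.
  by rewrite sumr_const card_ord -mulr_natl -{2}[d]mul1r -mulrDl natr1 mulrC divfK.
apply: lerD.
  apply: ler_sum => k _; apply: le_trans (MP k i _); first by rewrite ipE.
  by apply: leq_trans Mi; exact: leq_bigmax.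
by apply: le_trans (NP i Ni); rewrite ipE.
Qed.

End domain.
End sobolev.

(** * Neumann eigenvalues *)

Section neumann.
Context (R : realType) (n : nat).
Local Notation mu := (lebesgue_row R n).
Local Notation K0 := (8 * expR 2^-1 : R).
Variable Om : set 'rV[R]_n.
Hypotheses (oO : open Om) (bO : bounded_set Om) (cO : convex Om).

Let mO : measurable Om. Proof. exact: open_measurable_row. Qed.
Let Ooo : (mu Om < +oo)%E. Proof. exact: bounded_lebesgue_row_lty. Qed.

Let V : lmodType R := (('rV[R]_n -> R^o) * ('I_n -> 'rV[R]_n -> R^o))%type.

Let H1L := H1_linear oO bO.
Let pa := psd_dirichlet oO bO.
Let pb := psd_l2form oO.

Lemma pair_lincomb I (s : seq I) (c : I -> R) (z : I -> V) :
  (forall x, (\sum_(i <- s) c i *: z i).1 x = \sum_(i <- s) c i * (z i).1 x) /\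
  (forall j x, (\sum_(i <- s) c i *: z i).2 j x = \sum_(i <- s) c i * (z i).2 j x).
Proof.
have E1 t (a b : V) x : (t *: a + b).1 x = t * a.1 x + b.1 x by [].
have E2 t (a b : V) j x : (t *: a + b).2 j x = t * a.2 j x + b.2 j x.
  exact: erefl.
elim: s => [|i s [IH1 IH2]]; first by split=> *; rewrite !big_nil.
split => [x|j x]; first by rewrite big_cons E1 IH1 [RHS]big_cons.
by rewrite big_cons E2 IH2 [RHS]big_cons.
Qed.

Lemma l2form_sqr z : l2form Om z z = \int[mu]_(x in Om) (z.1 x ^+ 2).
Proof. by apply: eq_Rintegral => x _; rewrite expr2. Qed.

Lemma dirichlet_sqr z : dirichlet Om z z = \int[mu]_(x in Om) (\sum_i z.2 i x ^+ 2).
Proof. by apply: eq_Rintegral => x _; apply: eq_bigr => i _; rewrite expr2. Qed.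

Lemma sqi_ae0 (D : set 'rV[R]_n) (f : 'rV[R]_n -> R) : measurable D -> square_integrable D f ->
  \int[mu]_(x in D) (f x ^+ 2) = 0 -> {ae mu, forall x, D x -> f x = 0}.
Proof.
move=> mD sf f0; have mf2 : measurable_fun D (fun x => (f x ^+ 2)%:E).
  by apply/measurable_EFinP/measurable_funX; case: sf.
have := @ae_eq_integral_abs _ _ _ mu D mD _ mf2.
move=> [+ _] => /(_ _)/wrap[].
  under eq_integral do rewrite gee0_abs ?lee_fin ?sqr_ge0//.
  by rewrite -[LHS]fineK ?(integrable_fin_num mD (sqi_integrable sf))//; congr EFin.
by apply: filterS => x h Dx; have := h Dx => -[] /eqP; rewrite sqrf_eq0 => /eqP.
Qed.

Lemma ae0_ip (D : set 'rV[R]_n) (f g : 'rV[R]_n -> R) : measurable D -> measurable_fun D f ->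
  measurable_fun D g ->
  {ae mu, forall x, D x -> f x = 0} -> \int[mu]_(x in D) (f x * g x) = 0.
Proof.
move=> mD mf mg f0; rewrite /Rintegral (@ae_eq_integral _ _ _ mu D (fun=> 0%E)).
- by rewrite integral0.
- by [].
- by apply/measurable_EFinP; exact: measurable_funM.
- exact: measurable_cst.
- by apply: filterS f0 => x h Dx; rewrite h// mul0r.
Qed.

(** The Rellich property in quantitative form: the covering inequality for a finite net of radius
    [rho], with 4 K0 rho^2 = d. The linear forms are the integrals over the cells. *)
Lemma l2form_compact (d : R) : 0 < d -> exists (m : nat) (l : 'I_m -> V -> R) (C B : R),
  [/\ 0 <= C, forall i x y, H1 Om x -> H1 Om y -> l i (x - y) = l i x - l i y,
   forall i x, H1 Om x -> l i x ^+ 2 <= B * l2form Om x x &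
   forall x, H1 Om x -> l2form Om x x <= d * dirichlet Om x x + C * \sum_i l i x ^+ 2].
Proof.
move=> d0; have [L L0 OL] := bounded_set_cube bO.
have k0 : 0 < 4 * K0 by rewrite !mulr_gt0// expR_gt0.
pose rho := Num.sqrt (d / (4 * K0)).
have rho0 : 0 < rho by rewrite sqrtr_gt0 divr_gt0.
have [m [p pP]] := @finite_net R n L rho rho0.
have [E [C [EP C0 HC]]] := covering_poincare oO bO cO rho0 (fun x Ox => pP x (OL x Ox)).
have sE i (u : 'rV[R]_n -> R) : square_integrable Om u -> square_integrable (E i) u.
  by have [mE EO] := EP i; exact: sqiS.
have Eoo i : (mu (E i) < +oo)%E.
  by have [mE EO] := EP i; apply: le_lt_trans Ooo; apply: le_measure; rewrite ?inE.
have iE i (u : 'rV[R]_n -> R) : square_integrable Om u -> mu.-integrable (E i) (EFin \o u).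
  move=> su; have [mE EO] := EP i.
  have s1 : square_integrable (E i) (fun=> 1).
    by apply: (sqi_bounded mE (B := 1)) => // x _; rewrite normr1.
  by have := sqiM mE (sE i _ su) s1; congr integrable; apply/funext => x /=; rewrite mulr1.
exists m, (fun i z => \int[mu]_(x in E i) z.1 x), C, (fine (mu Om)); split => //.
- move=> i x y [sx _ _] [sy _ _]; have [mE _] := EP i.
  by rewrite -RintegralB//; exact: iE.
- move=> i x [sx _ _]; have [mE EO] := EP i.
  rewrite l2form_sqr; apply: (le_trans (Rintegral_sqr_le mE (Eoo i) (sE i _ sx))).
  apply: ler_pM => //; [exact: fine_ge0|by apply: Rintegral_ge0 => ? _; exact: sqr_ge0|..].
    apply: fine_le; rewrite ?ge0_fin_numE//.
    by apply: le_measure; rewrite ?inE.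
  have s2 := sqi_integrable sx; have s3 := sqi_integrable (sE i _ sx).
  rewrite -lee_fin /Rintegral !fineK ?(integrable_fin_num _ s2) ?(integrable_fin_num _ s3)//.
  apply: ge0_subset_integral => //; last by move=> ? _; rewrite lee_fin sqr_ge0.
  by apply/measurable_EFinP/measurable_funX; case: sx.
- move=> x Hx; rewrite l2form_sqr dirichlet_sqr addrC.
  have := HC x.1 x.2 Hx; rewrite sqr_sqrtr ?divr_ge0 ?(ltW d0) ?(ltW k0)//.
  by rewrite (mulrC (4 * K0)) divfK// gt_eqF.
Qed.

(** The variational upper bound. The definition asks for eigenfunctions, so the test space is
    replaced by the eigenfunctions of the spectral theorem, independent because orthonormal. *)
Lemma neumann_eigenvalue_le (k : nat) (w : 'I_k.+1 -> 'rV[R]_n -> R)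
    (h : 'I_k.+1 -> 'I_n -> 'rV[R]_n -> R) (T : R) :
  (forall i, sobolev1 Om (w i) (h i)) ->
  (forall c : 'I_k.+1 -> R,
    \int[mu]_(x in Om) (\sum_j (\sum_i c i * h i j x) ^+ 2) <=
    T * \int[mu]_(x in Om) ((\sum_i c i * w i x) ^+ 2)) ->
  (forall c : 'I_k.+1 -> R, \int[mu]_(x in Om) ((\sum_i c i * w i x) ^+ 2) = 0 ->
    forall i, c i = 0) ->
  (neumann_eigenvalue Om k <= T%:E)%E.
Proof.
move=> Hw aT b0; pose z i : V := (w i, h i).
have Ea c : dirichlet Om (\sum_i c i *: z i) (\sum_i c i *: z i) =
    \int[mu]_(x in Om) (\sum_j (\sum_i c i * h i j x) ^+ 2).
  rewrite dirichlet_sqr; apply: eq_Rintegral => x _; apply: eq_bigr => j _.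
  by have [_ ->] := pair_lincomb (index_enum _) c z.
have Eb c : l2form Om (\sum_i c i *: z i) (\sum_i c i *: z i) =
    \int[mu]_(x in Om) ((\sum_i c i * w i x) ^+ 2).
  rewrite l2form_sqr; apply: eq_Rintegral => x _.
  by have [-> _] := pair_lincomb (index_enum _) c z.
have [||lam [e [eP eO]]] := @spectral_theorem R V (H1 Om) (H1_0 oO) H1L _ _ pa pb
  l2form_compact (H1_complete oO bO) k z T Hw.
- by move=> c; rewrite Ea Eb.
- by move=> c; rewrite Eb; exact: b0.
apply: ereal_inf_lbound => /=; exists T => //.
exists (fun i => lam i), (fun i => (e i).1); split.
  move=> i; have [He lT eig] := eP i (ltn_ord i); split => //; split.
    move=> ae0; have := eO i i (ltn_ord i) (ltn_ord i); rewrite eqxx /l2form.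
    have [[me _] _ _] := He.
    rewrite ae0_ip// => /eqP; by rewrite eq_sym oner_eq0.
  exists (e i).2; split => // v hv Hv.
  exact: eig (v, hv) Hv.
move=> a ae0 j.
have := ae0_ip mO _ _ ae0.
have sei i : square_integrable Om (e (nat_of_ord (i : 'I_k.+1))).1.
  by have [[]] := eP i (ltn_ord i).
move=> /(_ (e j).1) h0.
have : \int[mu]_(x in Om) ((\sum_i a i * (e i).1 x) * (e j).1 x) = a j.
  transitivity (l2form Om (\sum_i a i *: e i) (e j)).
    apply: eq_Rintegral => x _.
    by have [-> _] := pair_lincomb (index_enum _) a (fun i : 'I_k.+1 => e i).
  rewrite (form_sum (H1_0 oO) H1L pb)//; last 2 first.
  - by move=> i; have [] := eP i (ltn_ord i).
  - by have [] := eP j (ltn_ord j).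
  rewrite (bigD1 j)//= (eO _ _ (ltn_ord j) (ltn_ord j)) eqxx mulr1 big1 ?addr0// => i ij.
  by rewrite (eO _ _ (ltn_ord i) (ltn_ord j)) (_ : (i == j :> nat) = false) ?mulr0//; apply: negbTE; exact: ij.
rewrite h0//; last by case: (sei j).
have := sqi_sum mO (index_enum _) (fun i => sqiZ mO (a i) (sei i)).
by case.
Qed.

(** As m < k + 1, some nonzero combination of k + 1 independent eigenfunctions has zero integral
    over each of the m cells, so only the energy term remains in the covering inequality.
    Independence makes its norm positive. *)
Lemma neumann_eigenvalue_ge (k m : nat) (p : 'I_m -> 'rV[R]_n) (rho : R) : (m <= k)%N -> 0 < rho ->
  (forall x, Om x -> exists i, dot (x - p i) (x - p i) <= rho ^+ 2) ->
  (((4 * K0 * rho ^+ 2)^-1)%:E <= neumann_eigenvalue Om k)%E.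
Proof.
move=> mk rho0 pP.
have k0 : 0 < 4 * K0 * rho ^+ 2 by rewrite !mulr_gt0// expR_gt0.
have [E [C [EP C0 HC]]] := covering_poincare oO bO cO rho0 pP.
apply: le_ereal_inf_tmp => _ [t [lam [u [uP ind]]] <-]; rewrite lee_fin.
have /choice[g gP] : forall i, exists g, sobolev1 Om (u i) g /\
    forall v h, sobolev1 Om v h -> \int[mu]_(x in Om) (\sum_j g j x * h j x) =
      lam i * \int[mu]_(x in Om) (u i x * v x) by move=> i; have [[_ +] _] := uP i.
pose z i : V := (u i, g i).
have Hz i : H1 Om (z i) by case: (gP i).
have su i : square_integrable Om (u i) by case: (Hz i).
have eig i v : H1 Om v -> dirichlet Om (z i) v = lam i * l2form Om (z i) v.
  by move=> Hv; have [_ /(_ v.1 v.2 Hv)] := gP i.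
have lt i : lam i <= t by have [] := uP i.
have iE l (v : 'rV[R]_n -> R) : square_integrable Om v -> mu.-integrable (E l) (EFin \o v).
  move=> sv; have [mE EO] := EP l; apply: (@integrableS _ _ _ mu Om) => //.
  have s1 : square_integrable Om (fun=> 1).
    by apply: (sqi_bounded mO (B := 1)) => // x _; rewrite normr1.
  by have := sqiM mO sv s1; congr integrable; apply/funext => x /=; rewrite mulr1.
have [c c0 cM] := @exists_left_kernel R m k.+1
  (\matrix_(i, l) \int[mu]_(x in E l) u i x) (mk : (m < k.+1)%N).
pose f : V := \sum_i c ord0 i *: z i.
have Hf : H1 Om f by exact: (Hsum (H1_0 oO) H1L).
have f1 x : f.1 x = \sum_i c ord0 i * u i x.
  by have [-> _] := pair_lincomb (index_enum _) (fun i => c ord0 i) z.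
have fE l : \int[mu]_(x in E l) f.1 x = 0.
  have [mE EO] := EP l.
  under eq_Rintegral do rewrite f1.
  rewrite Rintegral_sum//; last by move=> i; apply: RintegrableZl => //; exact: iE.
  have := congr1 (fun M : 'rV[R]_m => M ord0 l) cM; rewrite !mxE => cMl.
  by rewrite -[RHS]cMl; apply: eq_bigr => i _; rewrite mxE RintegralZl//; exact: iE.
have bf : 0 < l2form Om f f.
  rewrite lt_neqAle eq_sym (form_ge0 pb Hf) andbT; apply/negP => /eqP.
  rewrite l2form_sqr => /(sqi_ae0 mO) ae0; move/eqP: c0; apply.
  apply/rowP => i; rewrite mxE; apply: (ind (fun i => c ord0 i)).
  have sf : square_integrable Om f.1 by case: Hf.
  by have := ae0 sf; apply: filterS => x h Ox; rewrite -f1 h.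
pose M i j := l2form Om (z i) (z j).
have MC i j : M i j = M j i by rewrite /M (psd_sym pb (Hz i) (Hz j)).
(* Eigenfunctions for distinct eigenvalues are orthogonal. Inside an eigenspace nothing is known,
   since the given family is only independent. *)
have lamM i j : lam i * M i j = lam j * M i j.
  by rewrite {2}MC /M -!eig// (psd_sym pa (Hz i) (Hz j)).
have bE (a : 'I_k.+1 -> R) : l2form Om (\sum_i a i *: z i) (\sum_i a i *: z i) =
    \sum_i \sum_j a i * a j * M i j.
  have Ha : H1 Om (\sum_i a i *: z i) by exact: (Hsum (H1_0 oO) H1L).
  rewrite (form_sum (H1_0 oO) H1L pb)//; apply: eq_bigr => i _.
  rewrite (psd_sym pb (Hz i) Ha) (form_sum (H1_0 oO) H1L pb)// mulr_sumr.
  by apply: eq_bigr => j _; rewrite mulrA (psd_sym pb (Hz j) (Hz i)).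
have af : dirichlet Om f f = \sum_i \sum_j lam i * (c ord0 i * c ord0 j * M i j).
  rewrite (form_sum (H1_0 oO) H1L pa)//; apply: eq_bigr => i _.
  rewrite eig// (psd_sym pb (Hz i) Hf) (form_sum (H1_0 oO) H1L pb)// !mulr_sumr.
  by apply: eq_bigr => j _; rewrite (psd_sym pb (Hz j) (Hz i)) -/(M i j); ring.
(* The difference of the two sides is the squared norm of the combination with coefficients sqrt(t -
   lam i) c i: whenever [M i j] is nonzero the two eigenvalues agree, so the product of the square
   roots is t - lam i. *)
have at_ : dirichlet Om f f <= t * l2form Om f f.
  rewrite -subr_ge0 af bE mulr_sumr -sumrB.
  pose b i := Num.sqrt (t - lam i) * c ord0 i.
  have Hb : H1 Om (\sum_i b i *: z i) by exact: (Hsum (H1_0 oO) H1L).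
  have := form_ge0 pb Hb; rewrite bE; congr (0 <= _); apply: eq_bigr => i _.
  rewrite mulr_sumr -sumrB; apply: eq_bigr => j _.
  have [M0|Mn0] := eqVneq (M i j) 0; first by rewrite M0 !mulr0 subrr.
  rewrite /b; have -> : lam j = lam i by apply: (mulIf Mn0); rewrite -lamM.
  have s2 : Num.sqrt (t - lam i) ^+ 2 = t - lam i by rewrite sqr_sqrtr ?subr_ge0.
  rewrite -[RHS]mulrBl -[in RHS]s2; ring.
have := HC f.1 f.2 Hf; rewrite -l2form_sqr -dirichlet_sqr big1 ?mulr0 ?add0r; last first.
  by move=> l _; rewrite fE expr0n.
move=> h.
have : l2form Om f f <= 4 * K0 * rho ^+ 2 * t * l2form Om f f.
  by rewrite -(mulrA _ t) (le_trans h)// ler_pM2l.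
rewrite -[X in X <= _]mul1r ler_pM2r// => h1.
by rewrite -div1r ler_pdivrMr// mulrC.
Qed.

End neumann.

(** * Tent functions *)

Section weak_gradient.
Context (R : realType) (n : nat).
Local Notation mu := (lebesgue_row R n).
Local Notation e_ i := (delta_mx ord0 i : 'rV[R]_n).

Lemma integrable_cube (f : 'rV[R]_n -> R) (L B : R) : measurable_fun setT f ->
  (forall x, `|f x| <= B * \1_(@cube R n L) x) -> mu.-integrable setT (EFin \o f).
Proof.
move=> mf fB; have mL := @measurable_cube R n L.
have [B0|B0] := leP 0 B; last first.
  have f0 x : f x = 0.
    by apply/eqP; rewrite -normr_le0 (le_trans (fB x))// mulr_le0_ge0// ltW.
  rewrite (_ : EFin \o f = fun=> 0%E); first exact: integrable0.
  by apply/funext => x /=; rewrite f0.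
apply: (@le_integrable _ _ _ mu setT measurableT _ (fun x => (B * \1_(@cube R n L) x)%:E)).
- exact/measurable_EFinP.
- by move=> x _ /=; rewrite lee_fin (le_trans (fB x))// ler_norm.
- apply: RintegrableZl => //; apply/integrableP; split.
    by apply/measurable_EFinP; exact: measurable_indic.
  under eq_integral do rewrite gee0_abs ?lee_fin ?indicE//=.
  by rewrite integral_indic// setIT; exact: cube_lty.
Qed.

Lemma bounded_convergence (f_ : nat -> 'rV[R]_n -> R) (f : 'rV[R]_n -> R) (L B : R) :
  (forall k, measurable_fun setT (f_ k)) -> measurable_fun setT f ->
  (forall k x, `|f_ k x| <= B * \1_(@cube R n L) x) ->
  (forall x, f_ k x @[k --> \oo] --> f x) ->
  \int[mu]_x f_ k x @[k --> \oo] --> \int[mu]_x f x.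
Proof.
move=> mf_ mf fB ff.
have fB' x : `|f x| <= B * \1_(@cube R n L) x.
  apply: (ler_cvg_to (cvg_norm (ff x)) (cvg_cst _)).
  by apply: nearW => k; exact: fB.
have ih : mu.-integrable setT (EFin \o (fun x => B * \1_(@cube R n L) x)).
  have := @integrable_cube (fun x => B * \1_(@cube R n L) x) L `|B|.
  apply; first by apply: measurable_funM => //; apply: measurable_indic; exact: measurable_cube.
  by move=> x; rewrite normrM [X in _ * X]ger0_norm// indicE.
have := @dominated_convergence _ _ R mu setT measurableT
  (fun k x => (f_ k x)%:E) (EFin \o f) (fun x => (B * \1_(@cube R n L) x)%:E).
case.
- by move=> k; exact/measurable_EFinP.
- exact/measurable_EFinP.
- apply: aeW => x _ /=; apply/cvg_EFin; first exact: nearW.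
  exact: ff.
- exact: ih.
- by apply: aeW => x k _ /=; rewrite lee_fin.
move=> _ _ h3; apply: fine_cvg; apply: cvg_trans h3 _.
by rewrite /Rintegral fineK// (integrable_fin_num measurableT (integrable_cube mf fB')).
Qed.

Lemma partial_off_support (phi : 'rV[R]_n -> R) (K : set 'rV[R]_n) i x : compact K ->
  (forall x, ~ K x -> phi x = 0) -> ~ K x -> partial i phi x = 0.
Proof.
move=> /(compact_closed (@norm_hausdorff R 'rV[R]_n)) cK phi0 Kx.
have /nbhs_ballP[e /= e0 eK] : nbhs x (~` K).
  by apply: open_nbhs_nbhs; split => //; rewrite openC.
rewrite /partial /derive; apply: cvg_lim => //; apply: cvg_near_cst.
apply: (@filterS _ _ _ (ball (0 : R) e)).
  move=> h he; rewrite /= (phi0 x Kx) phi0 ?subrr ?scaler0//.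
  apply: eK; split => // a b; rewrite (ord1 a) /ball/= !mxE eqxx/= opprD addrCA subrr addr0 normrN.
  move: he; rewrite /ball/= sub0r normrN => he.
  by case: (b == i); rewrite ?mulr1// mulr0 normr0.
by apply: nbhs_dnbhs; exact: nbhsx_ballx.
Qed.

(** Integration by parts for difference quotients is just translation invariance of the integral.
    The two quotients then converge to the derivatives with uniform bounds, by the mean value
    theorem for [phi] and by the quadratic error for [f]. *)
Lemma weak_gradient_C1 (Om : set 'rV[R]_n) (f : 'rV[R]_n -> R) (g : 'I_n -> 'rV[R]_n -> R) :
  open Om -> bounded_set Om -> continuous f -> (forall i, continuous (g i)) ->
  (forall L, exists2 C : R, 0 <= C & forall i x (h : R), cube L x -> `|h| <= 1 ->
     `|f (x + h *: e_ i) - f x - h * g i x| <= C * h ^+ 2) ->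
  sobolev1 Om f g.
Proof.
move=> oO bO cf cg fg; have mO : measurable Om by exact: open_measurable_row.
have Ooo : (mu Om < +oo)%E by exact: bounded_lebesgue_row_lty.
have [L L0 OL] := bounded_set_cube bO.
have csqi u : continuous u -> square_integrable Om u.
  move=> cu; have [B fB] := continuous_bounded_cube (ltW L0) cu.
  apply: (sqi_bounded mO (B := B)) => //.
    by apply: measurable_funTS; exact: continuous_measurable_row.
  by move=> x /OL; exact: fB.
split=> [|i|phi [sphi [K [cK KO Kphi]]] i]; [exact: csqi|exact: csqi|].
have toT (u : 'rV[R]_n -> R) : (forall x, ~ K x -> u x = 0) ->
    \int[mu]_(x in Om) u x = \int[mu]_x u x.
  move=> u0; rewrite Rintegral_mkcond; apply: eq_Rintegral => x _.
  by rewrite patchE; case: ifPn => // /negP; rewrite inE => xO; rewrite u0// => /KO.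
have dphi0 x : ~ K x -> partial i phi x = 0 by exact: partial_off_support.
rewrite toT; last by move=> x Kx; rewrite dphi0// mulr0.
rewrite toT; last by move=> x Kx; rewrite Kphi// mulr0.
have cphi : continuous phi by have [] := sphi [::].
have cdphi : continuous (partial i phi) by have [] := sphi [:: i].
have dphi x : derivable phi x (e_ i) by have [_] := sphi [::]; apply.
(* [phi] lives on [cube L], its shifts on [cube (L + 1)], and shifted points stay in [cube (L + 2)],
   where all bounds are taken. *)
have L2 : 0 <= L + 2 by rewrite addr_ge0// ltW.
have L12 : L + 2 = L + 1 + 1 by ring.
have [Bf fB] := continuous_bounded_cube L2 cf.
have [Bp pB] := continuous_bounded_cube L2 cphi.
have [Bd dB] := continuous_bounded_cube L2 cdphi.
have [Bg gB] := continuous_bounded_cube L2 (cg i).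
have [C C0 fC] := fg (L + 2).
have cL (a b : R) x : a <= b -> @cube R n a x -> @cube R n b x.
  by move=> ab xa j; rewrite (le_trans (xa j)).
have cubeD (a h : R) x : `|h| <= 1 -> @cube R n a x -> @cube R n (a + 1) (x + h *: e_ i).
  move=> h1 xa j; rewrite !mxE eqxx/=; rewrite (le_trans (ler_normD _ _))// lerD//.
  by rewrite normrM; case: (j == i); rewrite ?normr1 ?mulr1// normr0 mulr0.
have KL x : K x -> cube L x by move=> /KO/OL.
pose s (k : nat) : R := k.+1%:R^-1.
have s0 k : 0 < s k by rewrite invr_gt0.
have s1 k : `|s k| <= 1 by rewrite ger0_norm ?(ltW (s0 k))// invf_le1// ler1n.
have ss k : k.+1%:R * s k = 1 by rewrite mulfV.
pose q k x := k.+1%:R * (phi (x + s k *: e_ i) - phi x).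
pose r k x := k.+1%:R * (f (x - s k *: e_ i) - f x).
have mcont (u : 'rV[R]_n -> R) : continuous u -> measurable_fun setT u by exact: continuous_measurable_row.
have mshift (u : 'rV[R]_n -> R) a : continuous u -> measurable_fun setT (fun x : 'rV[R]_n => u (x + a)).
  move=> cu; have := measurable_comp_shift (- a) (mcont u cu).
  by congr measurable_fun; apply/funext => x; rewrite opprK.
have mq k : measurable_fun setT (q k).
  apply: measurable_funM => //; apply: measurable_funB; [exact: mshift|exact: mcont].
have mr k : measurable_fun setT (r k).
  apply: measurable_funM => //; apply: measurable_funB; [exact: mshift|exact: mcont].
have intM (u v : 'rV[R]_n -> R) Bu Bv : measurable_fun setT u -> measurable_fun setT v ->
    (forall x, cube (L + 2) x -> `|u x| <= Bu /\ `|v x| <= Bv) ->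
    (forall x, ~ cube (L + 2) x -> u x * v x = 0) ->
    mu.-integrable setT (EFin \o (fun x => u x * v x)).
  move=> mu_ mv uv uv0; apply: (@integrable_cube _ (L + 2) (Bu * Bv)).
    exact: measurable_funM.
  move=> x; rewrite indicE; have [/set_mem xL|/negP] := boolP (x \in cube (L + 2)).
    by rewrite mulr1 normrM; have [h1 h2] := uv x xL; apply: ler_pM.
  by rewrite inE => /uv0 ->; rewrite normr0 mulr0.
have offK a x : 0 <= a -> ~ cube (L + a) x -> ~ K x.
  by move=> a0 xL /KL xL'; apply: xL; apply: cL xL'; rewrite lerDl.
have offKs (h : R) x : ~ cube (L + 1) x -> `|h| <= 1 -> ~ K (x + h *: e_ i).
  move=> xL h1 /KL xL'; apply: xL; have := cubeD L (- h) _ _ xL'.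
  by rewrite normrN scaleNr addrK; exact.
have qB k x : `|q k x| <= Bd * \1_(@cube R n (L + 1)) x.
  rewrite indicE; have [/set_mem xL|/negP] := boolP (x \in cube (L + 1)).
    rewrite mulr1 /q; have [c cs ->] := mvt_line x (s k) dphi.
    rewrite mulrA ss mul1r; apply: dB; rewrite L12.
    by apply: cubeD => //; exact: le_trans (s1 k).
  rewrite inE => xL; rewrite /q !Kphi ?subrr ?mulr0 ?normr0//; last exact: offKs.
  exact: offK xL.
have rE k x : cube (L + 2) x -> `|r k x + g i x| <= C * s k.
  move=> xL; have := fC i x (- s k) xL; rewrite normrN => /(_ (s1 k)).
  rewrite sqrrN scaleNr mulNr opprK => h.
  have -> : r k x + g i x = k.+1%:R * (f (x - s k *: e_ i) - f x + s k * g i x).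
    by rewrite mulrDr mulrA ss mul1r.
  rewrite normrM ger0_norm// mulrC -ler_pdivlMr// (le_trans h)//.
  by rewrite -mulrA -/(s k) expr2.
(* Discrete summation by parts: the shift of [phi] is moved onto [f]. *)
have E k : \int[mu]_x (f x * q k x) = \int[mu]_x (r k x * phi x).
  have i0 : mu.-integrable setT (EFin \o (fun x => f x * phi x)).
    apply: (@intM _ _ Bf Bp); [exact: mcont|exact: mcont|by move=> x xL; split; [exact: fB|exact: pB]|].
    by move=> x xL; rewrite Kphi ?mulr0//; exact: offK xL.
  have i1 : mu.-integrable setT (EFin \o (fun x => f x * phi (x + s k *: e_ i))).
    have := @integrable_cube _ (L + 1) (Bf * Bp); apply.
      by apply: measurable_funM; [exact: mcont|exact: mshift].
    move=> x; rewrite indicE; have [/set_mem xL|/negP] := boolP (x \in cube (L + 1)).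
      rewrite mulr1 normrM; apply: ler_pM => //; first by apply: fB; apply: cL xL; rewrite lerD2l ler1n.
      by apply: pB; rewrite L12; exact: cubeD.
    by rewrite inE => xL; rewrite Kphi ?mulr0 ?normr0//; exact: offKs.
  have i2 : mu.-integrable setT (EFin \o (fun x => f (x - s k *: e_ i) * phi x)).
    have := @integrable_cube _ (L + 1) (Bf * Bp); apply.
      by apply: measurable_funM; [exact: mshift|exact: mcont].
    move=> x; rewrite indicE; have [/set_mem xL|/negP] := boolP (x \in cube (L + 1)).
      rewrite mulr1 normrM; apply: ler_pM => //; last by apply: pB; apply: cL xL; rewrite lerD2l ler1n.
      apply: fB; rewrite L12.
      by rewrite -scaleNr; apply: cubeD => //; rewrite normrN.
    by rewrite inE => xL; rewrite Kphi ?mulr0 ?normr0//; exact: offK xL.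
  transitivity (k.+1%:R * (\int[mu]_x (f x * phi (x + s k *: e_ i)) - \int[mu]_x (f x * phi x))).
    rewrite -RintegralB// -RintegralZl//; last exact: RintegrableB.
    by apply: eq_Rintegral => x _; rewrite /q; ring.
  transitivity (k.+1%:R * (\int[mu]_x (f (x - s k *: e_ i) * phi x) - \int[mu]_x (f x * phi x))); last first.
    rewrite -RintegralB// -RintegralZl//; last exact: RintegrableB.
    by apply: eq_Rintegral => x _; rewrite /r; ring.
  congr (_ * (_ - _)).
  rewrite -[RHS](Rintegral_shift (- (s k *: e_ i))).
    by apply: eq_Rintegral => x _; rewrite opprK addrK.
  by apply: measurable_funM; [exact: mshift|exact: mcont].
have lq : \int[mu]_x (f x * q k x) @[k --> \oo] --> \int[mu]_x (f x * partial i phi x).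
  apply: (@bounded_convergence _ _ (L + 1) (Bf * Bd)).
  - by move=> k; apply: measurable_funM => //; exact: mcont.
  - by apply: measurable_funM; exact: mcont.
  - move=> k x; rewrite normrM -mulrA; have := qB k x; rewrite indicE.
    case: (boolP (x \in cube (L + 1))) => [/set_mem xL|_]; rewrite ?mulr0 ?mulr1 => h.
      by apply: ler_pM => //; apply: fB; apply: cL xL; rewrite lerD2l ler1n.
    by rewrite (_ : `|q k x| = 0) ?mulr0//; apply/eqP; rewrite eq_le h/=.
  - move=> x; apply: cvgM; first exact: cvg_cst.
    have sd : s @ \oo --> (0 : R)^'.
      move=> A /nbhs_ballP[e /= e0 eA].
      have := near_infty_natSinv_lt (PosNum e0); apply: filterS => k /= ke; apply: eA.
        by rewrite /ball/= sub0r normrN ger0_norm// ltW.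
      by rewrite gt_eqF.
    have := cvg_comp _ _ sd (dphi x); rewrite (_ : _ \o s = q ^~ x)//.
    apply/funext => k; rewrite /q /= /s invrK /shift/=.
    by rewrite (addrC _ x).
have lr : \int[mu]_x (r k x * phi x) @[k --> \oo] --> \int[mu]_x (- g i x * phi x).
  apply: (@bounded_convergence _ _ (L + 1) ((C + Bg) * Bp)).
  - by move=> k; apply: measurable_funM => //; exact: mcont.
  - by apply: measurable_funM; [apply: measurableT_comp => //; exact: mcont|exact: mcont].
  - move=> k x; rewrite normrM -mulrA indicE.
    case: (boolP (x \in cube (L + 1))) => [/set_mem xL|/negP]; rewrite ?mulr0 ?mulr1.
      have xL2 : cube (L + 2) x by apply: cL xL; rewrite lerD2l ler1n.
      apply: ler_pM => //; last exact: pB.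
      rewrite -[r k x](addrK (g i x)) (le_trans (ler_normB _ _))// lerD ?gB//.
      rewrite (le_trans (rE k x xL2))// ler_piMr//.
      by rewrite (le_trans (ler_norm _)).
    rewrite inE => xL; rewrite Kphi ?normr0 ?mulr0//.
    exact: offK xL.
  - move=> x; have [Kx|Kx] := pselect (K x); last first.
      by rewrite Kphi// mulr0; under eq_fun do rewrite mulr0; exact: cvg_cst.
    apply: cvgM; last exact: cvg_cst.
    have xL2 : cube (L + 2) x by apply: cL (KL _ Kx); rewrite lerDl.
    apply/cvgrPdist_le => e e0; have C1 : 0 < C + 1 by rewrite ltr_wpDl.
    have := near_infty_natSinv_lt (PosNum (divr_gt0 e0 C1)); apply: filterS => k /= ke.
    rewrite -normrN opprB opprK (le_trans (rE k x xL2))//.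
    apply: (@le_trans _ _ ((C + 1) * s k)); first by rewrite ler_wpM2r ?(ltW (s0 k))// lerDl.
    by rewrite mulrC -ler_pdivlMr// ltW.
have h1 : \int[mu]_x (f x * partial i phi x) = \int[mu]_x (- g i x * phi x).
  apply: (cvg_unique _ lq) => //.
  by rewrite (_ : (fun k => \int[mu]_x (f x * q k x)) = (fun k => \int[mu]_x (r k x * phi x)))//; apply/funext.
rewrite h1 -[RHS]mulN1r -RintegralZl//; first by apply: eq_Rintegral => x _; rewrite mulN1r mulNr.
apply: (@intM _ _ Bg Bp); [exact: mcont|exact: mcont|by move=> x xL; split; [exact: gB|exact: pB]|].
by move=> x xL; rewrite Kphi ?mulr0//; exact: offK xL.
Qed.

End weak_gradient.

(** The squared positive part is C^1 with Lipschitz derivative, which is why tents are squares. *)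
Lemma sqr_max0_taylor (R : realType) (u v : R) :
  `|Num.max 0 v ^+ 2 - Num.max 0 u ^+ 2 - 2 * Num.max 0 u * (v - u)| <= (v - u) ^+ 2.
Proof.
have su := sqr_ge0 u; have sv := sqr_ge0 v.
have [u0|u0] := leP 0 u; have [v0|v0] := leP 0 v.
- by rewrite (_ : v ^+ 2 - _ - _ = (v - u) ^+ 2) ?ger0_norm ?sqr_ge0//; ring.
- have uv : 0 <= u * - v by rewrite mulr_ge0// oppr_ge0 ltW.
  by rewrite ler_norml; apply/andP; split; nra.
- have uv : 0 <= v * - u by rewrite mulr_ge0// oppr_ge0 ltW.
  by rewrite ler_norml; apply/andP; split; nra.
- by rewrite expr0n mulr0 mul0r !subr0 normr0 sqr_ge0.
Qed.

Lemma bernoulli_ge (R : realType) n (x : R) : 0 <= x <= 1 -> 1 - n%:R * x <= (1 - x) ^+ n.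
Proof.
move=> /andP[x0 x1]; elim: n => [|n IH]; first by rewrite mul0r subr0 expr0.
rewrite exprS; have h : 0 <= 1 - x by rewrite subr_ge0.
apply: (le_trans _ (ler_wpM2l h IH)); rewrite -natr1.
have : 0 <= n%:R * x ^+ 2 by rewrite mulr_ge0// sqr_ge0.
by nra.
Qed.

Lemma sqr_sum_disjoint (R : realType) (I : finType) (a : I -> R) :
  (forall i j, i != j -> a i * a j = 0) -> (\sum_i a i) ^+ 2 = \sum_i a i ^+ 2.
Proof.
move=> aij; rewrite expr2 mulr_suml; apply: eq_bigr => i _.
rewrite mulr_sumr (bigD1 i)//= -expr2 big1 ?addr0// => j ji.
by apply: aij; rewrite eq_sym.
Qed.

Section tent.
Context (R : realType) (n : nat).
Local Notation mu := (lebesgue_row R n).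
Local Notation e_ i := (delta_mx ord0 i : 'rV[R]_n).

Definition sdist (p : 'rV[R]_n) (rho : R) x := dot (x - p) (x - p) / rho ^+ 2.
Definition tent p rho x := Num.max 0 (1 - sdist p rho x) ^+ 2.
Definition grad_tent p rho i (x : 'rV[R]_n) :=
  2 * Num.max 0 (1 - sdist p rho x) * (- 2 * (x ord0 i - p ord0 i) / rho ^+ 2).

Lemma contM (f g : 'rV[R]_n -> R) : continuous f -> continuous g -> continuous (fun x => f x * g x).
Proof. by move=> cf cg x; exact: (continuousM (cf x) (cg x)). Qed.

Lemma contD (f g : 'rV[R]_n -> R) : continuous f -> continuous g -> continuous (fun x => f x + g x).
Proof. by move=> cf cg x; exact: (continuousD (cf x) (cg x)). Qed.

Lemma cont_sum I (s : seq I) (f : I -> 'rV[R]_n -> R) : (forall i, continuous (f i)) ->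
  continuous (fun x => \sum_(i <- s) f i x).
Proof.
move=> cf; elim: s => [|i s IH].
  by under eq_fun do rewrite big_nil; move=> x; exact: cst_continuous.
by under eq_fun do rewrite big_cons; exact: contD.
Qed.

Section one.
Variables (p : 'rV[R]_n) (rho : R).
Hypothesis rho0 : 0 < rho.

Let r20 : 0 < rho ^+ 2. Proof. exact: exprn_gt0. Qed.

Lemma sdist_ge0 x : 0 <= sdist p rho x.
Proof. by rewrite divr_ge0 ?dot_ge0// ltW. Qed.

Lemma sdist_shift i x h : sdist p rho (x + h *: e_ i) =
  sdist p rho x + h * (2 * (x ord0 i - p ord0 i) / rho ^+ 2) + h ^+ 2 / rho ^+ 2.
Proof.
have E y : dot y (e_ i) = y ord0 i.
  rewrite /dot (bigD1 i)//= mxE !eqxx mulr1 big1 ?addr0// => j ji.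
  by rewrite mxE (negbTE ji) andbF mulr0.
rewrite /sdist addrAC (_ : x ord0 i - p ord0 i = (x - p) ord0 i); last by rewrite !mxE.
move: (x - p) => y; rewrite !dotE (dotC (e_ i) y) !E mxE !eqxx/=; field.
by rewrite gt_eqF.
Qed.

Lemma continuous_sdist : continuous (sdist p rho).
Proof.
apply: contM; last by move=> x; exact: cst_continuous.
have cx i : continuous (fun x : 'rV[R]_n => (x - p) ord0 i).
  rewrite (_ : (fun x => _) = (fun x : 'rV[R]_n => x ord0 i + - p ord0 i)).
    by apply: contD => x; [exact: coord_continuous|exact: cst_continuous].
  by apply/funext => x; rewrite !mxE.
by apply: cont_sum => i; apply: contM.
Qed.

Lemma continuous_max0 : continuous (fun x => Num.max 0 (1 - sdist p rho x)).
Proof.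
rewrite (_ : (fun x => _) = (fun x => (1 - sdist p rho x + `|1 - sdist p rho x|) * 2^-1)).
  apply: contM; last by move=> x; exact: cst_continuous.
  have c1 : continuous (fun x => 1 - sdist p rho x).
    rewrite (_ : (fun x => _) = (fun x => 1 + -1 * sdist p rho x)).
      apply: contD; first by move=> x; exact: cst_continuous.
      by apply: contM; [move=> x; exact: cst_continuous|exact: continuous_sdist].
    by apply/funext => x; rewrite mulN1r.
  apply: contD => // x; exact: (cvg_norm (c1 x)).
apply/funext => x; case: leP => h; [rewrite ger0_norm//|rewrite ltr0_norm//]; by field.
Qed.

Lemma sobolev_tent (Om : set 'rV[R]_n) : open Om -> bounded_set Om ->
  sobolev1 Om (tent p rho) (grad_tent p rho).
Proof.
move=> oO bO; apply: weak_gradient_C1 => //.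
- by apply: contM; exact: continuous_max0.
- move=> i; have cc a : continuous (fun _ : 'rV[R]_n => a : R) by move=> x; exact: cst_continuous.
  apply: contM; first by apply: contM => //; exact: continuous_max0.
  apply: contM => //; apply: contM => //; apply: contD => // x; exact: coord_continuous.
move=> L; pose P := \sum_i `|p ord0 i|.
have P0 : 0 <= P by exact: sumr_ge0.
pose A := (2 * (`|L| + P) / rho ^+ 2) ^+ 2.
exists (2 * A + 2 * (rho ^+ 2)^-1 ^+ 2 + 2 * (rho ^+ 2)^-1).
  have r'0 : 0 <= (rho ^+ 2)^-1 by rewrite invr_ge0 ltW.
  have A0 : 0 <= A by exact: sqr_ge0.
  by apply: addr_ge0; [apply: addr_ge0|]; apply: mulr_ge0 => //; exact: sqr_ge0.
move=> i x h xL h1; rewrite /tent /grad_tent.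
set u := 1 - sdist p rho x; set v := 1 - sdist p rho (x + h *: e_ i).
set al := - 2 * (x ord0 i - p ord0 i) / rho ^+ 2.
have vu : v - u = al * h - h ^+ 2 * (rho ^+ 2)^-1.
  by rewrite /v /u sdist_shift /al; ring.
have u1 : Num.max 0 u <= 1 by rewrite ge_max ler01/= /u gerBl sdist_ge0.
have u0 : 0 <= Num.max 0 u by rewrite le_max lexx.
have alA : al ^+ 2 <= A.
  rewrite /A -[al ^+ 2]real_normK ?num_real// lerXn2r ?nnegrE//.
    by rewrite divr_ge0 ?(ltW r20)// mulr_ge0// addr_ge0.
  rewrite /al normrM [X in _ * X]gtr0_norm ?invr_gt0// ler_pM2r ?invr_gt0//.
  rewrite mulNr normrN normrM (ger0_norm (ler0n R 2)) ler_pM2l// (le_trans (ler_normB _ _))// lerD//.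
    by rewrite (le_trans (xL i))// ler_norm.
  by rewrite /P (bigD1 i)//= lerDl sumr_ge0.
have t := sqr_max0_taylor u v.
move: t vu u0 u1; set mu_ := Num.max 0 u; set mv := Num.max 0 v; set r := (rho ^+ 2)^-1.
have r0 : 0 <= r by rewrite invr_ge0 ltW.
have h2 : h ^+ 2 <= 1 by rewrite -real_normK ?num_real// expr_le1.
move=> t vu u0 u1.
have E : mv ^+ 2 - mu_ ^+ 2 - h * (2 * mu_ * al) =
   (mv ^+ 2 - mu_ ^+ 2 - 2 * mu_ * (v - u)) - 2 * mu_ * (h ^+ 2 * r) by rewrite vu; ring.
rewrite E (le_trans (ler_normB _ _))//.
have hr : 0 <= h ^+ 2 * r by rewrite mulr_ge0// sqr_ge0.
rewrite [X in _ + X]ger0_norm; last by rewrite mulr_ge0// mulr_ge0.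
have k1 : 2 * mu_ * (h ^+ 2 * r) <= 2 * (h ^+ 2 * r).
  by rewrite ler_wpM2r// ler_piMr.
have k2 : (v - u) ^+ 2 <= 2 * (al ^+ 2 * h ^+ 2) + 2 * (h ^+ 2 * r ^+ 2).
  rewrite vu; apply: (@le_trans _ _ (2 * (al * h) ^+ 2 + 2 * (h ^+ 2 * r) ^+ 2)).
    by have := sqr_ge0 (al * h + h ^+ 2 * r); nra.
  rewrite !exprMn lerD2l ler_pM2l// ler_wpM2r ?sqr_ge0//.
  by rewrite expr2 ler_piMl// sqr_ge0.
have k3 : al ^+ 2 * h ^+ 2 <= A * h ^+ 2 by rewrite ler_wpM2r// sqr_ge0.
rewrite (_ : (_ + _) * h ^+ 2 = 2 * (A * h ^+ 2) + 2 * (h ^+ 2 * r ^+ 2) + 2 * (h ^+ 2 * r)); last by ring.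
lra.
Qed.

Lemma sum_grad_tent x : \sum_i grad_tent p rho i x ^+ 2 =
  16 / rho ^+ 2 * (sdist p rho x * Num.max 0 (1 - sdist p rho x) ^+ 2).
Proof.
rewrite /grad_tent; set m := Num.max _ _.
transitivity (\sum_i (16 * m ^+ 2 / rho ^+ 2 ^+ 2) * ((x - p) ord0 i * (x - p) ord0 i)).
  by apply: eq_bigr => i _; rewrite !mxE; field; rewrite gt_eqF.
rewrite -mulr_sumr -/(dot (x - p) (x - p)) /sdist.
by field; rewrite gt_eqF.
Qed.

(** A change of variables: by convexity the contraction towards [p] maps [Om] into itself, and its
    Jacobian is th^n. *)
Lemma homothety_integral (Om : set 'rV[R]_n) (th : R) (f : 'rV[R]_n -> R) :
  measurable Om -> convex Om -> Om p -> 0 < th <= 1 ->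
  measurable_fun setT f -> (forall x, 0 <= f x) ->
  ((th ^+ n)%:E * \int[mu]_(x in Om) (f (th *: x + (1 - th) *: p))%:E <=
   \int[mu]_(x in Om) (f x)%:E)%E.
Proof.
move=> mO cO Op /andP[th0 th1] mf f0.
pose F x := (f x * \1_Om x)%:E.
have mF : measurable_fun setT F.
  by apply/measurable_EFinP; apply: measurable_funM => //; exact: measurable_indic.
have F0 x : (0 <= F x)%E by rewrite lee_fin mulr_ge0// indicE.
have := @ge0_integral_affine R n th ((1 - th) *: p) F (lt0r_neq0 th0) mF F0.
rewrite (gtr0_norm th0) => E.
have EF : (\int[mu]_x F x = \int[mu]_(x in Om) (f x)%:E)%E.
  rewrite [RHS]integral_mkcond; apply: eq_integral => x _.
  by rewrite patchE /F indicE; case: ifP => _; rewrite ?mulr1 ?mulr0.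
have tn : 0 < th ^+ n by rewrite exprn_gt0.
have -> : (\int[mu]_(x in Om) (f x)%:E =
    (th ^+ n)%:E * \int[mu]_x F (th *: x + (1 - th) *: p)%R)%E.
  by rewrite E muleA -EFinM mulfV ?gt_eqF// mul1e.
apply: lee_wpmul2l; first by rewrite lee_fin ltW.
rewrite integral_mkcond; apply: ge0_le_integral => //.
- by move=> x _; rewrite patchE; case: ifP => // _; rewrite lee_fin.
- apply/(measurable_restrictT _ mO)/measurable_funTS/measurable_EFinP.
  exact: (measurableT_comp mf (measurable_row_affine _ _)).
- exact: (measurableT_comp mF (measurable_row_affine _ _)).
- move=> x _; rewrite patchE; case: ifPn => [/set_mem Ox|_]; last exact: F0.
  rewrite /F indicE mem_set ?mulr1//; apply: cO => //.
  by rewrite (ltW th0).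
Qed.

(** [Om] may cut the ball in an arbitrary convex shape, so the two integrals are compared through a
    contraction towards [p]. By Bernoulli the ratio 1 - 1/(2n) costs at most a factor 2 in volume,
    and it moves the points of the support to where the tent is not small. In all, 16 from the
    gradient, 2 from the volume and 4 n^2 from the pointwise comparison make 128 n^2. *)
Lemma tent_rayleigh (Om : set 'rV[R]_n) : (0 < n)%N -> open Om -> bounded_set Om -> convex Om -> Om p ->
  \int[mu]_(x in Om) (\sum_i grad_tent p rho i x ^+ 2) <=
  128 * n%:R ^+ 2 / rho ^+ 2 * \int[mu]_(x in Om) (tent p rho x ^+ 2).
Proof.
move=> n0 oO bO cO Op; have mO : measurable Om by exact: open_measurable_row.
have [L L0 OL] := bounded_set_cube bO.
have csqi u : continuous u -> mu.-integrable Om (EFin \o u).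
  move=> cu; have [B fB] := continuous_bounded_cube (ltW L0) cu.
  apply: (integrable_bounded mO (B := B)).
  - exact: bounded_lebesgue_row_lty.
  - by apply: measurable_funTS; exact: continuous_measurable_row.
  - by move=> x /OL; exact: fB.
pose m x := Num.max 0 (1 - sdist p rho x).
have cm : continuous m by exact: continuous_max0.
have ct : continuous (tent p rho) by apply: contM.
have ct2 : continuous (fun x => tent p rho x ^+ 2) by apply: contM.
pose x0 : R := (2 * n%:R)^-1; pose th := 1 - x0.
have nR : 1 <= n%:R :> R by rewrite ler1n.
have x00 : 0 < x0 by rewrite invr_gt0 mulr_gt0// ltr0n.
have nx : n%:R * x0 = 2^-1 by rewrite /x0; field; rewrite pnatr_eq0 -lt0n.
have x01 : x0 <= 2^-1 by rewrite -nx ler_peMl// ltW.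
have th01 : 0 < th <= 1 by rewrite /th; apply/andP; split; lra.
have thn : 2^-1 <= th ^+ n.
  by apply: le_trans (bernoulli_ge n _); [rewrite nx; lra|apply/andP; split; lra].
(* On the support s < 1, and the contracted point has positive part [a = 1 - th^2 s], at least both
   [x0] and 1 - s. One factor a^2 pays for [x0 ^+ 2], the other for the squared positive part. *)
have key x : x0 ^+ 2 * (sdist p rho x * m x ^+ 2) <= tent p rho (th *: x + (1 - th) *: p) ^+ 2.
  have sE : sdist p rho (th *: x + (1 - th) *: p) = th ^+ 2 * sdist p rho x.
    rewrite /sdist (_ : th *: x + (1 - th) *: p - p = th *: (x - p)).
      by rewrite dotZl dotZr !mulrA expr2.
    by apply/rowP => i; rewrite !mxE; ring.
  rewrite /tent sE /m; set s := sdist p rho x.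
  have s0 : 0 <= s by exact: sdist_ge0.
  have [s1|s1] := leP (1 - s) 0; first by rewrite expr0n !mulr0 sqr_ge0.
  have t2 : th ^+ 2 <= 1 - x0 by rewrite /th expr2; move: th01; rewrite /th; nra.
  have t20 : 0 <= th ^+ 2 by exact: sqr_ge0.
  have a1 : 1 - s <= 1 - th ^+ 2 * s by rewrite lerD2l lerN2 ler_piMl//; lra.
  have a2 : x0 <= 1 - th ^+ 2 * s by nra.
  rewrite (max_idPr _); last lra.
  set a := 1 - th ^+ 2 * s in a1 a2 *.
  have b1 : x0 ^+ 2 <= a ^+ 2 by rewrite lerXn2r ?nnegrE ?(ltW x00)//; lra.
  have b2 : (1 - s) ^+ 2 <= a ^+ 2 by rewrite lerXn2r ?nnegrE ?(ltW s1)//; lra.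
  rewrite [leRHS]expr2; apply: ler_pM; rewrite ?sqr_ge0//.
    by rewrite mulr_ge0// sqr_ge0.
  by rewrite (le_trans _ b2)// ler_piMl ?sqr_ge0//; lra.
have h := homothety_integral mO cO Op th01 (continuous_measurable_row ct2) (fun x => sqr_ge0 _).
have cS : continuous (fun x => sdist p rho x * m x ^+ 2).
  apply: contM; [exact: continuous_sdist|exact: contM].
have iS := csqi _ cS; have i4 := csqi _ ct2.
have main : 2^-1 * (x0 ^+ 2 * \int[mu]_(x in Om) (sdist p rho x * m x ^+ 2)) <=
    \int[mu]_(x in Om) (tent p rho x ^+ 2).
  rewrite -RintegralZl// -lee_fin EFinM.
  have fE (u : 'rV[R]_n -> R) : mu.-integrable Om (EFin \o u) ->
      (\int[mu]_(x in Om) u x)%:E = (\int[mu]_(x in Om) (u x)%:E)%E.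
    by move=> iu; rewrite /Rintegral fineK// (integrable_fin_num mO iu).
  rewrite !fE//; last exact: RintegrableZl.
  apply: le_trans h; apply: lee_pmul.
  - by rewrite lee_fin invr_ge0.
  - apply: integral_ge0 => x _; rewrite lee_fin mulr_ge0 ?sqr_ge0// mulr_ge0 ?sqr_ge0//.
    exact: sdist_ge0.
  - by rewrite lee_fin.
  - apply: ge0_le_integral => //.
    + move=> x _; rewrite lee_fin mulr_ge0 ?sqr_ge0// mulr_ge0 ?sqr_ge0//; exact: sdist_ge0.
    + apply: measurable_funTS; apply/measurable_EFinP; apply: measurable_funM => //.
      exact: continuous_measurable_row.
    + apply: measurable_funTS; apply/measurable_EFinP.
      exact: (measurableT_comp (continuous_measurable_row ct2) (measurable_row_affine _ _)).
    + by move=> x _; rewrite lee_fin.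
under eq_Rintegral do rewrite sum_grad_tent.
rewrite RintegralZl//.
rewrite [leRHS](_ : _ = 16 / rho ^+ 2 * (8 * n%:R ^+ 2 * \int[mu]_(x in Om) (tent p rho x ^+ 2))); last by ring.
rewrite ler_pM2l ?divr_gt0//.
have n2 : 0 < 8 * n%:R ^+ 2 :> R by rewrite mulr_gt0// exprn_gt0// ltr0n.
rewrite -ler_pdivrMl//; have -> : (8 * n%:R ^+ 2)^-1 = 2^-1 * x0 ^+ 2.
  by rewrite /x0; field; rewrite pnatr_eq0 -lt0n.
by rewrite -mulrA.
Qed.

Lemma tent_gt0 (Om : set 'rV[R]_n) : open Om -> bounded_set Om -> Om p ->
  0 < \int[mu]_(x in Om) (tent p rho x ^+ 2).
Proof.
move=> oO bO Op; have mO : measurable Om by exact: open_measurable_row.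
have [st _ _] := sobolev_tent oO bO.
rewrite lt_neqAle eq_sym; apply/andP; split; last first.
  by apply: Rintegral_ge0 => x _; exact: sqr_ge0.
apply/negP => /eqP /(sqi_ae0 mO st) [N [mN N0 sub]].
have ct : continuous (fun x => Num.max 0 (1 - sdist p rho x)) by exact: continuous_max0.
pose U := Om `&` [set x | 0 < Num.max 0 (1 - sdist p rho x)].
have oU : open U.
  apply: openI => //.
  by apply: (open_comp _ (@open_gt R 0)) => x _; exact: ct.
have Up : U p.
  split => //=; rewrite /sdist subrr (_ : dot 0 0 = 0) ?mul0r ?subr0 ?lt_max ?ltr01 ?orbT//.
  by rewrite /dot big1// => i _; rewrite mxE mul0r.
have := open_lebesgue_row_gt0 oU (ex_intro _ _ Up); rewrite ltNge => /negP; apply.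
rewrite -N0; apply: le_measure; rewrite ?inE//; first exact: open_measurable_row.
move=> x [Ox /= xp]; apply: sub => /= /(_ Ox) /eqP; rewrite sqrf_eq0 => /eqP x0.
by move: xp; rewrite x0 ltxx.
Qed.

End one.

Lemma tent_disjoint p q rho x : 0 < rho -> (2 * rho) ^+ 2 <= dot (p - q) (p - q) ->
  1 - sdist p rho x <= 0 \/ 1 - sdist q rho x <= 0.
Proof.
move=> rho0 pq; have r20 : 0 < rho ^+ 2 by exact: exprn_gt0.
have [|h1] := leP (1 - sdist p rho x) 0; first by left.
have [|h2] := leP (1 - sdist q rho x) 0; first by right.
move: h1 h2; rewrite !subr_gt0 !ltr_pdivrMr// mul1r => h1 h2.
have : dot (p - q) (p - q) <= 2 * dot (x - p) (x - p) + 2 * dot (x - q) (x - q).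
  rewrite /dot !mulr_sumr -big_split/=; apply: ler_sum => i _; rewrite !mxE.
  by have := sqr_ge0 (2 * x ord0 i - p ord0 i - q ord0 i); nra.
by rewrite exprMn in pq; lra.
Qed.

(** Tents of radius r/2 have disjoint supports, so they are orthogonal for both forms and the bound
    for one tent holds on their whole span; 512 is 128 * 4. *)
Lemma neumann_eigenvalue_le_separated (Om : set 'rV[R]_n) (k : nat) (q : 'I_k.+1 -> 'rV[R]_n) (r : R) :
  (0 < n)%N -> open Om -> bounded_set Om -> convex Om -> 0 < r -> (forall i, Om (q i)) ->
  (forall i j, i != j -> r ^+ 2 <= dot (q i - q j) (q i - q j)) ->
  (neumann_eigenvalue Om k <= (512 * n%:R ^+ 2 / r ^+ 2)%:E)%E.
Proof.
move=> n0 oO bO cO r0 Oq sep; pose rho := r / 2.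
have rho0 : 0 < rho by rewrite divr_gt0.
have mO : measurable Om by exact: open_measurable_row.
pose w i := tent (q i) rho; pose g i := grad_tent (q i) rho.
have sw i : sobolev1 Om (w i) (g i) by exact: sobolev_tent.
have dis i j x : i != j -> 1 - sdist (q i) rho x <= 0 \/ 1 - sdist (q j) rho x <= 0.
  by move=> ij; apply: tent_disjoint => //; rewrite mulrC divfK// sep.
have iw i : mu.-integrable Om (EFin \o (fun x => w i x ^+ 2)).
  by apply: sqi_integrable => //; case: (sw i).
have ig i : mu.-integrable Om (EFin \o (fun x => \sum_j g i j x ^+ 2)).
  rewrite (_ : EFin \o _ = (fun x => \sum_j (g i j x ^+ 2)%:E)%E); last first.
    by apply/funext => x /=; rewrite sumEFin.
  by apply: integrable_sum => // j _; apply: sqi_integrable => //; case: (sw i).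
have Ew (c : 'I_k.+1 -> R) : \int[mu]_(x in Om) ((\sum_i c i * w i x) ^+ 2) =
    \sum_i c i ^+ 2 * \int[mu]_(x in Om) (w i x ^+ 2).
  transitivity (\int[mu]_(x in Om) (\sum_i c i ^+ 2 * w i x ^+ 2)).
    apply: eq_Rintegral => x _; rewrite sqr_sum_disjoint; first by apply: eq_bigr => i _; rewrite exprMn.
    by move=> i j /(dis _ _ x)[h|h]; rewrite /w /tent (max_idPl h) expr0n ?mulr0 ?mul0r// mulr0.
  rewrite Rintegral_sum//; last by move=> i; exact: RintegrableZl.
  by apply: eq_bigr => i _; rewrite RintegralZl.
have Eg (c : 'I_k.+1 -> R) : \int[mu]_(x in Om) (\sum_j (\sum_i c i * g i j x) ^+ 2) =
    \sum_i c i ^+ 2 * \int[mu]_(x in Om) (\sum_j g i j x ^+ 2).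
  transitivity (\int[mu]_(x in Om) (\sum_i c i ^+ 2 * \sum_j g i j x ^+ 2)).
    apply: eq_Rintegral => x _.
    under [RHS]eq_bigr do rewrite mulr_sumr.
    rewrite exchange_big/=; apply: eq_bigr => j _.
    rewrite sqr_sum_disjoint; first by apply: eq_bigr => i _; rewrite exprMn.
    by move=> i i' /(dis _ _ x)[h|h]; rewrite /g /grad_tent (max_idPl h) !(mulr0, mul0r).
  rewrite Rintegral_sum//; last by move=> i; exact: RintegrableZl.
  by apply: eq_bigr => i _; rewrite RintegralZl.
apply: (neumann_eigenvalue_le oO bO cO sw).
- move=> c; rewrite Ew Eg mulr_sumr; apply: ler_sum => i _.
  rewrite mulrCA ler_wpM2l ?sqr_ge0//.
  rewrite (le_trans (tent_rayleigh rho0 n0 oO bO cO (Oq i)))//.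
  by rewrite le_eqVlt; apply/orP; left; apply/eqP; rewrite /rho; field; rewrite gt_eqF.
- move=> c; rewrite Ew => c0 i.
  have pos j : 0 <= c j ^+ 2 * \int[mu]_(x in Om) (w j x ^+ 2).
    by rewrite mulr_ge0 ?sqr_ge0// ltW// tent_gt0.
  move: (psumr_eq0P (fun j _ => pos j) c0) => /(_ i isT) /eqP.
  by rewrite mulf_eq0 sqrf_eq0 (gt_eqF (tent_gt0 rho0 oO bO (Oq i))) orbF => /eqP.
Qed.

End tent.

(** * Separated sets and homotheties *)

Section separated.
Context (R : realType) (n : nat).
Implicit Types (Om : set 'rV[R]_n) (x y z : 'rV[R]_n).

Local Notation dd x y := (dot (x - y) (x - y)).

Lemma sqdist_triangle x y z : dd x z <= 2 * dd x y + 2 * dd y z.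
Proof.
rewrite /dot !mulr_sumr -big_split/=; apply: ler_sum => i _; rewrite !mxE.
by have := sqr_ge0 (x ord0 i - 2 * y ord0 i + z ord0 i); nra.
Qed.

Lemma sqdistC x y : dd x y = dd y x.
Proof. by rewrite -(opprB y x) dotNl dotNr opprK. Qed.

(** The points form a sequence of which only the first [m] count, so that points can be appended
    without changing type. *)
Definition has_separated Om m (r : R) := exists q : nat -> 'rV[R]_n,
  (forall i, (i < m)%N -> Om (q i)) /\
  (forall i j, (i < j)%N -> (j < m)%N -> r ^+ 2 <= dd (q i) (q j)).

Lemma has_separatedS Om m (r : R) q x : (forall i, (i < m)%N -> Om (q i)) ->
  (forall i j, (i < j)%N -> (j < m)%N -> r ^+ 2 <= dd (q i) (q j)) ->
  Om x -> (forall i, (i < m)%N -> r ^+ 2 <= dd (q i) x) ->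
  exists2 q' : nat -> 'rV[R]_n, (forall i, (i < m)%N -> q' i = q i) /\ q' m = x &
  (forall i, (i < m.+1)%N -> Om (q' i)) /\
  (forall i j, (i < j)%N -> (j < m.+1)%N -> r ^+ 2 <= dd (q' i) (q' j)).
Proof.
move=> Oq sq Ox sx; exists (fun i => if (i < m)%N then q i else x).
  by split => [i ->|]//; rewrite ltnn.
split => [i _|i j ij jm]; first by case: ifPn => // /Oq.
have im : (i < m)%N by exact: leq_trans ij jm.
rewrite im; case: ifPn => jm'; first exact: sq.
exact: sx.
Qed.

(** The new points lie on the segment from [q 0] to [q 1], at distances 2r and 4r from [q 0]. The
    other points are at distance at least 8r from [q 0], hence at least 4r from the new ones. *)
Lemma has_separated_add2 Om m (r : R) : convex Om -> (2 <= m)%N -> 0 < r ->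
  has_separated Om m (8 * r) -> has_separated Om m.+2 (2 * r).
Proof.
move=> cO m2 r0 [q [Oq sq]].
have m0 : (0 < m)%N by exact: leq_trans m2.
pose D := dd (q 0%N) (q 1%N); have D64 : (8 * r) ^+ 2 <= D by exact: sq.
pose d := Num.sqrt D.
have D0 : 0 < D by apply: lt_le_trans D64; rewrite exprn_gt0// mulr_gt0.
have d2 : d ^+ 2 = D by rewrite sqr_sqrtr// ltW.
have d0 : 0 < d by rewrite sqrtr_gt0.
have d8 : 8 * r <= d by rewrite -(@ler_pXn2r _ 2) ?nnegrE ?(ltW d0) ?mulr_ge0 ?(ltW r0)// d2.
pose pt (s : R) := (1 - s) *: q 0%N + (1 - (1 - s)) *: q 1%N.
have Opt s : 0 <= s <= 1 -> Om (pt s).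
  move=> /andP[s0 s1]; apply: cO; [|exact: Oq|exact: Oq].
  by rewrite subr_ge0 s1 gerBl.
have ptE s s' : dd (pt s) (pt s') = (s - s') ^+ 2 * D.
  rewrite (_ : pt s - pt s' = (s' - s) *: (q 0%N - q 1%N)).
    by rewrite dotZl dotZr /D mulrA -expr2; congr (_ * _); ring.
  by apply/rowP => i; rewrite /pt !mxE; ring.
have pt0 : pt 0 = q 0%N by rewrite /pt !subr0 subrr scale1r scale0r addr0.
pose s := 2 * r / d.
have sd : s ^+ 2 * D = 4 * r ^+ 2 by rewrite /s -d2; field; rewrite gt_eqF.
have s0 : 0 <= s by rewrite divr_ge0 ?mulr_ge0 ?(ltW r0) ?(ltW d0).
have s4 : 4 * s <= 1.
  by rewrite /s mulrA ler_pdivrMr// mul1r; apply: le_trans d8; lra.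
have E4 : (2 * r) ^+ 2 = 4 * r ^+ 2 by ring.
have E8 : (8 * r) ^+ 2 = 64 * r ^+ 2 by ring.
have far t i : (i < m)%N -> 0 <= t <= 2 -> (0 < t * s) -> 4 * r ^+ 2 <= t ^+ 2 * (4 * r ^+ 2) ->
    (2 * r) ^+ 2 <= dd (q i) (pt (t * s)).
  move=> im /andP[t0 t2] ts0 t4; rewrite E4.
  case: i im => [_|i im].
    by rewrite -pt0 ptE sub0r sqrrN exprMn -mulrA sd.
  have h1 : 64 * r ^+ 2 <= dd (q 0%N) (q i.+1) by rewrite -E8; exact: sq.
  have h2 := sqdist_triangle (q 0%N) (pt (t * s)) (q i.+1).
  have h3 : dd (q 0%N) (pt (t * s)) <= 16 * r ^+ 2.
    rewrite -pt0 ptE sub0r sqrrN exprMn -mulrA sd.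
    have : t ^+ 2 <= 4 by nra.
    by have := sqr_ge0 r; nra.
  move: h1 h2 h3; rewrite (sqdistC (pt (t * s)) (q i.+1)); have := sqr_ge0 r; lra.
have sp : 0 < s by rewrite divr_gt0// mulr_gt0.
have r2 := sqr_ge0 r.
have sq2 i j : (i < j)%N -> (j < m)%N -> (2 * r) ^+ 2 <= dd (q i) (q j).
  move=> ij jm; apply: le_trans (sq i j ij jm).
  by rewrite E4 E8; lra.
have [|i im|q' [q'E q'm] [Oq' sq']] := @has_separatedS Om m (2 * r) q (pt (1 * s)) Oq sq2.
- by apply: Opt; rewrite mul1r s0/=; lra.
- by apply: far => //; [apply/andP; split; lra|rewrite mul1r|rewrite expr1n mul1r].
have [|i im|q'' _ [Oq'' sq'']] := @has_separatedS Om m.+1 (2 * r) q' (pt (2 * s)) Oq' sq'.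
- by apply: Opt; apply/andP; split; lra.
- have [im'|im'] := ltnP i m.
    rewrite q'E//; apply: far => //; [apply/andP; split; lra|lra|lra].
  have -> : i = m by apply/eqP; rewrite eqn_leq im' andbT -ltnS.
  rewrite q'm ptE (_ : (1 * s - 2 * s) = - s); last by ring.
  by rewrite sqrrN sd E4.
by exists q''.
Qed.

Lemma has_separated_small Om m : (0 < n)%N -> open Om -> Om !=set0 ->
  exists2 r : R, 0 < r & has_separated Om m r.
Proof.
move=> n0 oO [x Ox]; have /nbhs_ballP[e /= e0 eO] := open_nbhs_nbhs (conj oO Ox).
pose r := e / m.+1%:R; have r0 : 0 < r by rewrite divr_gt0.
exists r => //; exists (fun i => x + (i%:R * r) *: const_mx 1); split.
  move=> i im; apply: eO; split => // a b; rewrite (ord1 a) /ball/= !mxE opprD addrA subrr sub0r normrN mulr1.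
  rewrite ger0_norm; last by rewrite mulr_ge0// ltW.
  rewrite /r mulrA ltr_pdivrMr// mulrC ltr_pM2l//.
  by rewrite ltr_nat (leq_trans im).
move=> i j ij jm.
rewrite (_ : _ - _ = ((i%:R - j%:R) * r) *: const_mx 1); last by apply/rowP => a; rewrite !mxE; ring.
rewrite dotZl dotZr mulrA -expr2 [X in _ <= X * _]exprMn.
have h1 : 1 <= (i%:R - j%:R) ^+ 2 :> R.
  rewrite -[leRHS]sqrrN opprB -natrB ?(ltnW ij)// -natrX ler1n expn_gt0 subn_gt0 ij//.
have h2 : 1 <= dot (const_mx 1 : 'rV[R]_n) (const_mx 1).
  rewrite /dot; under eq_bigr do rewrite !mxE mulr1.
  by rewrite sumr_const card_ord ler1n.
apply: (@le_trans _ _ ((i%:R - j%:R) ^+ 2 * r ^+ 2)); first by rewrite ler_peMl ?sqr_ge0.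
by rewrite ler_peMr// mulr_ge0// sqr_ge0.
Qed.

Lemma has_separated_bounded Om : bounded_set Om ->
  exists D : R, forall r, 0 < r -> has_separated Om 2 r -> r ^+ 2 <= D.
Proof.
move=> /bounded_set_cube[L L0 OL]; exists (n%:R * (2 * L) ^+ 2) => r r0 [q [Oq /(_ 0%N 1%N isT isT) /le_trans]].
apply; rewrite mulr_natl -[in leRHS](card_ord n) -sumr_const; apply: ler_sum => i _.
rewrite -expr2 !mxE -[leLHS]real_normK ?num_real// lerXn2r ?nnegrE//.
  by rewrite mulr_ge0// ltW.
by rewrite (le_trans (ler_normB _ _))// mulr2n mulrDl mul1r lerD//; apply: OL; apply: Oq.
Qed.

Lemma has_separatedW Om m m' (r : R) : (m' <= m)%N -> has_separated Om m r -> has_separated Om m' r.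
Proof.
move=> mm [q [Oq sq]]; exists q; split => [i im|i j ij jm]; first by apply: Oq; exact: leq_trans mm.
by apply: sq => //; exact: leq_trans mm.
Qed.

(** A separated family that cannot be extended is a net: a point far from all its members could be
    appended. *)
Lemma cover_of_not_separated Om m (r : R) : ~ has_separated Om m.+1 r ->
  exists (m' : nat) (p : 'I_m' -> 'rV[R]_n), [/\ (m' <= m)%N, forall i, Om (p i) &
    forall x, Om x -> exists i, dd x (p i) <= r ^+ 2].
Proof.
elim: m => [|m IH] nS.
  exists 0%N, (fun=> 0); split => //; first by case.
  move=> x Ox; exfalso; apply: nS; exists (fun=> x); split => // i j ij.
  by rewrite ltnS leqn0 => /eqP j0; move: ij; rewrite j0.
have [S|/IH[m' [p [mm Op Hp]]]] := pselect (has_separated Om m.+1 r); last first.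
  by exists m', p; split => //; exact: leqW.
have [q [Oq sq]] := S.
exists m.+1, (fun i => q i); split => // [i|x Ox]; first exact: Oq.
apply: contrapT => /forallNP H; apply: nS.
have [i im|q' _ H'] := @has_separatedS Om m.+1 r q x Oq sq Ox.
  by have := H (Ordinal im); rewrite sqdistC => /negP; rewrite -ltNge => /ltW.
by exists q'.
Qed.

(** Starting from a small radius that works, double it until separation fails; boundedness forces
    this to happen. *)
Lemma exists_radius Om k : (0 < n)%N -> (3 <= k)%N -> open Om -> Om !=set0 -> bounded_set Om ->
  convex Om -> exists2 r : R, 0 < r &
  (exists q : 'I_k.+1 -> 'rV[R]_n, (forall i, Om (q i)) /\
    forall i j, i != j -> r ^+ 2 <= dd (q i) (q j)) /\
  exists (m : nat) (p : 'I_m -> 'rV[R]_n), [/\ (m <= k - 2)%N, forall i, Om (p i) &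
    forall x, Om x -> exists i, dd x (p i) <= (8 * r) ^+ 2].
Proof.
move=> n0 k3 oO nO bO cO.
have [r0 r00 S0] := @has_separated_small Om k.+1 n0 oO nO.
have [D DP] := has_separated_bounded bO.
pose P j := `[< has_separated Om k.+1 (2 ^+ j * r0) >].
have [j Pj nPj] : exists2 j, P j & ~~ P j.+1.
  apply: contrapT => /forallPNP H.
  have allP j : P j.
    elim: j => [|j IH]; first by apply/asboolP; rewrite expr0 mul1r.
    by have := H j IH => /negP; rewrite negbK.
  have bnd j : (2 ^+ j * r0) ^+ 2 <= D.
    apply: DP; first by rewrite mulr_gt0// exprn_gt0.
    have /asboolP := allP j; apply: has_separatedW.
    by rewrite ltnS; exact: leq_trans k3.
  have r20 : 0 < r0 ^+ 2 by rewrite exprn_gt0.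
  have D0 : 0 <= D / r0 ^+ 2 by rewrite divr_ge0 ?(ltW r20)// (le_trans _ (bnd 0%N))// sqr_ge0.
  pose j := (Num.truncn (D / r0 ^+ 2)).+1.
  have /andP[_ jD] := truncn_itv D0; rewrite -/j in jD.
  have := bnd j; rewrite exprMn -ler_pdivlMr// leNgt => /negP; apply.
  apply: (lt_le_trans jD); apply: (@le_trans _ _ (2 ^+ j)).
    by rewrite -natrX ler_nat ltnW// ltn_expl.
  by rewrite expr2 ler_peMl ?exprn_ge0// exprn_ege1// ler1n.
pose r := 2 ^+ j * r0; have r'0 : 0 < r by rewrite mulr_gt0// exprn_gt0.
exists r => //; split.
  have /asboolP[q [Oq sq]] := Pj.
  exists (fun i => q i); split => [i|i i' ii']; first exact: Oq.
  have [l|l|/val_inj l] := ltngtP i i'; [exact: sq|rewrite sqdistC; exact: sq|].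
  by rewrite l eqxx in ii'.
(* k - 1 points at mutual distances 8r would give k + 1 points at distances 2r. The hypothesis 3 <=
   k supplies the two points between which the others are inserted. *)
have : ~ has_separated Om (k - 2).+1 (8 * r).
  move=> S; move/asboolP: nPj; apply.
  have := has_separated_add2 cO _ r'0 S; rewrite exprS -mulrA.
  have -> : ((k - 2).+3 = k.+1)%N by rewrite -addn3 -(addn1 k) -{2}(subnK (ltnW k3)) -addnA.
  by apply; rewrite ltnS subn_gt0.
by move/cover_of_not_separated.
Qed.

End separated.

Section homothety.
Context (R : realType) (n : nat).
Local Notation mu := (lebesgue_row R n).

(* If [y] in [Om] were outside the homothetic image, the sets [s_j y + (1 - s_j) S],
   [s_j = j / (2 n N)], [j < N], would be disjoint subsets of [Om], each of volume
   at least half that of [S], and [N] is larger than [2 / w]. *)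
Lemma sub_homothety (S Om : set 'rV[R]_n) (x0 : 'rV[R]_n) (w : R) : (0 < n)%N ->
  measurable S -> convex S -> (forall x, S x -> S (2 *: x0 - x)) -> S !=set0 -> S `<=` Om ->
  measurable Om -> convex Om -> 0 < w -> (0 < mu Om < +oo)%E ->
  (w%:E * mu Om <= mu S)%E ->
  exists2 T : R, 0 < T <= 12 * n%:R / w & forall y, Om y -> exists2 z, S z & y = x0 + T *: (z - x0).
Proof.
move=> n0 mS cS sS [z0 Sz0] SOm mOm cOm w0 /andP[Om0 Omoo] wS.
have Sx0 : S x0.
  rewrite (_ : x0 = 2^-1 *: z0 + (1 - 2^-1) *: (2 *: x0 - z0)).
    by apply: cS => //; [apply/andP; split; lra|exact: sS].
  by apply/rowP => i; rewrite !mxE; field.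
have SOmle : (mu S <= mu Om)%E by apply: le_measure; rewrite ?inE.
have Omf : mu Om \is a fin_num by rewrite ge0_fin_numE.
have Soo : (mu S < +oo)%E by exact: le_lt_trans Omoo.
have Sf : mu S \is a fin_num by rewrite ge0_fin_numE.
pose v := fine (mu Om); pose vS := fine (mu S).
have v0 : 0 < v by rewrite fine_gt0// Om0.
have wv : w * v <= vS by rewrite -lee_fin EFinM !fineK.
have vSv : vS <= v by rewrite -lee_fin !fineK.
have vS0 : 0 < vS by apply: lt_le_trans wv; rewrite mulr_gt0.
have w1 : w <= 1 by rewrite -(ler_pM2r v0) mul1r (le_trans wv).
pose N := (Num.truncn (2 / w)).+1.
have w20 : 0 <= 2 / w by rewrite divr_ge0// ltW.
have /andP[N1 N2] := truncn_itv w20; rewrite -/N in N2.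
have N3 : N%:R <= 3 / w.
  rewrite /N -natr1; have : 1 <= w^-1 by rewrite invf_ge1.
  by move: N1; rewrite (_ : 3 / w = 2 / w + w^-1); [lra|field; rewrite gt_eqF].
have N0 : 0 < N%:R :> R by rewrite ltr0n.
have nR0 : 0 < n%:R :> R by rewrite ltr0n.
(* The factor 1/(s j - s i) met below is at most 2 n N, and [T] is twice that. With N <= 3 / w this
   gives 12 n / w. *)
pose T := 4 * n%:R * N%:R : R.
have T0 : 0 < T by rewrite !mulr_gt0.
exists T.
  rewrite T0/= /T (_ : 12 * n%:R / w = 4 * n%:R * (3 / w)); last by ring.
  by rewrite ler_pM2l// mulr_gt0.
move=> y Oy; apply: contrapT => nT.
pose s (j : nat) : R := j%:R / (2 * n%:R * N%:R).
have q0 : 0 < 2 * n%:R * N%:R :> R by rewrite !mulr_gt0.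
have s0 j : 0 <= s j by rewrite divr_ge0// ltW.
have sn j : (j < N)%N -> n%:R * s j <= 2^-1.
  move=> jN; rewrite /s mulrA ler_pdivrMr// (_ : 2^-1 * _ = n%:R * N%:R); last by field.
  by rewrite ler_pM2l// ler_nat ltnW.
have s1 j : (j < N)%N -> s j <= 2^-1.
  by move=> jN; apply: le_trans (sn j jN); rewrite ler_peMl// ler1n.
have s1V j : (j < N)%N -> 0 < 1 - s j.
  by move=> jN; rewrite subr_gt0 (le_lt_trans (s1 j jN))// invf_lt1// ltr1n.
have s01 j : (j < N)%N -> 0 <= s j <= 1.
  by move=> jN; rewrite s0 -subr_ge0 ltW// s1V.
pose C j := [set z | S ((1 - s j)^-1 *: z + (- (s j / (1 - s j))) *: y)].
have CE j z : (j < N)%N -> C j z -> exists2 a, S a & z = s j *: y + (1 - s j) *: a.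
  move=> jN Cz; eexists; first exact: Cz.
  apply/rowP => i; rewrite !mxE; field.
  by rewrite gt_eqF// s1V.
have mC j : measurable (C j).
  by have := measurable_row_affine (1 - s j)^-1 ((- (s j / (1 - s j))) *: y) measurableT mS; rewrite setTI.
have COm j : (j < N)%N -> C j `<=` Om.
  move=> jN z /(CE _ _ jN)[a Sa ->]; apply: cOm => //; first exact: s01.
  exact: SOm.
have muC j : (j < N)%N -> ((2^-1)%:E * mu S <= mu (C j))%E.
  move=> jN; have h := s1V j jN.
  rewrite (@lebesgue_row_affine R n)//; last by rewrite invr_eq0 gt_eqF.
  rewrite lee_wpmul2r// lee_fin normfV exprVn invrK (gtr0_norm h).
  apply: (le_trans _ (bernoulli_ge n _)).
    by have := sn j jN; lra.
  exact: s01.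
(* A common point of two copies writes [y] as al ((1 - s i) a - (1 - s j) b). Central symmetry
   replaces -b by the mirror image [a'] of [b], so the point x0 + (y - x0) / T becomes a convex
   combination of [a], [a'] and [x0], hence lies in [S]. *)
have Cdis i j z : (i < j)%N -> (j < N)%N -> C i z -> C j z -> False.
  move=> ij jN Ci Cj; have iN := ltn_trans ij jN.
  have [a Sa za] := CE _ _ iN Ci; have [b Sb zb] := CE _ _ jN Cj.
  apply: nT.
  have ss : 0 < s j - s i by rewrite /s -mulrBl divr_gt0// subr_gt0 ltr_nat.
  pose al := (s j - s i)^-1.
  have al0 : 0 < al by rewrite invr_gt0.
  have alT : 2 * al <= T.
    rewrite /al ler_pdivrMr// /s -mulrBl /T.
    rewrite (_ : 4 * n%:R * N%:R * ((j%:R - i%:R) / (2 * n%:R * N%:R)) = 2 * (j%:R - i%:R)); last first.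
      by field; rewrite !gt_eqF.
    by rewrite -[leLHS]mulr1 ler_pM2l// -natrB ?(ltnW ij)// ler1n subn_gt0.
  pose la := (1 - s i) * al / T; pose lb := (1 - s j) * al / T.
  pose a' := 2 *: x0 - b.
  have Sa' : S a' by exact: sS.
  have la0 : 0 <= la by rewrite divr_ge0 ?(ltW T0)// mulr_ge0 ?(ltW al0) ?(ltW (s1V i iN)).
  have lb0 : 0 <= lb by rewrite divr_ge0 ?(ltW T0)// mulr_ge0 ?(ltW al0) ?(ltW (s1V j jN)).
  have lab : la + lb <= 1.
    rewrite /la /lb -mulrDl ler_pdivrMr// mul1r -mulrDl (le_trans _ alT)// ler_pM2r//.
    by rewrite [leRHS](_ : 2 = 1 + 1)// lerD// gerBl s0.
  have yE : y = al *: ((1 - s i) *: a - (1 - s j) *: b).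
    have E : (s j - s i) *: y = (1 - s i) *: a - (1 - s j) *: b.
      apply/rowP => k; have := congr1 (fun M : 'rV[R]_n => M ord0 k) (etrans (esym za) zb).
      by rewrite !mxE; lra.
    by rewrite -E scalerA mulVf ?gt_eqF// scale1r.
  exists (x0 + T^-1 *: (y - x0)); last first.
    by rewrite addrAC subrr add0r scalerA divff ?gt_eqF// scale1r addrC subrK.
  have lT : la - lb = T^-1.
    rewrite /la /lb -mulrBl -mulrBl (_ : 1 - s i - (1 - s j) = s j - s i); last by ring.
    by rewrite mulfV ?gt_eqF// mul1r.
  have zE : x0 + T^-1 *: (y - x0) = la *: a + lb *: a' + (1 - (la + lb)) *: x0.
    have -> : T^-1 *: (y - x0) = la *: a - lb *: b - T^-1 *: x0.
      by apply/rowP => k; rewrite [in LHS]yE /la /lb !mxE; ring.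
    rewrite -lT; apply/rowP => k; rewrite /a' !mxE; ring.
  rewrite zE; have [l0|ln0] := eqVneq (la + lb) 0.
    move/eqP: l0; rewrite paddr_eq0// => /andP[/eqP -> /eqP ->].
    by rewrite addr0 subr0 !scale0r !add0r scale1r.
  have lp : 0 < la + lb by rewrite lt_neqAle eq_sym ln0 addr_ge0.
  rewrite (_ : _ + _ = (la + lb) *: ((la / (la + lb)) *: a + (1 - la / (la + lb)) *: a') +
     (1 - (la + lb)) *: x0).
    apply: (cS) => //; first by rewrite (ltW lp).
    apply: (cS) => //; rewrite divr_ge0 ?(ltW lp)//= ler_pdivrMr// mul1r lerDl//.
  by apply/rowP => k; rewrite !mxE; field.
have : (\sum_(j < N) mu (C j) <= mu Om)%E.
  have mU : measurable (\big[setU/set0]_(j < N) C j) by exact: bigsetU_measurable.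
  rewrite -(@measure_semi_additive_ord _ _ _ mu N (fun j : 'I_N => C j))//.
    apply: le_measure; rewrite ?inE//.
    rewrite -bigcup_mkord => z [j /= jN Cz]; exact: COm Cz.
  apply/trivIsetP => i j _ _ ij; apply/seteqP; split => // z [Ci Cj].
  have [l|l|/val_inj l] := ltngtP i j; [exact: Cdis l _ Ci Cj|exact: Cdis l _ Cj Ci|].
  by rewrite l eqxx in ij.
apply/negP; rewrite -ltNge.
apply: (@lt_le_trans _ _ (\sum_(j < N) (2^-1 * vS)%:E)%E); last first.
  by apply: lee_sum => j _; rewrite EFinM fineK//; exact: muC.
rewrite sumEFin sumr_const card_ord -mulr_natl -[mu Om]fineK// lte_fin -/v.
have : 2 < N%:R * w by rewrite -ltr_pdivrMr.
have NvS : N%:R * (w * v) <= N%:R * vS by rewrite ler_wpM2l// ltW.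
move=> h; have : 2 * v < N%:R * w * v by rewrite ltr_pM2r.
move: NvS; rewrite mulrA; lra.
Qed.

(** The volume of the intersection, as a function of [x], has integral vol(Om)^2 and vanishes
    outside 2 Om by convexity, a set of volume 2^n vol(Om). The factor 1/2 leaves room for a strict
    inequality in the argument by contradiction. *)
Lemma exists_large_reflection (Om : set 'rV[R]_n) : measurable Om -> convex Om -> (0 < mu Om < +oo)%E ->
  exists x : 'rV[R]_n, ((2^-1 * 2 ^- n)%:E * mu Om <= mu (Om `&` [set z | Om (x - z)%R]))%E.
Proof.
move=> mO cO /andP[nO Ooo]; apply: contrapT => /forallNP H.
have Of : mu Om \is a fin_num by rewrite ge0_fin_numE.
pose v := fine (mu Om); have v0 : 0 < v by rewrite fine_gt0// nO.
pose phi (p : 'rV[R]_n * 'rV[R]_n) : \bar R := (\1_Om p.2 * \1_Om (p.1 - p.2))%:E.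
have mI : measurable_fun setT (\1_Om : 'rV[R]_n -> R) by exact: measurable_indic.
have mphi : measurable_fun setT phi.
  apply/measurable_EFinP; apply: measurable_funM; first exact: measurableT_comp.
  apply: measurableT_comp => //; apply: measurable_row => i.
  rewrite (_ : (fun p => _) = (fun p : 'rV[R]_n * 'rV[R]_n => p.1 ord0 i - p.2 ord0 i)).
    by apply: measurable_funB; apply: (measurableT_comp (measurable_row_coord i)).
  by apply/funext => p; rewrite !mxE.
have phi0 p : (0 <= phi p)%E by rewrite lee_fin mulr_ge0// indicE.
have mR x : measurable [set z : 'rV[R]_n | Om (x - z)].
  have := measurable_row_affine (-1) x measurableT mO; rewrite setTI.
  by congr measurable; apply/funext => z; rewrite /preimage/= scaleN1r addrC.
have E1 x : (\int[mu]_z phi (x, z) = mu (Om `&` [set z | Om (x - z)%R]))%E.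
  rewrite -[X in mu X]setIT -integral_indic//; last exact: measurableI.
  apply: eq_integral => z _; rewrite /phi/= !indicE in_setI -natrM mulnb.
  by congr ((_ && _)%:R)%:E; apply/idP/idP; rewrite !inE.
have E2 z : (\int[mu]_x phi (x, z) = (\1_Om z * v)%:E)%E.
  rewrite /phi/=; under eq_integral do rewrite EFinM.
  rewrite ge0_integralZl//=.
  - rewrite (@ge0_integral_shift R n (fun x => (\1_Om x)%:E) z)//; last exact/measurable_EFinP.
    by rewrite integral_indic// setIT EFinM fineK.
  - apply/measurable_EFinP; apply: measurableT_comp => //; exact: measurable_shift.
have tot : (\int[mu]_x \int[mu]_z phi (x, z) = (v * v)%:E)%E.
  rewrite (fubini_tonelli phi mphi phi0); under eq_integral do rewrite E2 mulrC EFinM.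
  rewrite ge0_integralZl//; last 2 first.
  - exact/measurable_EFinP.
  - by rewrite lee_fin ltW.
  by rewrite integral_indic// setIT EFinM fineK.
have := tot; apply/eqP; rewrite lt_eqF//.
pose W := [set x : 'rV[R]_n | Om (2^-1 *: x + 0)].
have muW : mu W = (2 ^+ n * v)%:E.
  rewrite (@lebesgue_row_affine R n 2^-1 0 Om)//.
  by rewrite normfV exprVn invrK ger0_norm// EFinM fineK.
have mW : measurable W by have := measurable_row_affine 2^-1 0 measurableT mO; rewrite setTI.
apply: (@le_lt_trans _ _ (\int[mu]_x ((2^-1 * 2 ^- n * v) * \1_W x)%:E)%E).
  apply: ge0_le_integral => //.
  - by move=> x _; exact: integral_ge0.
  - exact: (measurable_fun_fubini_tonelli_F phi mphi phi0).
  - by apply/measurable_EFinP; apply: measurable_funM => //; exact: measurable_indic.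
  - move=> x _; rewrite E1 indicE; have [xW|/negP xW] := boolP (x \in W).
      by rewrite mulr1 EFinM fineK// ltW// ltNge; exact/negP.
    rewrite mulr0 (_ : _ `&` _ = set0) ?measure0//.
    apply/seteqP; split => // z [Oz /= Oxz]; apply: xW; rewrite inE /W/= addr0.
    rewrite (_ : 2^-1 *: x = 2^-1 *: z + (1 - 2^-1) *: (x - z)).
      by apply: cO => //; apply/andP; split; lra.
    by apply/rowP => i; rewrite !mxE; field.
under eq_integral do rewrite EFinM.
rewrite ge0_integralZl//; last 2 first.
- exact/measurable_EFinP/measurable_indic.
- by rewrite lee_fin !mulr_ge0 ?invr_ge0 ?exprn_ge0// ltW.
have -> : (\int[mu]_x (\1_W x)%:E = mu W)%E by rewrite integral_indic// setIT.
rewrite muW -EFinM lte_fin.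
rewrite (_ : _ * (2 ^+ n * v) = 2^-1 * (v * v)); last by field; rewrite expf_neq0.
by rewrite gtr_pMl ?mulr_gt0// invf_lt1// ltr1n.
Qed.

End homothety.

(** * Comparison of eigenvalues *)

Section comparison.
Context (R : realType) (n : nat).
Local Notation mu := (lebesgue_row R n).
Local Notation K0 := (8 * expR 2^-1 : R).

(** In the constant, 512 comes from the tents, 144 = 12^2 from the homothety ratio, 64 = 8^2 from
    the covering radius, and 4 K0 from the Poincare inequality on cells. *)
Context (D : R).
Hypothesis (D0 : 0 < D) (DE : D = 512 * 144 * 64 * (4 * K0)).

(** The radius [r] cancels between the two bounds. The n^4 is the n^2 of the tents times the n^2 of
    the squared homothety ratio. *)
Lemma neumann_comparison (Om Om' S : set 'rV[R]_n) (x0 : 'rV[R]_n) (w f : R) (k : nat) :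
  (0 < n)%N -> (3 <= k)%N -> open Om -> Om !=set0 -> bounded_set Om -> convex Om ->
  open Om' -> bounded_set Om' -> convex Om' -> Om `<=` Om' ->
  measurable S -> convex S -> (forall x, S x -> S (2 *: x0 - x)) -> S !=set0 -> S `<=` Om ->
  0 < w -> (w%:E * mu Om' <= mu S)%E -> 0 <= f -> f * D <= w ^+ 2 / n%:R ^+ 4 ->
  (f%:E * neumann_eigenvalue Om k <= neumann_eigenvalue Om' (k - 2))%E.
Proof.
move=> n0 k3 oO nO bO cO oO' bO' cO' OO' mS cS sS S0 SO w0 wS f0 fw.
have mO' : measurable Om' by exact: open_measurable_row.
have [r r0 [[q [Oq sq]] [m [p [mk Op pP]]]]] := exists_radius n0 k3 oO nO bO cO.
have nO' : (0 < mu Om' < +oo)%E.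
  rewrite bounded_lebesgue_row_lty// andbT open_lebesgue_row_gt0//.
  by have [x Ox] := nO; exists x; exact: OO'.
have [T /andP[T0 Tw] TP] := sub_homothety n0 mS cS sS S0 (subset_trans SO OO') mO' cO' w0 nO' wS.
have ub := neumann_eigenvalue_le_separated n0 oO bO cO r0 Oq sq.
have rT : 0 < T * (8 * r) by rewrite !mulr_gt0.
have lb := @neumann_eigenvalue_ge R n Om' oO' bO' cO' (k - 2) m (fun i => x0 + T *: (p i - x0)) _ mk rT.
apply: le_trans (lb _); last first.
  move=> y /TP[z Sz ->]; have [i zi] := pP z (SO _ Sz); exists i.
  rewrite (_ : _ - _ = T *: (z - p i)); last by apply/rowP => j; rewrite !mxE; ring.
  by rewrite dotZl dotZr mulrA -expr2 exprMn ler_wpM2l// sqr_ge0.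
clear lb TP.
have f0' : (0 <= f%:E)%E by rewrite lee_fin.
apply: (le_trans (lee_wpmul2l f0' ub)); rewrite -EFinM lee_fin.
clear ub pP.
have nR : 0 < n%:R :> R by rewrite ltr0n.
have K00 : 0 < K0 by rewrite mulr_gt0// expR_gt0.
have T2 : T ^+ 2 <= 144 * n%:R ^+ 2 / w ^+ 2.
  rewrite (_ : 144 * _ / _ = (12 * n%:R / w) ^+ 2); last by field; rewrite gt_eqF.
  rewrite lerXn2r ?nnegrE ?(ltW T0)//.
  by rewrite divr_ge0 ?(ltW w0)// mulr_ge0 ?(ltW nR).
have B0 : 0 < 4 * K0 * (T * (8 * r)) ^+ 2.
  by apply: mulr_gt0; [exact: mulr_gt0|exact: exprn_gt0].
rewrite -[leRHS]mul1r ler_pdivlMr; last exact: B0.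
have -> : f * (512 * n%:R ^+ 2 / r ^+ 2) * (4 * K0 * (T * (8 * r)) ^+ 2) =
    f * D * (n%:R ^+ 2 * (T ^+ 2 / 144)).
  by rewrite DE; field; rewrite gt_eqF.
rewrite [leRHS](_ : _ = w ^+ 2 / n%:R ^+ 4 * (n%:R ^+ 2 * (n%:R ^+ 2 / w ^+ 2))); last first.
  by field; rewrite !gt_eqF.
have n2 := sqr_ge0 (n%:R : R).
have T144 : 0 <= T ^+ 2 / 144 by apply: mulr_ge0; [exact: sqr_ge0|rewrite invr_ge0 ler0n].
have T2' : T ^+ 2 / 144 <= n%:R ^+ 2 / w ^+ 2 by rewrite ler_pdivrMr ?ltr0n// mulrC mulrA.
have fD0 := mulr_ge0 f0 (ltW D0); have nT0 := mulr_ge0 n2 T144; have nT := ler_wpM2l n2 T2'.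
exact: ler_pM.
Qed.

Lemma neumann_factor_ge0 (k : nat) (w : R) : (0 <= neumann_factor n k w)%E.
Proof.
rewrite /neumann_factor le_min; apply/andP; split; last first.
  by rewrite lee_fin invr_ge0 mulr_ge0 ?exprn_even_ge0.
apply: mule_ge0; last first.
  by rewrite lee_fin invr_ge0 mulr_ge0 ?exprn_even_ge0.
change (0 <= lne (1 - w)%:E * lne (1 - w)%:E)%E.
have [h|h] := leP 0%E (lne (1 - w)%:E); first exact: mule_ge0.
by apply: mule_le0; exact: ltW.
Qed.

(** For w < 1/2 one has |log(1 - w)| <= w / (1 - w) <= 2w. For larger w, including w = 1 where the
    logarithm is infinite, the second entry of the minimum suffices. Also log k >= 1 - 1/k >= 2/3,
    and 48 exceeds 4 (3/2)^6. *)
Lemma neumann_factor_le (k : nat) (w : R) : (0 < n)%N -> (3 <= k)%N -> 0 < w <= 1 ->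
  (neumann_factor n k w <= (48 * w ^+ 2 / n%:R ^+ 4)%:E)%E.
Proof.
move=> n0 k3 /andP[w0 w1].
have k0 : 0 < k%:R :> R by rewrite ltr0n (leq_trans _ k3).
have lnk : 2 / 3 <= ln k%:R :> R.
  have kV : 0 < k%:R^-1 :> R by rewrite invr_gt0.
  have := @le_ln1Dx R (k%:R^-1 - 1); rewrite (addrC 1) subrK lnV ?posrE//.
  have : k%:R^-1 <= 3^-1 :> R by rewrite lef_pV2 ?posrE// ler_nat.
  by move=> h /(_ _)/wrap[]; lra.
have n1 : 1 <= n%:R :> R by rewrite ler1n.
have n4 : 0 < n%:R ^+ 4 :> R by rewrite exprn_gt0// (lt_le_trans ltr01).
have Lj j : (2 / 3) ^+ j <= ln k%:R ^+ j :> R by rewrite lerXn2r ?nnegrE//; lra.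
have Lp j : 0 < ln k%:R ^+ j :> R by rewrite exprn_gt0//; lra.
have np j : 0 < n%:R ^+ j :> R by rewrite exprn_gt0// (lt_le_trans ltr01).
rewrite /neumann_factor; have [w2|w2] := leP 2^-1 w.
  rewrite ge_min; apply/orP; right; rewrite lee_fin -div1r ler_pdivrMr; last exact: mulr_gt0 (np 6%N) (Lp 4%N).
  rewrite [leRHS](_ : _ = 48 * (w ^+ 2 * n%:R ^+ 2 * ln k%:R ^+ 4)); last first.
    by field; rewrite gt_eqF// (lt_le_trans ltr01).
  have a1 : 4^-1 <= w ^+ 2.
    have -> : 4^-1 = 2^-1 ^+ 2 :> R by field.
    by rewrite lerXn2r ?nnegrE ?(ltW w0).
  have a2 : 1 <= n%:R ^+ 2 :> R by rewrite exprn_ege1.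
  have a3 := Lj 4%N; have a4 : (2 / 3) ^+ 4 = 16 / 81 :> R by field.
  have : 4^-1 * 1 * (16 / 81) <= w ^+ 2 * n%:R ^+ 2 * ln k%:R ^+ 4.
    by rewrite ler_pM ?mulr_ge0 ?invr_ge0// -?a4// ler_pM ?invr_ge0.
  lra.
rewrite ge_min; apply/orP; left; rewrite lne_EFin; last lra.
rewrite -[X in (X * _)%E]/(((ln (1 - w)) ^+ 2)%:E) -EFinM lee_fin ler_pdivrMr; last exact: mulr_gt0 (np 8%N) (Lp 6%N).
rewrite [leRHS](_ : _ = 48 * (w ^+ 2 * (n%:R ^+ 4 * ln k%:R ^+ 6))); last first.
  by field; rewrite gt_eqF// (lt_le_trans ltr01).
have l1 : ln (1 - w) <= - w by apply: le_ln1Dx; lra.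
have l2 : - (2 * w) <= ln (1 - w).
  have h0 : 0 < 1 - w by lra.
  rewrite lerNl -lnV ?posrE//.
  have -> : (1 - w)^-1 = 1 + w / (1 - w) by field; rewrite gt_eqF.
  apply: (le_trans (le_ln1Dx _)).
    by apply: (@lt_le_trans _ _ 0); [rewrite ltrN10|rewrite divr_ge0 ?(ltW w0) ?(ltW h0)].
  by rewrite ler_pdivrMr//; nra.
have lnw : ln (1 - w) ^+ 2 <= 4 * w ^+ 2 by nra.
have a2 : 1 <= n%:R ^+ 4 :> R by rewrite exprn_ege1.
have a3 := Lj 6%N; have a4 : (2 / 3) ^+ 6 = 64 / 729 :> R by field.
have a5 : 1 * (64 / 729) <= n%:R ^+ 4 * ln k%:R ^+ 6 :> R.
  by rewrite -a4; apply: ler_pM => //; exact: exprn_ge0.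
have := ler_wpM2l (sqr_ge0 w) a5.
by have := sqr_ge0 w; lra.
Qed.

End comparison.

(** The halved ratio [w / 2] accommodates the loss in the choice of the reflection, and the
    symmetric case satisfies it a fortiori; 192 is 48 times the 4 of (w / 2)^2. *)
Lemma neumann_main (R : realType) (D : R) (n k : nat) (Om Om' S : set 'rV[R]_n) (x0 : 'rV[R]_n) (w : R) :
  0 < D -> D = 512 * 144 * 64 * (4 * (8 * expR 2^-1)) ->
  (0 < n)%N -> (3 <= k)%N -> bounded_convex_domain Om -> bounded_convex_domain Om' ->
  Om `<=` Om' -> 0 < w <= 1 ->
  measurable S -> convex S -> (forall x, S x -> S (2 *: x0 - x)) -> S `<=` Om ->
  ((w / 2)%:E * lebesgue_row R n Om' <= lebesgue_row R n S)%E ->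
  (((192 * D)^-1)%:E * neumann_factor n k w * neumann_eigenvalue Om k
     <= neumann_eigenvalue Om' (k - 2))%E.
Proof.
move=> D0 DE n0 k3 [nO oO bO /convex_setE cO _] [nO' oO' bO' /convex_setE cO' _] OO' w01 mS cS sS SO wS.
have /andP[w0 w1] := w01.
have F0 := neumann_factor_ge0 n k w.
have F1 := @neumann_factor_le R n k w n0 k3 w01.
have Ff : neumann_factor n k w \is a fin_num by rewrite ge0_fin_numE// (le_lt_trans F1)// ltry.
rewrite -(fineK Ff) -EFinM.
have S0 : S !=set0.
  apply/set0P/eqP => S0; move: wS; rewrite S0 measure0 leNgt => /negP; apply.
  apply: mule_gt0; first by rewrite lte_fin divr_gt0.
  exact: open_lebesgue_row_gt0.
have f1 : fine (neumann_factor n k w) <= 48 * w ^+ 2 / n%:R ^+ 4 by rewrite -lee_fin fineK.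
have f0 : 0 <= fine (neumann_factor n k w) by exact: fine_ge0.
move: (fine _) f0 f1 => F {}F0 {}F1.
have c0 : 0 <= (192 * D)^-1 by rewrite invr_ge0; apply: mulr_ge0 => //; exact: ltW.
apply: (@neumann_comparison R n D D0 DE Om Om' S x0 (w / 2)) => //.
- exact: divr_gt0.
- exact: mulr_ge0.
- have -> : (192 * D)^-1 * F * D = F / 192 by field; rewrite gt_eqF.
  rewrite ler_pdivrMr//; apply: (le_trans F1); rewrite le_eqVlt; apply/orP; left; apply/eqP.
  by field; rewrite pnatr_eq0 -lt0n.
Qed.

Theorem theorem1p5 (R : realType) :
  exists c : R, 0 < c /\
  forall (n : nat) (Omega Omega' : set 'rV[R]_n) (k : nat),
    (1 <= n)%N ->
    bounded_convex_domain Omega ->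
    bounded_convex_domain Omega' ->
    Omega `<=` Omega' ->
    (3 <= k)%N ->
    ([set - x | x in Omega] = Omega ->
      (c%:E * neumann_factor n k (volume_ratio Omega Omega')
         * neumann_eigenvalue Omega k
       <= neumann_eigenvalue Omega' (k - 2))%E) /\
    (c%:E * neumann_factor n k (2 ^- n * volume_ratio Omega Omega')
       * neumann_eigenvalue Omega k
     <= neumann_eigenvalue Omega' (k - 2))%E.
Proof.
have [D DE] : exists D : R, D = 512 * 144 * 64 * (4 * (8 * expR 2^-1)) by eexists.
have D0 : 0 < D by rewrite DE !mulr_gt0 ?ltr0n ?expR_gt0.
exists (192 * D)^-1; split; first by rewrite invr_gt0; exact: mulr_gt0.
move=> n Om Om' k n1 dO dO' OO' k3.
have [nO oO bO /convex_setE cO _] := dO; have [nO' oO' bO' /convex_setE cO' _] := dO'.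
have mO := open_measurable_row oO; have mO' := open_measurable_row oO'.
have Op : (0 < lebesgue_row R n Om)%E by exact: open_lebesgue_row_gt0.
have O'p : (0 < lebesgue_row R n Om')%E by exact: open_lebesgue_row_gt0.
have Ooo := bounded_lebesgue_row_lty mO bO; have O'oo := bounded_lebesgue_row_lty mO' bO'.
have Of : lebesgue_row R n Om \is a fin_num by rewrite ge0_fin_numE.
have O'f : lebesgue_row R n Om' \is a fin_num by rewrite ge0_fin_numE.
have v0 : 0 < fine (lebesgue_row R n Om) by rewrite fine_gt0// Op.
have v'0 : 0 < fine (lebesgue_row R n Om') by rewrite fine_gt0// O'p.
set v := volume_ratio Om Om'.
have vE : (v%:E * lebesgue_row R n Om' = lebesgue_row R n Om)%E.
  by rewrite -(fineK O'f) -[RHS]fineK// -EFinM /v /volume_ratio divfK// gt_eqF.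
have vp : 0 < v by rewrite divr_gt0.
have v1 : v <= 1.
  rewrite ler_pdivrMr// mul1r -lee_fin !fineK//.
  by apply: le_measure; rewrite ?inE.
split.
  move=> sO; apply: (@neumann_main R D n k Om Om' Om 0 v) => //.
  - by rewrite vp.
  - by move=> x Ox; rewrite scaler0 sub0r -sO; exists x.
  - rewrite -vE; apply: lee_wpmul2r => //.
    by rewrite lee_fin ler_pdivrMr// ler_peMr ?(ltW vp)// ler1n.
have p2 : 0 < 2 ^- n :> R by rewrite invr_gt0 exprn_gt0.
have p21 : 2 ^- n <= 1 :> R by rewrite invf_le1 ?exprn_gt0// exprn_ege1// ler1n.
have [|x xP] := exists_large_reflection mO cO; first by rewrite Op.
have mR : measurable [set z : 'rV[R]_n | Om (x - z)].
  have := measurable_row_affine (-1) x measurableT mO; rewrite setTI.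
  by congr measurable; apply/funext => z; rewrite /preimage/= scaleN1r addrC.
(* The map z -> x - z is the central symmetry about x/2 and exchanges the two sets being
   intersected. *)
apply: (@neumann_main R D n k Om Om' (Om `&` [set z | Om (x - z)]) (2^-1 *: x)) => //.
- by rewrite mulr_gt0//= -[leRHS]mul1r ler_pM// ltW.
- exact: measurableI.
- move=> a b t t01 [Oa Ra] [Ob Rb]; split; first exact: cO.
  rewrite /= (_ : x - _ = t *: (x - a) + (1 - t) *: (x - b)); first exact: cO.
  by apply/rowP => i; rewrite !mxE; ring.
- move=> a [Oa Ra]; rewrite scalerA divff// scale1r; split => //=.
  by rewrite opprB addrCA subrr addr0.
- apply: le_trans xP; rewrite -vE muleA -EFinM.
  by rewrite le_eqVlt; apply/orP; left; apply/eqP; congr (_%:E * _)%E; rewrite mulrC mulrA.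
Qed.
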